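(* Let $T$ be a semistandard hook-valued tableau, $i\ge1$, and $\tilde{\mathcal U}(T)=(\tilde P(T),\tilde Q(T))$. (1) If $f_i(T)=0$, then $f_i(\tilde P(T))=0$. (2) If $e_i(T)=0$, then $e_i(\tilde P(T))=0$. (3) If $f_i(T)\ne0$, then $f_i(\tilde P(T))=\tilde P(f_i(T))$ and $\tilde Q(T)=\tilde Q(f_i(T))$. (4) If $e_i(T)\ne0$, then $e_i(\tilde P(T))=\tilde P(e_i(T))$ and $\tilde Q(T)=\tilde Q(e_i(T))$.
   Context: French notation: row $1$ is the bottom row, rows numbered upward, columns left to right; cell $(r,c)$ is in row $r$, column $c$. A semistandard tableau of hook shape $U$ consists of a hook entry $x$, a leg $\ell_1<\dots<\ell_p$ above $x$ with $x<\ell_1$, and an arm $a_1\le\dots\le a_q$ to the right of $x$ with $x\le a_1$ ($p,q\ge0$, positive integers); $\mathsf L(U)$ is the leg, $\mathsf L^+(U)=(x,\ell_1,\dots,\ell_p)$ the extended leg, $\mathsf A(U)$ the arm. A (semistandard) hook-valued tableau (HVT) of partition shape $\lambda$ is a filling of the cells of $\lambda$ by such hook tableaux with $\max(A)\le\min(B)$ whenever the cell of $A$ is left of that of $B$ in the same row, and $\max(A)<\min(C)$ whenever the cell of $A$ is below that of $C$ in the same column. Leg excess = total number of leg entries. Crystal operators: the column reading word $R(T)$ reads, for each column from left to right, the extended legs of its cells (cells top to bottom, each extended leg from top to bottom), followed by all arm entries of that column in weakly increasing order. Assign $-$ to each $i$ and $+$ to each $i+1$ in $R(T)$, and successively pair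 a $+$ that is adjacent to and left of a $-$, removing paired signs, until no more pairs. If there is no unpaired $-$, $f_i(T)=0$. Otherwise let $B$ be the cell containing the $i$ of the rightmost unpaired $-$. (M) If the cell $B^\uparrow$ above $B$ contains an $i+1$, $f_i$ removes an $i$ from $\mathsf A(B)$ and adds $i+1$ to $\mathsf A(B^\uparrow)$. (S) Otherwise, if the cell $B^\rightarrow$ right of $B$ contains an $i$ in $\mathsf L^+(B^\rightarrow)$, $f_i$ removes this $i$ from $\mathsf L^+(B^\rightarrow)$ and adds $i+1$ to $\mathsf L(B)$. (N) Otherwise $f_i$ changes that $i$ into $i+1$. If there is no unpaired $+$, $e_i(T)=0$; otherwise let $B$ be the cell containing the $i+1$ of the leftmost unpaired $+$. (M) If the cell $B^\downarrow$ below $B$ contains an $i$, $e_i$ removes the $i+1$ from $\mathsf A(B)$ and adds $i$ to $\mathsf A(B^\downarrow)$. (S) Otherwise, if the cell $B^\leftarrow$ left of $B$ contains an $i+1$ in $\mathsf L(B^\leftarrow)$, $e_i$ removes it and adds $i$ to $\mathsf L^+(B)$. (N) Otherwise $e_i$ changes that $i+1$ into $i$. Multiset uncrowding bumping $\tilde{\mathcal V}_b$: if the leg excess of $T$ is $0$, return $T$. Otherwise let $r$ be the topmost row containing a cell with nonempty leg; in that row let $(r,c)$ be the cell whose leg contains the largest value (the rightmost such cell); let $\ell$ be its largest leg entry and $a$ its rightmost arm entry. In row $r+1$ find the leftmost number strictly greater than $\ell$. If none exists, attach an empty cell at the end of row $r+1$, call it $(r+1,\tilde c)$, and let $k$ be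 empty; otherwise let $k$ be this number and $(r+1,\tilde c)$ its cell. (a) If $\tilde c\ne c$: remove $\ell$ from the leg of $(r,c)$, put $\ell$ in place of $k$ (as hook entry if the cell is new), attach $k$ (if nonempty) to the leg of $(r+1,\tilde c)$. (b) If $\tilde c=c$: remove the multiset $\{z\in\mathsf A(r,c):\ell\le z\le a\}$ from the arm of $(r,c)$ and $\ell$ from its leg, insert that multiset into the arm of $(r+1,\tilde c)$, replace the hook entry of $(r+1,\tilde c)$ by $\ell$, and attach $k$ (if nonempty) to the leg of $(r+1,\tilde c)$. Multiset uncrowding insertion: $\tilde{\mathcal V}(T)=\tilde{\mathcal V}_b^d(T)$, $d\ge1$ minimal such that the shape changes or $\tilde{\mathcal V}_b^d(T)=\tilde{\mathcal V}_b^{d-1}(T)$. Multiset uncrowding map: for $T$ of shape $\lambda$ with leg excess $\alpha$, $\tilde P_0=T$, $\tilde Q_0$ empty of shape $\lambda/\lambda$; for $1\le i\le\alpha$, $\tilde P_i=\tilde{\mathcal V}(\tilde P_{i-1})$, and $\tilde Q_i$ is $\tilde Q_{i-1}$ with the new cell $\mathsf{shape}(\tilde P_i)/\mathsf{shape}(\tilde P_{i-1})$ added and filled with $\tilde r-r$, where $\tilde r$ is the row of the new cell and $r$ the topmost row of $\tilde P_{i-1}$ containing a cell with nonzero leg excess; $\tilde{\mathcal U}(T)=(\tilde P(T),\tilde Q(T)):=(\tilde P_\alpha,\tilde Q_\alpha)$. *)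

(* Defs.v *)
From mathcomp Require Import all_boot.

Set Implicit Arguments.
Unset Strict Implicit.
Unset Printing Implicit Defensive.

(* Hook tableaux and hook-valued tableaux (French notation).           *)
(* A hook tableau U is stored as a pair (xl, arm) where                *)
(*   xl  = extended leg L^+(U) = (x, l_1, ..., l_p), increasing,       *)
(*         head xl = hook entry x, behead xl = leg L(U);               *)
(*   arm = A(U) = (a_1 <= ... <= a_q).                                 *)
(* A HVT is a seq of rows, row index 0 = bottom row (row 1 of the      *)
(* paper), each row a seq of cells from left to right.                 *)

Definition cell := (seq nat * seq nat)%type.
Definition hvt := seq (seq cell).

Definition dcell : cell := ([::], [::]).

Definition hook_entry (U : cell) : nat := head 0 U.1.
Definition leg (U : cell) : seq nat := behead U.1.
Definition entries (U : cell) : seq nat := U.1 ++ U.2.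

Definition cmax (U : cell) : nat := foldr maxn 0 (entries U).
Definition cmin (U : cell) : nat := foldr minn (head 0 (entries U)) (entries U).

Definition valid_hook (U : cell) : bool :=
  [&& U.1 != [::], sorted ltn U.1, sorted leq U.2,
      all (fun z => 0 < z) (entries U) &
      (if U.2 is a :: _ then hook_entry U <= a else true)].

Definition row (t : hvt) (r : nat) : seq cell := nth [::] t r.
Definition cellat (t : hvt) (r c : nat) : cell := nth dcell (row t r) c.
Definition has_cell (t : hvt) (r c : nat) : bool := (r < size t) && (c < size (row t r)).
Definition shape (t : hvt) : seq nat := map size t.

Definition is_HVT (t : hvt) : bool :=
  [&& all (fun rw => (rw != [::]) && all valid_hook rw) t,
      sorted geq (shape t),
      all (fun r => all (fun c => cmax (cellat t r c) <= cmin (cellat t r c.+1))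
                        (iota 0 (size (row t r)).-1)) (iota 0 (size t)) &
      all (fun r => all (fun c => cmax (cellat t r c) < cmin (cellat t r.+1 c))
                        (iota 0 (size (row t r.+1)))) (iota 0 (size t).-1)].

Definition leg_excess (t : hvt) : nat := sumn [seq size (leg U) | U <- flatten t].

Definition ins (z : nat) (s : seq nat) : seq nat := sort leq (z :: s).

Definition upd (t : hvt) (r c : nat) (fn : cell -> cell) : hvt :=
  set_nth [::] t r (set_nth dcell (row t r) c (fn (cellat t r c))).

(* Column reading word; a letter is (value, (row, column, kind)),      *)
(* kind = true : the letter lies in the extended leg of the cell,      *)
(* kind = false: the letter lies in the arm of the cell.               *)

Definition letter := (nat * (nat * nat * bool))%type.

Definition col_rows (t : hvt) (c : nat) : seq nat :=
  [seq r <- rev (iota 0 (size t)) | c < size (row t r)].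

Definition col_word (t : hvt) (c : nat) : seq letter :=
  flatten [seq [seq (z, (r, c, true)) | z <- rev (cellat t r c).1] | r <- col_rows t c]
  ++ sort (fun p q : letter => p.1 <= q.1)
       (flatten [seq [seq (z, (r, c, false)) | z <- (cellat t r c).2] | r <- col_rows t c]).

Definition rword (t : hvt) : seq letter :=
  flatten [seq col_word t c | c <- iota 0 (size (row t 0))].

(* signs: true = '+' (letter i+1), false = '-' (letter i) *)
Definition signs (i : nat) (w : seq letter) : seq (bool * letter) :=
  [seq (p.1 == i.+1, p) | p <- w & (p.1 == i) || (p.1 == i.+1)].

Fixpoint rm_pair (s : seq (bool * letter)) : seq (bool * letter) :=
  match s with
  | x :: ((y :: s'') as s') => if x.1 && ~~ y.1 then s'' else x :: rm_pair s'
  | _ => s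
  end.

(* iterate until no more pairs can be removed (size s iterations suffice) *)
Definition unpaired (s : seq (bool * letter)) : seq (bool * letter) :=
  iter (size s) rm_pair s.

(* Crystal operators f_i, e_i; None encodes the value 0.               *)

Definition f_op (i : nat) (t : hvt) : option hvt :=
  let u := unpaired (signs i (rword t)) in
  match rev [seq p <- u | ~~ p.1] with
  | [::] => None
  | p :: _ =>
    let: (_, (r, c, k)) := p.2 in
    if has_cell t r.+1 c && (i.+1 \in entries (cellat t r.+1 c)) then
      Some (upd (upd t r c (fun B => (B.1, rem i B.2)))
                r.+1 c (fun B => (B.1, ins i.+1 B.2)))
    else if has_cell t r c.+1 && (i \in (cellat t r c.+1).1) then
      Some (upd (upd t r c.+1 (fun B => (rem i B.1, B.2)))
                r c (fun B => (ins i.+1 B.1, B.2)))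
    else
      Some (upd t r c (fun B => if k then (ins i.+1 (rem i B.1), B.2)
                                 else (B.1, ins i.+1 (rem i B.2))))
  end.

Definition e_op (i : nat) (t : hvt) : option hvt :=
  let u := unpaired (signs i (rword t)) in
  match [seq p <- u | p.1] with
  | [::] => None
  | p :: _ =>
    let: (_, (r, c, k)) := p.2 in
    if (0 < r) && has_cell t r.-1 c && (i \in entries (cellat t r.-1 c)) then
      Some (upd (upd t r c (fun B => (B.1, rem i.+1 B.2)))
                r.-1 c (fun B => (B.1, ins i B.2)))
    else if (0 < c) && (i.+1 \in leg (cellat t r c.-1)) then
      Some (upd (upd t r c.-1 (fun B => (head 0 B.1 :: rem i.+1 (behead B.1), B.2)))
                r c (fun B => (ins i B.1, B.2)))
    else
      Some (upd t r c (fun B => if k then (ins i (rem i.+1 B.1), B.2)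
                                 else (B.1, ins i (rem i.+1 B.2))))
  end.

Definition top_leg_row (t : hvt) : nat :=
  last 0 [seq r <- iota 0 (size t) | has (fun U => leg U != [::]) (row t r)].

Definition legmax (U : cell) : nat := foldr maxn 0 (leg U).

Definition row_entries (rw : seq cell) : seq (nat * (nat * bool)) :=
  flatten [seq (hook_entry (nth dcell rw c), (c, true))
                 :: [seq (z, (c, false)) | z <- (nth dcell rw c).2]
          | c <- iota 0 (size rw)].

Definition bump (t : hvt) : hvt :=
  if leg_excess t == 0 then t else
  let r := top_leg_row t in
  let cols := [seq c <- iota 0 (size (row t r)) | leg (cellat t r c) != [::]] in
  let m := foldr maxn 0 [seq legmax (cellat t r c) | c <- cols] in
  let c := last 0 [seq c <- cols | legmax (cellat t r c) == m] in
  let B := cellat t r c in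
  let l := legmax B in
  let a := last 0 B.2 in
  let rowup := row t r.+1 in
  let cand := [seq p <- row_entries rowup | l < p.1] in
  let ct := if cand is p :: _ then p.2.1 else size rowup in
  let C := nth dcell rowup ct in
  if ct != c then
    let t1 := upd t r c (fun U => (take 1 U.1 ++ rem l (behead U.1), U.2)) in
    let C' :=
      match cand with
      | [::] => ([:: l], [::])
      | (k, (_, true)) :: _ => (l :: ins k (behead C.1), C.2)
      | (k, (_, false)) :: _ => (head 0 C.1 :: ins k (behead C.1), ins l (rem k C.2))
      end in
    set_nth [::] t1 r.+1 (set_nth dcell rowup ct C')
  else
    let M := [seq z <- B.2 | l <= z <= a] in
    let t1 := upd t r c (fun U => (take 1 U.1 ++ rem l (behead U.1),
                                   [seq z <- U.2 | ~~ (l <= z <= a)])) in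
    let C' :=
      match cand with
      | [::] => ([:: l], sort leq M)
      | (k, _) :: _ => (l :: ins k (behead C.1), sort leq (C.2 ++ M))
      end in
    set_nth [::] t1 r.+1 (set_nth dcell rowup ct C').

(* V~(T) = bump^d(T), d >= 1 minimal such that the shape changes or
   bump^d(T) = bump^(d-1)(T).  Such d is at most (size t).+1. *)
Fixpoint vloop (fuel : nat) (t : hvt) : hvt :=
  match fuel with
  | 0 => t
  | n.+1 => let t' := bump t in
            if (shape t' != shape t) || (t' == t) then t' else vloop n t'
  end.

Definition uncrowd_ins (t : hvt) : hvt := vloop (size t).+1 t.

(* recording tableau: grid of options, None = cell of the inner shape lambda *)
Definition qtab := seq (seq (option nat)).

Definition new_row (P P' : hvt) : nat :=
  find (fun j => size (row P' j) != size (row P j)) (iota 0 (size P')).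

Fixpoint uloop (n : nat) (P : hvt) (Q : qtab) : hvt * qtab :=
  match n with
  | 0 => (P, Q)
  | n.+1 =>
    let P' := uncrowd_ins P in
    let r := top_leg_row P in
    let rt := new_row P P' in
    let Q' := set_nth [::] Q rt (rcons (nth [::] Q rt) (Some (rt - r))) in
    uloop n P' Q'
  end.

Definition uncrowd (t : hvt) : hvt * qtab :=
  uloop (leg_excess t) t [seq nseq (size rw) None | rw <- t].

Definition Ptilde (t : hvt) : hvt := (uncrowd t).1.
Definition Qtilde (t : hvt) : qtab := (uncrowd t).2.

(* Main.v *)
(* The uncrowding map is an iteration of single bumps, and the number of bumps and all the shapes
   involved depend only on data that [f_i] preserves. So it suffices that [f_i] commutes with one
   bump.
   For the bracketing rule, each column amounts to [a] signs [-] followed by [b] signs [+]. A bump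
   moves an entry weakly to the left, hence changes at most two columns, and a study of the cases
   [l = i] and [l = i.+1] for the bumped leg entry [l] shows that it never creates an unpaired sign
   and that the last unpaired [-] stays in its column, except when it moves with the bumped entry
   or, in one case where [f_i] acts by (S), one column to the right. In each case the bump applied
   after [f_i] and [f_i] applied after the bump give the same tableau; the kind of move and the
   bumped entry may differ between the two orders.
   As [e_i] and [f_i] are partial inverses, the claims on [e_i] follow; that [e_i] still vanishes
   after uncrowding holds because the number of unpaired [+] is unchanged. *)

(* A case analysis on tableaux would have to combine (M), (S), (N) with both forms of the bump and
   with all relative positions of the cells involved. Counting the letters of each column removes
   most of this. A column increases strictly from cell to cell, so its hook entries already tell in
   which cell a value sits: (M) becomes the renaming of an arm letter, and the transfer of arm
   entries in case (b) of the bump changes no count at all. Three kinds of move remain for [f_i] and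
   two for the bump. Moves are relations given by additive equations between counts. This keeps
   truncated subtraction out of the statements and leaves the comparison of the two orders to linear
   arithmetic. The results return to tableaux because a tableau is determined by its model
   ([md_inj]). The operator [e_i] is never compared with a bump: where it does not vanish, only the
   fact that it inverts [f_i] is used. *)
From mathcomp Require Import all_boot.
From mathcomp Require Import zify.
Require Import Defs.

Set Implicit Arguments.
Unset Strict Implicit.
Unset Printing Implicit Defensive.

(** * Bracketing of column words *)

(* Column [x] contributes [a x] signs [-] followed by [b x] signs [+]; [pend a b x] is the number of
   [+] of the columns before [x] that no [-] of these columns cancels. *)
Fixpoint pend (a b : nat -> nat) (x : nat) : nat :=
  if x is y.+1 then (pend a b y - a y) + b y else 0.

Definition all_paired (a b : nat -> nat) := forall x, a x <= pend a b x.

Definition last_minus (a b : nat -> nat) (d : nat) :=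
  pend a b d < a d /\ forall x, d < x -> a x <= pend a b x.

(** Agreement from some column on means equal total numbers of unpaired [+], without fixing a width
    for either word. *)
Definition pend_stable (a b a' b' : nat -> nat) :=
  exists N, forall x, N <= x -> pend a' b' x = pend a b x.

Lemma pend_eq (a b a' b' : nat -> nat) y :
  (forall x, x < y -> a' x = a x /\ b' x = b x) -> pend a' b' y = pend a b y.
Proof.
elim: y => //= y IH H; have [-> ->] := H y (ltnSn y).
by rewrite IH // => x xy; apply: H; apply: ltnW.
Qed.

Lemma pend_eq_from (a b a' b' : nat -> nat) c y :
  pend a' b' c = pend a b c -> c <= y ->
  (forall x, c <= x -> a' x = a x) -> (forall x, c <= x -> b' x = b x) ->
  pend a' b' y = pend a b y.
Proof.
move=> Hc + Ha Hb; elim: y => [//|y IH] cy.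
have [<-//|Hne] := eqVneq c y.+1.
by rewrite /= IH ?Ha ?Hb //; lia.
Qed.

(** * Bracketing when only two columns change *)

Section Transfer.
Variables (a b a' b' : nat -> nat).

Lemma transfer_same :
  a' =1 a -> b' =1 b ->
  [/\ all_paired a b -> all_paired a' b', pend_stable a b a' b'
    & forall d, last_minus a b d -> last_minus a' b' d].
Proof.
move=> Ha Hb; have HP y : pend a' b' y = pend a b y by apply: pend_eq.
split; first by move=> H x; rewrite HP Ha.
- by exists 0.
by move=> d [H1 H2]; split; rewrite ?HP ?Ha // => x; rewrite HP Ha; apply: H2.
Qed.

Variables (e c : nat).
Hypothesis ec : e < c.
Hypothesis Ea : forall x : nat, x != e -> x != c -> a' x = a x.
Hypothesis Eb : forall x : nat, x != e -> x != c -> b' x = b x.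

Let P_le_e y : y <= e -> pend a' b' y = pend a b y.
Proof. by move=> ye; apply: pend_eq => x xy; split; [apply: Ea|apply: Eb]; lia. Qed.

Let P_gt_c y : pend a' b' c.+1 = pend a b c.+1 -> c < y -> pend a' b' y = pend a b y.
Proof. by move=> H cy; apply: (pend_eq_from H) => // x cx; [apply: Ea|apply: Eb]; lia. Qed.

(* A [+] travels from column [e] to column [c], or is cancelled together with a [-] of column [c]. *)
Lemma transfer_plus_right :
  a' e = a e -> b e = (b' e).+1 ->
  (forall x, e < x < c -> a x = 0) ->
  (a c = (a' c).+1 /\ b' c = b c \/ a c = 0 /\ a' c = 0 /\ b' c = (b c).+1) ->
  [/\ all_paired a b -> all_paired a' b', pend_stable a b a' b'
    & forall d, last_minus a b d -> last_minus a' b' d].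
Proof.
move=> ae be a0 Hc.
(* The travelling [+] meets no [-] strictly between the two columns, so its absence lowers the
   pending number by exactly one until column [c] makes up for it. *)
have Pm y : e < y <= c -> pend a b y = (pend a' b' y).+1.
  elim: y => [|y IH] Hy; first lia.
  have [<-|Hne] := eqVneq e y; first by rewrite /= P_le_e // ae be; lia.
  by rewrite /= IH ?a0 ?Ea ?a0 ?Eb //; lia.
have Pc : pend a' b' c.+1 = pend a b c.+1.
  by rewrite /= Pm; [case: Hc => [[]|[]]|]; lia.
have Pg := P_gt_c Pc.
have cmp x : a x <= pend a b x -> a' x <= pend a' b' x.
  have [xe|xe] := leqP x e.
    rewrite P_le_e //; have [->|xe'] := eqVneq x e; first by rewrite ae.
    by rewrite Ea //; lia.
  have [xc|xc] := ltnP x c; first by rewrite Ea ?a0 //; lia.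
  have [->|xc'] := eqVneq x c; last by rewrite Pg ?Ea //; lia.
  by rewrite Pm; [case: Hc => [[]|[]]|]; lia.
split; first by move=> H x; apply: cmp.
- by exists c.+1.
move=> d [H1 H2]; split; last by move=> x /H2; apply: cmp.
have [xe|xe] := leqP d e.
  rewrite P_le_e //; have [xe'|xe'] := eqVneq d e; first by rewrite xe' ae -xe'.
  by rewrite Ea //; lia.
have [xc|xc] := ltnP d c; first by move: H1; rewrite a0 //; lia.
have [xc'|xc'] := eqVneq d c; last by rewrite Pg ?Ea //; lia.
by move: H1; rewrite xc' Pm; [case: Hc => [[]|[]]|]; lia.
Qed.

(** A [-] travels from [c] to [e] across columns without signs and finds the same supply of [+]. If
    it is the only [-] of [c] and unpaired, the last unpaired [-] travels with it; if [c] held the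
    last unpaired [-] among several, one stays behind. *)
Lemma transfer_minus_left :
  a' e = (a e).+1 -> a c = (a' c).+1 -> b' e = b e -> b' c = b c ->
  (forall x, e <= x < c -> b x = 0) -> (forall x, e < x < c -> a x = 0) ->
  [/\ all_paired a b -> all_paired a' b', pend_stable a b a' b'
    & forall d, last_minus a b d ->
       if (d == c) && (a c == 1) && (pend a b c == 0) then last_minus a' b' e
       else last_minus a' b' d].
Proof.
move=> ae ac be bc b0 a0.
have Pm y : e < y <= c -> pend a b y = pend a b e - a e /\ pend a' b' y = pend a b e - (a e).+1.
  elim: y => [|y IH] Hy; first lia.
  have [<-|Hne] := eqVneq e y; first by rewrite /= P_le_e // ae be b0; lia.
  have [I1 I2] := IH ltac:(lia).
  by rewrite /= I1 I2 (@Ea y) ?(@Eb y) ?(a0 y) ?(b0 y); lia.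
have [Pc1 Pc2] := Pm c ltac:(lia).
have Pc : pend a' b' c.+1 = pend a b c.+1 by rewrite /= Pc1 Pc2 ac bc; lia.
have Pg := P_gt_c Pc.
have cmp d x : (x <= e -> a c <= pend a b c) -> d <= x -> a x <= pend a b x -> a' x <= pend a' b' x.
  move=> ace dx ax; have [xe|xe] := leqP x e.
    rewrite P_le_e //; have [E|xe'] := eqVneq x e; first by subst x; rewrite ae; lia.
    by rewrite Ea //; lia.
  have [xc|xc] := ltnP x c; first by rewrite Ea ?a0 //; lia.
  have [E|xc'] := eqVneq x c; last by rewrite Pg ?Ea //; lia.
  by subst x; lia.
split; first by move=> H x; apply: (cmp 0).
- by exists c.+1.
move=> d [H1 H2]; case: ifP => [/andP[/andP[/eqP dc /eqP a1] /eqP P0]|].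
  subst d; split; first by rewrite P_le_e // ae; lia.
  move=> x ex; have [xc|xc] := ltnP x c; first by rewrite Ea ?a0 //; lia.
  have [->|xc'] := eqVneq x c; first lia.
  by rewrite Pg ?Ea ?H2 //; lia.
move=> Hn; split; last first.
  move=> x dx; apply: (cmp d); [|lia|exact: H2].
  by move=> xe; apply: H2; lia.
have [xe|xe] := leqP d e.
  rewrite P_le_e //; have [xe'|xe'] := eqVneq d e; first by rewrite xe' in H1 *; rewrite ae; lia.
  by rewrite Ea //; lia.
have [xc|xc] := ltnP d c; first by move: H1; rewrite a0 //; lia.
have [xc'|xc'] := eqVneq d c; last by rewrite Pg ?Ea //; lia.
move: Hn H1; rewrite xc' eqxx /=; lia.
Qed.

(** A [+] travels from [c] to [e]. No [-] lies in the columns it crosses nor in [c], so its earlier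
    arrival gives it no new partner. *)
Lemma transfer_plus_left :
  a' e = a e -> b' e = (b e).+1 -> a' c = a c -> b c = (b' c).+1 ->
  (forall x, e < x <= c -> a x = 0) ->
  [/\ all_paired a b -> all_paired a' b', pend_stable a b a' b'
    & forall d, last_minus a b d -> last_minus a' b' d].
Proof.
move=> ae be ac bc a0.
have Pm y : e < y <= c -> pend a' b' y = (pend a b y).+1.
  elim: y => [|y IH] Hy; first lia.
  have [<-|Hne] := eqVneq e y; first by rewrite /= P_le_e // ae be; lia.
  by rewrite /= IH ?a0 ?Ea ?a0 ?Eb //; lia.
have Pc : pend a' b' c.+1 = pend a b c.+1.
  by rewrite /= Pm ?ac ?a0 ?bc //; lia.
have Pg := P_gt_c Pc.
have aE x : a' x = a x.
  have [->//|xe] := eqVneq x e; have [->//|xc] := eqVneq x c; exact: Ea.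
have cmp x : (a x <= pend a b x) = (a' x <= pend a' b' x).
  rewrite aE; have [xe|xe] := leqP x e; first by rewrite P_le_e.
  have [xc|xc] := leqP x c; first by rewrite a0 //; lia.
  by rewrite Pg.
split; first by move=> H x; rewrite -cmp.
- by exists c.+1.
by move=> d [H1 H2]; split; [rewrite ltnNge -cmp -ltnNge|move=> x; rewrite -cmp; apply: H2].
Qed.

(** A [+] that was bracketed inside column [c] leaves for [e], where it counts as a new [+] or
    cancels a [-], and its partner in [c] is set free. Either the gain is still pending at [c] and
    pairs the freed [-], or an unpaired [-] on the way has used it up, and then the freed [-]
    becomes the last unpaired one. *)
Lemma transfer_plus_left_unpair :
  (a' e = a e /\ b' e = (b e).+1 \/ a e = (a' e).+1 /\ b e = 0 /\ b' e = 0) ->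
  a' c = (a c).+1 -> b' c = b c ->
  (forall x, e < x < c -> b x = 0) ->
  [/\ all_paired a b -> all_paired a' b', pend_stable a b a' b'
    & forall d, last_minus a b d ->
       if (e < d < c) || (d == e) && (a' e != a e) then last_minus a' b' c
       else last_minus a' b' d].
Proof.
move=> He ac bc b0.
have Pm y : e < y <= c -> pend a' b' y = (pend a b y).+1 \/ pend a b y = 0 /\ pend a' b' y = 0.
  elim: y => [|y IH] Hy; first lia.
  have [<-|Hne] := eqVneq e y; first by rewrite /= P_le_e //; case: He => [[]|[]]; lia.
  by rewrite /= ?Ea ?Eb ?b0 //; lia.
have Pc : pend a' b' c.+1 = pend a b c.+1.
  by rewrite /= bc; have := Pm c ltac:(lia); lia.
have Pg := P_gt_c Pc.
(* If no [-] that the gain can meet before [c] is unpaired, the gain is still pending at [c]. *)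
have Pm' s y : e < y <= c -> s <= e -> (forall x, s <= x < c -> a x <= pend a b x) \/ s = e /\ a' e = a e /\ (forall x, s < x < c -> a x <= pend a b x) ->
  pend a' b' y = (pend a b y).+1.
  move=> Hy se Hs.
  have Hs' x : e < x < c -> a x <= pend a b x.
    by case: Hs => [H|[_ [_ H]]] Hx; apply: H; lia.
  have He' : a' e = a e \/ a e <= pend a b e.
    by case: Hs => [H|[_ [H _]]]; [right; apply: H; lia|left].
  elim: y Hy => [|y IH] Hy; first lia.
  have [<-|Hne] := eqVneq e y; first by rewrite /= P_le_e //; case: He => [[]|[]]; lia.
  by rewrite /= ?Ea ?Eb ?b0 ?IH //; have := Hs' y; lia.
have cmp s x : s <= e -> (forall x, s <= x -> a x <= pend a b x) \/ s = e /\ a' e = a e /\ (forall x, s < x -> a x <= pend a b x) -> s < x \/ s = x /\ a x <= pend a b x -> a' x <= pend a' b' x.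
  move=> se Hs sx.
  have Hx : a x <= pend a b x by case: Hs => [H|[_ [_ H]]]; case: sx => [|[]] //; intros; apply: H; lia.
  have [xe|xe] := leqP x e.
    rewrite P_le_e //; have [xe'|xe'] := eqVneq x e; last by rewrite Ea //; lia.
    by subst x; case: He => [[]|[]]; lia.
  have [xc|xc] := ltnP c x; first by rewrite Pg ?Ea //; lia.
  have HP : pend a' b' x = (pend a b x).+1.
    apply: (Pm' s) => //; first lia.
    by case: Hs => [H|[H1 [H2 H3]]]; [left|right; do 2!split => //] => *; [apply: H|apply: H3]; lia.
  have [E|xc'] := eqVneq x c; last by rewrite HP Ea //; lia.
  by subst x; rewrite ac HP.
split.
- by move=> H x; apply: (cmp 0) => //; [left=> *; apply: H|have := H x; lia].
- by exists c.+1.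
move=> d [H1 H2].
have Pd x : d < x -> a x <= pend a b x by apply: H2.
case: ifP => Hd.
  split; last by move=> x cx; rewrite Pg // Ea ?Pd //; lia.
  (* The unpaired [-] of column [d] absorbs the gain and no [+] follows it before [c], so the freed
     [-] finds nothing pending. *)
  have P0 y : d < y <= c -> pend a' b' y = 0 /\ pend a b y = 0.
    elim: y => [|y IH] Hy; first lia.
    have [Ed|Hne] := eqVneq d y; last first.
      have [I1 I2] := IH ltac:(lia).
      by rewrite /= I1 I2 ?Eb ?b0 //; lia.
    subst y => /=; have [E|Ne] := eqVneq d e.
      by subst d; rewrite P_le_e //; case: He => [[]|[]]; lia.
    by rewrite Ea ?Eb ?b0; [have := Pm d|..]; lia.
  by rewrite (proj1 (P0 c _)) ?ac //; lia.
have [xe|xe] := leqP d e.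
  have Hs : (d < e) \/ d = e /\ a' e = a e by lia.
  split.
    rewrite P_le_e //; suff -> : a' d = a d by [].
    by case: Hs => [?|[-> ->//]]; rewrite Ea //; lia.
  move=> x dx; case: Hs => [de|[de ae]].
    by apply: (cmp d.+1) => //; [left=> *; apply: Pd|have := Pd x; lia].
  by apply: (cmp d) => //; [right|left].
have cd : c <= d by lia.
have [E|Ne] := eqVneq d c.
  subst d; split; first by rewrite ac; have := Pm c ltac:(lia); lia.
  by move=> x cx; rewrite Pg ?Ea ?Pd //; lia.
by split; [rewrite Pg ?Ea //; lia|move=> x dx; rewrite Pg ?Ea ?Pd //; lia].
Qed.

End Transfer.

(** * A model of hook-valued tableaux *)

(* A tableau is recorded by its hook entries [hk r c], with [0] outside the shape, and by the
   multiplicities [ex c z] and [ar c z] of [z] in the extended legs and in the arms of column [c].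
   Columns increase strictly from cell to cell, so the hook entries determine the row of every
   entry: this is [inrow]. *)
Record model := Model {
  hk : nat -> nat -> nat;
  ex : nat -> nat -> nat;
  ar : nat -> nat -> nat }.

Definition inrow m r c z := (0 < hk m r c <= z) && ~~ (0 < hk m r.+1 c <= z).

Definition ent m c z := 0 < ex m c z + ar m c z.

(** The hook entry is the smallest entry of its cell, so [ent_le] expresses the row condition by
    comparing with the next hook entry alone. *)
Record valid (m : model) : Prop := Valid {
  ex_le1 : forall c z, ex m c z <= 1;
  ex_hk : forall r c, 0 < hk m r c -> ex m c (hk m r c) = 1;
  ent_row : forall c z, ent m c z -> exists r, inrow m r c z;
  hk_col : forall r c, 0 < hk m r.+1 c -> 0 < hk m r c < hk m r.+1 c;
  hk_adj : forall r c, 0 < hk m r c.+1 -> 0 < hk m r c;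
  ent_le : forall r c z, ent m c z -> inrow m r c z -> 0 < hk m r c.+1 -> z <= hk m r c.+1 }.

Definition isleg m r c z := [&& 0 < ex m c z, inrow m r c z & hk m r c < z].

(* The letters [i] and [i.+1] of column [c] are read in the order [i.+1], [i] (extended legs), [i],
   [i.+1] (arms); [na] and [nb] count the [-] and [+] that remain after pairing inside the column. *)
Definition na m i c := (ex m c i + ar m c i) - ex m c i.+1.
Definition nb m i c := ar m c i.+1 + (ex m c i.+1 - (ex m c i + ar m c i)).

(* [f_i] acts in column [d] by (S). *)
Definition hooked m i d := ex m d i.+1 = 0 /\ exists2 r, inrow m r d i & hk m r d.+1 = i.

Definition at_ (x y : nat) (x0 y0 : nat) : nat := (x == x0) && (y == y0).

Definition shift_hk m d i r c := if (c == d) && (hk m r c == i) then i.+1 else hk m r c.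

(* [FSwap] is (S), [FExt] is (N) on an extended leg; in the model (M) is the same as (N) on an arm,
   and [FArm] stands for both. *)
Inductive fkind := FArm | FExt | FSwap.

Definition fkind_at m i d k :=
  match k with
  | FArm => 0 < ar m d i /\ ~ hooked m i d
  | FExt => ar m d i = 0 /\ ~ hooked m i d
  | FSwap => hooked m i d
  end.

(** In each equation the letter lost stands on the left and the letter gained on the right. In
    [FSwap] the hook entry [i] of column [d.+1] leaves, and by [hooked_swap] the leg entry [i.+1] of
    the same cell succeeds it; hence the shift in column [d.+1]. *)
Definition fmove m i d k m' :=
  match k with
  | FArm => [/\ forall r c, hk m' r c = hk m r c,
               forall c z, ex m' c z = ex m c z
             & forall c z, ar m' c z + at_ c z d i = ar m c z + at_ c z d i.+1]
  | FExt => [/\ forall r c, hk m' r c = shift_hk m d i r c,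
               forall c z, ex m' c z + at_ c z d i = ex m c z + at_ c z d i.+1
             & forall c z, ar m' c z = ar m c z]
  | FSwap => [/\ forall r c, hk m' r c = shift_hk m d.+1 i r c,
               forall c z, ex m' c z + at_ c z d.+1 i = ex m c z + at_ c z d i.+1
             & forall c z, ar m' c z = ar m c z]
  end.

(** Rows increase weakly, so the rightmost cell with a leg in row [r] also has the largest leg entry
    of that row. The entry selected by the bump is thus found by row, then column, then value. *)
Definition topleg m r c l :=
  isleg m r c l /\
  forall r' c' z, isleg m r' c' z -> r' < r \/ r' = r /\ (c' < c \/ c' = c /\ z <= l).

(* What [l] bumps: a hook entry (or nothing, in a new cell), or the arm entry [k]. *)
Inductive bkind := BHook | BArm of nat.

(** In [BHook] it suffices that the cell to the left has no entry above [l], since rows increase.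
    The alternatives [0 < hk m r.+2 _ <= z] set aside the entries of higher cells, because [ent]
    does not know rows. *)
Definition target m r l e k :=
  match k with
  | BHook => (hk m r.+1 e = 0 \/ l < hk m r.+1 e) /\
      (forall e', e = e'.+1 -> 0 < hk m r.+1 e' /\
         forall z, ent m e' z -> z <= l \/ 0 < hk m r.+2 e' <= z)
  | BArm k => [/\ 0 < hk m r.+1 e <= l, 0 < ar m e k, l < k,
      ~~ (0 < hk m r.+2 e <= k) & forall z, ent m e z -> z <= l \/ k <= z]
  end.

(** A bumped hook entry stays in the extended leg of its cell, so only [l] changes its column. Case
    (b) is [BHook] with [e = c]: no count changes, and the new hook entry [l] by itself assigns the
    arm entries from [l] on to row [r.+1]. *)
Definition bmove m r c l e k m' :=
  match k with
  | BHook => [/\ forall r' c', hk m' r' c' = if (r' == r.+1) && (c' == e) then l else hk m r' c',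
      forall c' z, ex m' c' z + at_ c' z c l = ex m c' z + at_ c' z e l
    & forall c' z, ar m' c' z = ar m c' z]
  | BArm k => [/\ forall r' c', hk m' r' c' = hk m r' c',
      forall c' z, ex m' c' z + at_ c' z c l = ex m c' z + at_ c' z e k
    & forall c' z, ar m' c' z + at_ c' z e k = ar m c' z + at_ c' z e l]
  end.

Definition meq m m' := [/\ forall r c, hk m r c = hk m' r c,
   forall c z, ex m c z = ex m' c z & forall c z, ar m c z = ar m' c z].

Section Valid.
Variable m : model.
Hypothesis vm : valid m.

Lemma hk_row_lt s r c : s < r -> 0 < hk m r c -> 0 < hk m s c < hk m r c.
Proof.
elim: r => // r IH sr /(hk_col vm) H.
have [->//|ne] := eqVneq s r.
have := IH ltac:(lia) ltac:(lia); lia.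
Qed.

Lemma hk_row_le s r c : s <= r -> 0 < hk m r c -> 0 < hk m s c <= hk m r c.
Proof.
move=> sr H; have [->|ne] := eqVneq s r; first lia.
have := @hk_row_lt s r c ltac:(lia) H; lia.
Qed.

Lemma inrow_hk r c : 0 < hk m r c -> inrow m r c (hk m r c).
Proof. by move=> H; rewrite /inrow; have := @hk_col m vm r c; lia. Qed.

Lemma ent_hk r c : 0 < hk m r c -> ent m c (hk m r c).
Proof. by move=> H; rewrite /ent ex_hk. Qed.

Lemma hk_col_le r c c' : c <= c' -> 0 < hk m r c' -> 0 < hk m r c <= hk m r c'.
Proof.
elim: c' => [|c' IH] cc H; first by move: cc; rewrite leqn0 => /eqP ->; lia.
have [->|ne] := eqVneq c c'.+1; first lia.
have H' := hk_adj vm H.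
have := ent_le vm (ent_hk H') (inrow_hk H') H.
have := IH ltac:(lia) H'; lia.
Qed.

Lemma inrow_uniq r s c z : inrow m r c z -> inrow m s c z -> r = s.
Proof.
wlog rs : r s / r <= s => [H|Hr Hs].
  by have [/H//|/ltnW/H H1] := leqP r s; move=> ? ?; apply/esym/H1.
have [//|ne] := eqVneq r s; move: Hr Hs; rewrite /inrow => Hr Hs.
have := @hk_row_le r.+1 s c ltac:(lia); lia.
Qed.

Lemma hk_uniq r s c z : 0 < z -> hk m r c = z -> inrow m s c z -> r = s.
Proof. by move=> z0 E; apply: inrow_uniq; rewrite -E; apply: inrow_hk; rewrite E. Qed.

Lemma hk_inj r s c z : 0 < z -> hk m r c = z -> hk m s c = z -> r = s.
Proof. by move=> z0 E E'; apply: (hk_uniq z0 E); rewrite -E'; apply: inrow_hk; rewrite E'. Qed.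

(** An entry in a row [s <= r] is bounded in turn by the hook entries at [(s, c.+1)], [(s, c')] and
    [(r, c')]; any other entry lies above row [r]. In this form the row condition applies to columns
    that are not adjacent. *)
Lemma ent_dich r c c' z : ent m c z -> c < c' -> 0 < hk m r c' ->
  z <= hk m r c' \/ 0 < hk m r.+1 c <= z.
Proof.
move=> ez cc Hr; have [s Hs] := ent_row vm ez.
have [sr|sr] := leqP s r; [left|right].
  have H1 := hk_row_le sr Hr; have H2 := @hk_col_le s c.+1 c' cc ltac:(lia).
  have := ent_le vm ez Hs ltac:(lia); lia.
have := @hk_row_le r.+1 s c sr; move: Hs; rewrite /inrow; lia.
Qed.

Lemma inrow_ent_le r c c' z : ent m c z -> inrow m r c z -> c < c' -> 0 < hk m r c' -> z <= hk m r c'.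
Proof.
move=> ez Hz cc Hr; have := ent_dich ez cc Hr; move: Hz; rewrite /inrow; lia.
Qed.

End Valid.

(** * Signatures under one bump *)

Section Bump.
Variables (m : model) (r c l e : nat) (bk : bkind) (i : nat).
Hypothesis vm : valid m.
Hypothesis top : topleg m r c l.
Hypothesis tgt : target m r l e bk.

(** The values not below the bumped entry; there are none if [l] goes to a new cell. *)
Definition big z := match bk with BHook => 0 < hk m r.+1 e <= z | BArm k => k <= z end.

Definition is_hook k := if k is BHook then true else false.

Lemma top_ex : ex m c l = 1.
Proof. by case: top => /and3P[H _ _] _; have := ex_le1 vm c l; lia. Qed.

Lemma top_hk : 0 < hk m r c < l.
Proof. by case: top => /and3P[_ + H] _; rewrite /inrow; lia. Qed.

Lemma top_inrow : inrow m r c l.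
Proof. by case: top => /and3P[]. Qed.

Lemma top_above : 0 < hk m r.+1 c -> l < hk m r.+1 c.
Proof. by have := top_inrow; rewrite /inrow; lia. Qed.

Lemma big_gt z : big z -> l < z.
Proof. rewrite /big; case: bk tgt => [[]|k' []] *; lia. Qed.

(** The hook entry above [(r, c)], if present, exceeds [l], so the search in row [r.+1] stops at
    column [c] at the latest, and before it if an arm entry is bumped. The left side is also the
    first column in which every entry above row [r] is [big]. *)
Lemma e_le_c : e + ~~ is_hook bk <= c.
Proof.
have Ha := top_above.
case: bk tgt => [[H1 H2]|k [H1 H2 H3 H4 H5]] /=.
  rewrite addn0 leqNgt; apply/negP => ce.
  case: e ce H1 H2 => // e' ce _ /(_ e' erefl) [H2 H3].
  have H4 := hk_col_le vm (r:=r.+1) (c:=c) (c':=e') ltac:(lia) H2.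
  have := H3 _ (ent_hk vm H2); have := hk_col vm (r:=r.+1) (c:=e'); lia.
rewrite addn1 ltnNge; apply/negP => ce.
have := hk_col_le vm (r:=r.+1) ce; lia.
Qed.

Lemma high_big x z : e + ~~ is_hook bk <= x -> 0 < hk m r.+1 x <= z -> big z.
Proof.
rewrite /big; case: bk tgt => [[H1 H2]|k [H1 H2 H3 H4 H5]] /=.
  by rewrite addn0 => ex H; have := hk_col_le vm (r:=r.+1) ex; lia.
rewrite addn1 => ex H.
have ek : ent m e k by rewrite /ent; lia.
have := ent_dich vm (r:=r.+1) ek ex; lia.
Qed.

(** As [hk m r c < l], the columns that [l] passes contain neither [l] nor a value between [l] and
    the bumped entry. This is why the moved letter crosses so few signs. *)
Lemma mid_dich x z : ent m x z -> e + ~~ is_hook bk <= x < c -> z <= hk m r c \/ big z.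
Proof.
move=> ez /andP[ex xc]; have := ent_dich vm (r:=r) ez xc.
have := @high_big x z ex; have := top_hk; lia.
Qed.

Lemma top_dich z : 0 < ex m c z -> z <= l \/ big z.
Proof.
move=> ez; have [s Hs] := ent_row vm (z:=z) (c:=c) ltac:(rewrite /ent; lia).
have [sr|sr] := leqP s r.
  left; have [E|ne] := eqVneq s r.
    subst s; have [H|H] := ltnP (hk m r c) z; last by have := top_hk; lia.
    have := (proj2 top) r c z; rewrite /isleg ez Hs H /= => /(_ isT); lia.
  have := hk_row_le vm (s:=s.+1) (r:=r) (c:=c) ltac:(lia); have := top_hk.
  by move: Hs; rewrite /inrow; lia.
right; apply: (high_big e_le_c).
have := hk_row_le vm (s:=r.+1) (r:=s) (c:=c) ltac:(lia).
by move: Hs; rewrite /inrow; lia.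
Qed.

Lemma no_leg_above x z : 0 < ex m x z -> 0 < hk m r.+1 x <= z -> z = hk m r.+1 x \/ 0 < hk m r.+2 x <= z.
Proof.
move=> ez Hz; have [s Hs] := ent_row vm (z:=z) (c:=x) ltac:(rewrite /ent; lia).
have [sr|sr] := ltnP r.+1 s.
  right; have := hk_row_le vm (s:=r.+2) (r:=s) (c:=x) ltac:(lia).
  by move: Hs; rewrite /inrow; lia.
have [E|ne] := eqVneq s r.+1; last first.
  have := hk_row_le vm (s:=s.+1) (r:=r.+1) (c:=x) ltac:(lia).
  by move: Hs; rewrite /inrow; lia.
left; subst s; have [H|H] := ltnP (hk m r.+1 x) z; last by lia.
have := (proj2 top) r.+1 x z; rewrite /isleg ez Hs H /= => /(_ isT); lia.
Qed.

Variable (m2 : model).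
Hypothesis mv : bmove m r c l e bk m2.

Lemma bmove_ex c' z : ex m2 c' z + at_ c' z c l = ex m c' z + at_ c' z e (if bk is BArm k then k else l).
Proof. by case: bk mv => [|k] []. Qed.

Lemma bmove_ar c' z : ar m2 c' z + (if bk is BArm k then at_ c' z e k else 0) =
   ar m c' z + (if bk is BArm k then at_ c' z e l else 0).
Proof. by case: bk mv => [|k] [] *; rewrite ?addn0. Qed.

Lemma bmove_other c' z : (c' != c) -> (c' != e) -> ex m2 c' z = ex m c' z /\ ar m2 c' z = ar m c' z.
Proof.
move=> H1 H2; have := bmove_ex c' z; have := bmove_ar c' z; rewrite /at_.
case: bk => [|k]; lia.
Qed.

Lemma bmove_off x : (x != e) -> (x != c) -> na m2 i x = na m i x /\ nb m2 i x = nb m i x.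
Proof.
move=> H1 H2; rewrite /na /nb.
by case: (bmove_other i H2 H1) => -> ->; case: (bmove_other i.+1 H2 H1) => -> ->.
Qed.
Hypothesis i0 : 0 < i.

(** The hook entry [i] that makes (S) apply and the leg entry [l = i.+1] lie in one cell, as no hook
    entry of the column fits between them. *)
Lemma hooked_top d : l = i.+1 -> hooked m i d -> d.+1 = c ->
  [/\ hk m r c = i, inrow m r d i & e + ~~ is_hook bk <= d].
Proof.
move=> li [u0 [s Hs hs]] dc; have Ht := top_hk; have Ha := top_above.
have sr : s = r.
  rewrite dc in hs.
  have := hk_row_lt vm (s:=s) (r:=r) (c:=c); have := hk_row_le vm (s:=r.+1) (r:=s) (c:=c); lia.
subst s; split=> //; first by rewrite -dc.
have noh : hk m r.+1 d <> i.+1.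
  by move=> E; have := ex_hk vm (r:=r.+1) (c:=d); rewrite E u0; lia.
have Hi : 0 < hk m r.+1 d -> i < hk m r.+1 d by move: Hs; rewrite /inrow; lia.
have := e_le_c; case: bk tgt => [[H1 H2]|k [H1 H2 H3 H4 H5]] /=; rewrite ?addn0 ?addn1 => ec.
  rewrite leqNgt; apply/negP => de; have [H3 H4] := H2 d ltac:(lia).
  have := H4 _ (ent_hk vm H3); have := hk_col vm (r:=r.+1) (c:=d); lia.
have [E|ne] := eqVneq e d; last by lia.
by subst d; lia.
Qed.

Let a := na m i.
Let b := nb m i.
Let a2 := na m2 i.
Let b2 := nb m2 i.

(** The last unpaired [-] stays in its column, or it is [l] and follows it to [e], or the departure
    of [l = i.+1] frees the hook entry [i] of [(r, c)], which takes over from column [d = c - 1].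
    The negations in the first alternative make the alternatives exclusive, which the commutation
    lemmas rely on. *)
Lemma bump_sig :
 [/\ all_paired a b -> all_paired a2 b2, pend_stable a b a2 b2 &
     forall d, last_minus a b d ->
     [\/ [/\ last_minus a2 b2 d, ~ [/\ l = i, d = c & ar m c i = 0]
           & ~ [/\ l = i.+1, d.+1 = c & hooked m i d]],
         [/\ l = i, d = c, ar m c i = 0, ~~ big i.+1 & last_minus a2 b2 e]
       | [/\ l = i.+1, d.+1 = c, hooked m i d, hk m r c = i & last_minus a2 b2 c]]].
Proof.
have top1 := top_ex; have toph := top_hk; have Hec := e_le_c.
have off := bmove_off.
have EXc0 := bmove_ex c i; have EXc1 := bmove_ex c i.+1; have EXe0 := bmove_ex e i; have EXe1 := bmove_ex e i.+1.
have ARc0 := bmove_ar c i; have ARc1 := bmove_ar c i.+1; have ARe0 := bmove_ar e i; have ARe1 := bmove_ar e i.+1.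
have uc1 := ex_le1 vm c i.+1; have ue1 := ex_le1 vm e i.+1.
have vc1 := ex_le1 vm c i; have ve1 := ex_le1 vm e i.
have [E|nec] := eqVneq e c.
  have Hh : is_hook bk by case: bk Hec => [|k] //=; lia.
  have aE : a2 =1 a.
    move=> x; rewrite /a2 /a; have [xe|ne] := eqVneq x e; last by have [] := off x ne ltac:(lia).
    subst x; rewrite /na; case: bk Hh EXe0 EXe1 ARe0 ARe1 => [|k] //= _; rewrite E /at_; lia.
  have bE : b2 =1 b.
    move=> x; rewrite /b2 /b; have [xe|ne] := eqVneq x e; last by have [] := off x ne ltac:(lia).
    subst x; rewrite /nb; case: bk Hh EXe0 EXe1 ARe0 ARe1 => [|k] //= _; rewrite E /at_; lia.
  have [T1 T2 T3] := transfer_same aE bE; split=> // d Hd.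
  have [|ncase] := boolP [&& l == i, d == c & ar m c i == 0].
    case/and3P => /eqP li /eqP dc /eqP a0; constructor 2; split=> //; last by rewrite E -dc; apply: T3.
    apply/negP => Hb; have [Hd1 _] := Hd.
    move: Hd1 Hb; rewrite /a /na dc a0 /big -E; case: bk Hh tgt => [|] //= _ [H1 _].
    move=> H2 H3.
    have E2 : hk m r.+1 e = i.+1 by lia.
    by have := ex_hk vm (r:=r.+1) (c:=e); rewrite E2; lia.
  constructor 1; split; first exact: T3.
    by move=> [li dc a0]; move: ncase; rewrite li dc a0 !eqxx.
  by move=> [li dc Hk]; have [] := hooked_top li Hk dc; move: Hh; case: bk => //=; lia.
have ec : e < c by lia.
have zi x : ent m x i = false -> ex m x i = 0 /\ ar m x i = 0 by rewrite /ent; lia.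
have zi1 x : ent m x i.+1 = false -> ex m x i.+1 = 0 /\ ar m x i.+1 = 0 by rewrite /ent; lia.
have bl z : big z -> l < z by apply: big_gt.
have mid x z := @mid_dich x z.
have HT := hooked_top; have HB := high_big.
have vtop : ex m c i.+1 > 0 -> i.+1 <= l \/ big i.+1 by apply: top_dich.
have offa x : x != e -> x != c -> a2 x = a x by move=> h1 h2; have [] := off x h1 h2.
have offb x : x != e -> x != c -> b2 x = b x by move=> h1 h2; have [] := off x h1 h2.
have notC d : l <> i.+1 -> ~ [/\ l = i.+1, d.+1 = c & hooked m i d] by move=> H [].
have notA d : l <> i -> ~ [/\ l = i, d = c & ar m c i = 0] by move=> H [].
have aext : forall k, bk = BArm k -> ex m e k = 0.
  move=> k Ek; move: tgt; rewrite Ek => -[H1 H2 H3 H4 H5].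
  by have := no_leg_above (x:=e) (z:=k); lia.
rewrite /a /a2 /b /b2 in offa offb *.
have nec' : (e == c) = false by lia.
have nce' : (c == e) = false by lia.
have nS : (i.+1 == i) = false by lia.
have nS' : (i == i.+1) = false by lia.
have [li|nli] := eqVneq l i.
  subst l.
  have mid0 x : e + ~~ is_hook bk <= x < c -> ex m x i = 0 /\ ar m x i = 0.
    by move=> Hx; apply: zi; apply/negP => H; have := bl i; have := mid x i H Hx; lia.
  have ma0 x : e < x < c -> na m i x = 0.
    by move=> Hx; rewrite /na; have := mid0 x; lia.
  (* If [big i.+1] holds, the bumped entry is [i.+1] itself: it ends in an extended leg, where it
     brackets the arriving [i], so column [e] loses a [+]. *)
  have [bi|nbi] := boolP (big i.+1).
    have [ae be] : na m2 i e = na m i e /\ nb m i e = (nb m2 i e).+1.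
      move: bi; rewrite /na /nb /big.
      case Ek: bk tgt mid0 aext EXe0 EXe1 ARe0 ARe1 => [|k] /=.
        rewrite addn0 /at_ nec' ?nS ?nS' !eqxx /= => -[H1 _] /(_ e); rewrite leqnn ec => /(_ isT).
        have := ex_hk vm (r:=r.+1) (c:=e).
        move=> Hx [-> ->] _ E0 E1 A0 A1 Hb.
        have E : hk m r.+1 e = i.+1 by lia.
        by rewrite E in Hx; lia.
      rewrite /at_ nec' ?nS ?nS' !eqxx /= => -[H1 H2 H3 H4 H5] _ /(_ k erefl) Hx E0 E1 A0 A1 Hb.
      have E : k = i.+1 by lia.
      by subst k; lia.
    have Hc : (na m i c = (na m2 i c).+1 /\ nb m2 i c = nb m i c \/ na m i c = 0 /\ na m2 i c = 0 /\ nb m2 i c = (nb m i c).+1).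
      move: EXc0 EXc1 ARc0 ARc1; rewrite /na /nb /at_ nce' ?nS ?nS' !eqxx /=.
      case: bk => [|k] /=; lia.
    have [T1 T2 T3] := transfer_plus_right ec offa offb ae be ma0 Hc.
    split=> // d Hd; constructor 1; split; [exact: T3| |apply: notC; lia].
    move=> [_ dc a0]; subst d.
    (* The [+] of column [e] is still pending at [c], so a lone [i] there is paired. *)
    have Pm y : e < y <= c -> 0 < pend (na m i) (nb m i) y.
      elim: y => [|y IH] Hy; first lia.
      have [E|ne] := eqVneq e y; first by subst y; rewrite /= be; lia.
      by rewrite /= (ma0 y); lia.
    have := Pm c ltac:(lia); case: Hd => + _; rewrite /na a0; lia.
  have uc0 : ex m c i.+1 = 0 by move: vtop nbi; lia.
  have [ae be] : na m2 i e = (na m i e).+1 /\ nb m2 i e = nb m i e.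
    move: nbi; rewrite /na /nb /big.
    case Ek: bk tgt mid0 zi1 mid aext EXe0 EXe1 ARe0 ARe1 => [|k] /=.
      rewrite addn0 /at_ nec' ?nS ?nS' !eqxx /= => -[H1 _] /(_ e); rewrite leqnn ec => /(_ isT).
      move=> [-> ->] /(_ e) H /(_ e i.+1); rewrite leqnn ec /big Ek /= => mid' _ E0 E1 A0 A1 Hb.
      have [] : ex m e i.+1 = 0 /\ ar m e i.+1 = 0 by apply: H; apply/negP => /mid'/(_ isT); lia.
      lia.
    rewrite /at_ nec' ?nS ?nS' !eqxx /= => -[H1 H2 H3 H4 H5] _ /(_ e) H _ /(_ k erefl) Hx E0 E1 A0 A1 Hb.
    have [] : ex m e i.+1 = 0 /\ ar m e i.+1 = 0 by apply: H; apply/negP => /H5; lia.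
    lia.
  have [ac bc] : na m i c = (na m2 i c).+1 /\ nb m2 i c = nb m i c.
    move: EXc0 EXc1 ARc0 ARc1; rewrite /na /nb /at_ nce' ?nS ?nS' !eqxx /=.
    case: bk => [|k] /=; lia.
  (* With [ma0] this says that [i] moves left without crossing any sign. *)
  have b0 x : e <= x < c -> nb m i x = 0.
    move=> Hx.
    have [] : ex m x i.+1 = 0 /\ ar m x i.+1 = 0; last by rewrite /nb; lia.
    apply: zi1; apply/negP => Hz.
    case Ek: bk tgt mid nbi => [|k] /=.
      by move=> _ /(_ x i.+1 Hz); rewrite addn0 Hx => /(_ isT); lia.
    move=> [H1 H2 H3 H4 H5] /(_ x i.+1 Hz); rewrite addn1 /big Ek => mid'.
    have [E|ne] := eqVneq e x; last by have := mid' ltac:(lia); lia.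
    by subst x; have := H5 _ Hz; lia.
  have [T1 T2 T3] := transfer_minus_left ec offa offb ae ac be bc b0 ma0.
  split=> // d Hd; have := T3 d Hd; case: ifP.
    case/andP => /andP[/eqP dc /eqP a1] /eqP P0 Hd'; constructor 2; split=> //.
    by move: a1; rewrite /na uc0 top1; lia.
  move=> Hn Hd'; constructor 1; split=> //; last by apply: notC; lia.
  move=> [_ dc a0]; subst d; case: Hd => Hd _; move: Hn Hd.
  have -> : na m i c = 1 by rewrite /na uc0 top1 a0.
  by rewrite eqxx; lia.
have [li|nli1] := eqVneq l i.+1.
  subst l.
  have nbi1 : ~ big i.+1 by move/bl; lia.
  have nbi : ~ big i by move/bl; lia.
  have mid1 x : e + ~~ is_hook bk <= x < c -> ex m x i.+1 = 0 /\ ar m x i.+1 = 0.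
    by move=> Hx; apply: zi1; apply/negP => H; have := mid x i.+1 H Hx; lia.
  have b0 x : e < x < c -> nb m i x = 0.
    move=> Hx; have [] := mid1 x ltac:(case: bk; lia); rewrite /nb; lia.
  have ac : ex m c i + ar m c i > 0 -> na m2 i c = (na m i c).+1 /\ nb m2 i c = nb m i c.
    move: EXc0 EXc1 ARc0 ARc1; rewrite /na /nb /at_ nce' ?nS ?nS' !eqxx /=.
    case: bk => [|k] /=; lia.
  have ac0 : ex m c i + ar m c i = 0 -> na m2 i c = na m i c /\ nb m i c = (nb m2 i c).+1.
    move: EXc0 EXc1 ARc0 ARc1; rewrite /na /nb /at_ nce' ?nS ?nS' !eqxx /=.
    case: bk => [|k] /=; lia.
  have arme k : bk = BArm k -> na m2 i e = na m i e /\ nb m2 i e = (nb m i e).+1.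
    move=> Ek; move: tgt EXe0 EXe1 ARe0 ARe1; rewrite Ek /= => -[H1 H2 H3 H4 H5].
    rewrite /na /nb /at_ nec' ?nS ?nS' !eqxx /=; lia.
  have hooke : is_hook bk -> [/\ ex m2 e i = ex m e i, ar m2 e i = ar m e i, ex m2 e i.+1 = 1 & ar m2 e i.+1 = 0]
      /\ (ex m e i.+1 = 0 /\ ar m e i.+1 = 0).
    move=> Ek; move: (mid1 e) EXe0 EXe1 ARe0 ARe1; move: Ek; case: bk => //= _.
    rewrite addn0 leqnn ec => /(_ isT) H.
    rewrite /na /nb /at_ nec' ?nS ?nS' !eqxx /=; split; last lia.
    split; lia.
  (* Without an [i] in column [c] a [+] travels; otherwise [l = i.+1] was bracketed inside the
     column and sets a [-] free. *)
  have [/ac [ac1 bc1]|pc] := ltnP 0 (ex m c i + ar m c i); last first.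
    have hkc : hk m r c <> i.
      by move=> E; have := ex_hk vm (r:=r) (c:=c); rewrite E; lia.
    have mid0 x : e + ~~ is_hook bk <= x < c -> ex m x i = 0 /\ ar m x i = 0.
      by move=> Hx; apply: zi; apply/negP => H; have := mid x i H Hx; lia.
    have [ac1 bc1] := ac0 ltac:(lia).
    have a0 x : e < x <= c -> na m i x = 0.
      move=> Hx; have [E|ne] := eqVneq x c; first by subst x; rewrite /na; lia.
      have [] := mid0 x ltac:(case: bk; lia); rewrite /na; lia.
    have [ae be] : na m2 i e = na m i e /\ nb m2 i e = (nb m i e).+1.
      case Ek: bk arme hooke mid0 => [|k]; last by move=> /(_ k erefl).
      move=> _ /(_ isT) [[H1 H2 H3 H4] [H5 H6]] /(_ e); rewrite addn0 leqnn ec => /(_ isT) [H7 H8].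
      rewrite /na /nb; lia.
    have [T1 T2 T3] := transfer_plus_left ec offa offb ae be ac1 bc1 a0.
    split=> // d Hd; constructor 1; split; [exact: T3|apply: notA; lia|].
    by move=> [li dc Hk]; have [] := HT _ li Hk dc.
  have He : na m2 i e = na m i e /\ nb m2 i e = (nb m i e).+1 \/
            na m i e = (na m2 i e).+1 /\ nb m i e = 0 /\ nb m2 i e = 0.
    case Ek: bk arme hooke => [|k]; last by move=> /(_ k erefl) H; left.
    move=> _ /(_ isT) [[H1 H2 H3 H4] [H5 H6]].
    rewrite /na /nb; lia.
  have [T1 T2 T3] := transfer_plus_left_unpair ec offa offb He ac1 bc1 b0.
  split=> // d Hd; have := T3 d Hd; case: ifP => Hn Hd'; last first.
    constructor 1; split=> //; first by apply: notA; lia.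
    move=> [_ dc Hk]; have [hkc Hr Hed] := HT _ erefl Hk dc.
    move: Hn; case Ek: bk Hed He hooke => [|k] /=; rewrite ?addn0 ?addn1 => Hed He hooke; last lia.
    have [E|ne] := eqVneq e d; last by lia.
    subst d; have [[H1 H2 H3 H4] [H5 H6]] := hooke isT.
    have : 0 < na m i e by case: Hd => + _; lia.
    rewrite /na; lia.
  have Hxd : e + ~~ is_hook bk <= d < c.
    move: Hn arme; case: bk => [|k] /=; rewrite ?addn0 ?addn1; first lia.
    by move=> Hn /(_ k erefl); have [E|ne] := eqVneq d e; [subst d|]; lia.
  have [Hd1 Hd2] := Hd.
  have entd : ent m d i by move: Hd1; rewrite /ent /na; lia.
  have hkc : hk m r c = i by have := mid d i entd Hxd; lia.
  have nohd x : e + ~~ is_hook bk <= x < c -> ~~ (0 < hk m r.+1 x <= i).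
    by move=> Hx; apply/negP => H; apply: nbi; apply: (HB x); [case/andP: Hx|].
  (* Otherwise the row condition forces the hook entry at [(r, d.+1)] to be [i], and this is an
     unpaired [-] to the right of [d]. *)
  have dc : d.+1 = c.
    have [//|ne] := eqVneq d.+1 c.
    have Hd1c : e + ~~ is_hook bk <= d.+1 < c by lia.
    have hd1 := hk_col_le vm (r:=r) (c:=d.+1) (c':=c) ltac:(lia) ltac:(lia).
    have := ent_dich vm (r:=r) entd (ltnSn d) ltac:(lia).
    have := nohd d Hxd => nh Hor.
    have Ehk : hk m r d.+1 = i by lia.
    have := ex_hk vm (r:=r) (c:=d.+1); rewrite Ehk => /(_ i0) v1.
    have [u0 q0] := mid1 d.+1 Hd1c.
    have := Hd2 d.+1 (ltnSn d); rewrite /=.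
    have a1 : 0 < na m i d.+1 by rewrite /na v1 u0.
    have bd : nb m i d = 0 by have [] := mid1 d Hxd; move: Hd1; rewrite /nb /na; lia.
    by clear -Hd1 a1 bd; lia.
  have u0 : ex m d i.+1 = 0 by case: (mid1 d Hxd).
  have hkd := hk_col_le vm (r:=r) (c:=d) (c':=c) ltac:(lia) ltac:(lia).
  constructor 3; split=> //; split=> //; exists r; last by rewrite dc.
  by rewrite /inrow nohd // andbT; lia.
(* Here [l] is not a letter of the word. A bumped [i] counts alike in arm and leg; so does a bumped
   [i.+1], because column [e] then contains no [i]. *)
have [aE bE] : (forall x, na m2 i x = na m i x) /\ (forall x, nb m2 i x = nb m i x); last first.
  have [T1 T2 T3] := transfer_same aE bE; split=> // d /T3 Hd'; constructor 1.
  by split=> //; [apply: notA|apply: notC]; lia.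
have cE : na m2 i c = na m i c /\ nb m2 i c = nb m i c.
  by move: EXc0 EXc1 ARc0 ARc1; rewrite /na /nb /at_ nce'; case: bk => [|k]; lia.
have eE : na m2 i e = na m i e /\ nb m2 i e = nb m i e.
  move: EXe0 EXe1 ARe0 ARe1; rewrite /na /nb /at_ nec'.
  case Ek: bk tgt aext => [|k] tgt' aext'; first lia.
  move: tgt' => [H1 H2 H3 H4 H5]; have {}aext' := aext' k erefl.
  have [E|ne] := eqVneq k i.+1; last by have [E|ne'] := eqVneq k i; [subst k|]; lia.
  subst k; have [] : ex m e i = 0 /\ ar m e i = 0; last lia.
  by apply: zi; apply/negP => /H5; lia.
split=> x; have [E|ne] := eqVneq x e; try (by subst x; case: eE);
  have [E'|ne'] := eqVneq x c; try (by subst x; case: cE);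
  by have [] := off x ne ne'.
Qed.
End Bump.

Section BumpTop.
Variables (m : model) (r c l e : nat) (bk : bkind) (i : nat).
Hypothesis vm : valid m.
Hypothesis top : topleg m r c l.
Hypothesis tgt : target m r l e bk.
Hypothesis li : l = i.

Notation big := (big m r e bk).

Lemma top_mid0 x : e + ~~ is_hook bk <= x < c -> ex m x i = 0 /\ ar m x i = 0.
Proof.
move=> Hx; suff: ~ ent m x i by rewrite /ent; lia.
move=> H; have := big_gt tgt (z:=i); have := mid_dich vm top tgt H Hx; have := top_hk top; lia.
Qed.

Lemma top_mid_na x : e < x < c -> na m i x = 0.
Proof. by move=> Hx; rewrite /na; have := @top_mid0 x ltac:(case: bk; lia); lia. Qed.

Hypothesis nbi : ~~ big i.+1.

Lemma top_ex1 : ex m c i.+1 = 0.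
Proof. by have := top_dich vm top tgt (z:=i.+1); lia. Qed.

Lemma top_mid1 x : e <= x < c -> ex m x i.+1 = 0 /\ ar m x i.+1 = 0.
Proof.
move=> Hx; suff: ~ ent m x i.+1 by rewrite /ent; lia.
move=> Hz; have := mid_dich vm top tgt Hz; have := top_hk top.
case Ek: bk tgt nbi => [|k] /=; first lia.
move=> [H1 H2 H3 H4 H5] => nb1 hkc mid'.
have [E|ne] := eqVneq e x; last by have := mid' ltac:(lia); lia.
by subst x; have := H5 _ Hz; lia.
Qed.

(** The letter [l = i] of column [c] is paired, and no [+] stands in columns [e] to [c - 1]. Hence
    its partner comes from before [e] and survives column [e], all of whose [-] are therefore
    paired. In the proofs below this is read backwards, to conclude [big i.+1]. *)
Lemma top_paired d : last_minus (na m i) (nb m i) d -> d < c ->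
  d <> e /\ (d.+1 = e -> 0 < nb m i d).
Proof.
move=> [Hd1 Hd2] dc; have Hec := e_le_c vm top tgt.
have ac : 0 < na m i c by rewrite /na top_ex1 -{1}li (top_ex vm top).
have Hc := Hd2 c dc; have [E|nec] := eqVneq e c.
  split; first lia.
  by move=> dec; move: Hc; rewrite -{2}E -dec /=; lia.
have ec : e < c by lia.
have b0 x : e <= x < c -> nb m i x = 0 by move=> Hx; have := top_mid1 Hx; rewrite /nb; lia.
have Pc y : e < y <= c -> pend (na m i) (nb m i) y = pend (na m i) (nb m i) e - na m i e.
  elim: y => [|y IH] Hy; first lia.
  have [E|ne] := eqVneq e y; first by subst y; rewrite /= b0; lia.
  by rewrite /= (@top_mid_na y) ?(b0 y) ?IH; lia.
have H : na m i c <= pend (na m i) (nb m i) e - na m i e by rewrite -(Pc c) //; lia.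
split=> [E|E]; first by subst d; lia.
by subst e; move: H => /=; lia.
Qed.
End BumpTop.

(** * Commutation of f_i with one bump *)

Lemma shift_hk_le m d i r c z : 0 < i -> z != i \/ c != d ->
  (0 < shift_hk m d i r c <= z) = (0 < hk m r c <= z).
Proof. by rewrite /shift_hk => i0 H; case: ifP => //; lia. Qed.

Lemma shift_hk_ge m d i r c : hk m r c <= shift_hk m d i r c <= (hk m r c).+1.
Proof. by rewrite /shift_hk; case: ifP => //; lia. Qed.

Lemma shift_hk_gt0 m d i r c : 0 < i -> (0 < shift_hk m d i r c) = (0 < hk m r c).
Proof. by rewrite /shift_hk => i0; case: ifP => //; lia. Qed.

(** * The move (S), and what the moves of [f_i] preserve *)

Section Hooked.
Variables (m : model) (i d : nat).
Hypothesis vm : valid m.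
Hypothesis i0 : 0 < i.

Lemma row_succ s : ex m d i.+1 = 0 -> inrow m s d i -> inrow m s d i.+1.
Proof.
move=> u0; rewrite /inrow => H; have := ex_hk vm (r:=s.+1) (c:=d).
have [E|ne] := eqVneq (hk m s.+1 d) i.+1; [rewrite E u0|]; lia.
Qed.

Lemma hooked_q : hooked m i d -> ar m d i.+1 = 0.
Proof.
move=> [u0 [s Hs hs]]; have Hs1 := row_succ u0 Hs.
suff: ~ ent m d i.+1 by rewrite /ent; lia.
by move=> He; have := ent_le vm He Hs1; lia.
Qed.

(** Column [d] sends no [+] to column [d.+1], which nevertheless has no unpaired [-]. So the hook
    entry [i] there is bracketed inside its column, by an [i.+1] in the extended legs, and no arm
    holds a further [i]. The row and column conditions put this [i.+1] into the leg of the same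
    cell. *)
Lemma hooked_swap : last_minus (na m i) (nb m i) d -> hooked m i d ->
  [/\ ex m d.+1 i = 1, ex m d.+1 i.+1 = 1, ar m d.+1 i = 0
    & exists s, [/\ inrow m s d i, hk m s d.+1 = i & isleg m s d.+1 i.+1]].
Proof.
move=> [Hd1 Hd2] Hk; have q0 := hooked_q Hk; case: Hk => [u0 [s Hs hs]].
have v1 : ex m d.+1 i = 1 by rewrite -hs ex_hk // hs.
have b0 : nb m i d = 0 by rewrite /nb u0 q0.
have a0 : na m i d.+1 = 0 by have := Hd2 d.+1 (ltnSn d); rewrite /= b0; lia.
rewrite /na v1 in a0; have := ex_le1 vm d.+1 i.+1 => u1.
have u11 : ex m d.+1 i.+1 = 1 by lia.
split=> //; first lia.
exists s; split=> //; rewrite /isleg u11 hs (ltnSn i) andbT /=.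
have Hi := inrow_hk vm (r:=s) (c:=d.+1).
rewrite hs in Hi; move: (Hi i0); rewrite /inrow hs => Hj.
have := hk_col vm (r:=s) (c:=d.+1).
suff : hk m s.+1 d.+1 <> i.+1 by lia.
move=> E; have := hk_adj vm (r:=s.+1) (c:=d) => H1.
have H2 : 0 < hk m s.+1 d by lia.
have := hk_col_le vm (r:=s.+1) (c:=d) (c':=d.+1) ltac:(lia) ltac:(lia).
have := ex_hk vm H2.
have [E2|ne] := eqVneq (hk m s.+1 d) i.+1; first by rewrite E2 u0.
by move: Hs; rewrite /inrow; lia.
Qed.

Variables (fk : fkind) (m1 : model).
Hypothesis Hd : last_minus (na m i) (nb m i) d.
Hypothesis Hk : fkind_at m i d fk.
Hypothesis Hf : fmove m i d fk m1.

Lemma fext_col : fk = FExt -> [/\ ex m d i = 1, ar m d i = 0 & ex m d i.+1 = 0].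
Proof.
move: Hk => + Ef; rewrite Ef => -[p0 _]; case: Hd => + _; rewrite {2}/na p0.
by have := ex_le1 vm d i; move=> *; split; lia.
Qed.

Lemma fmove_hk_gt0 x y : (0 < hk m1 x y) = (0 < hk m x y).
Proof. by case: fk Hf => -[-> _ _] //; rewrite shift_hk_gt0. Qed.

Lemma fmove_hk_ge x y : hk m x y <= hk m1 x y <= (hk m x y).+1.
Proof. by case: fk Hf => -[-> _ _]; rewrite ?shift_hk_ge; lia. Qed.

(** Only the comparison of [i] with a hook entry raised from [i] could change, and after such a move
    the column contains no [i]. So [f_i] leaves all surviving entries in their rows. *)
Lemma fmove_hk_le x y z : ent m1 y z -> (0 < hk m1 x y <= z) = (0 < hk m x y <= z).
Proof.
case Ef: fk Hf => -[-> HE HA] // Hz; apply: shift_hk_le => //; apply/orP; rewrite -negb_and;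
  apply/negP => /andP[/eqP Ez /eqP Ey]; subst y z; move: Hz; rewrite /ent HA.
  by have := HE d i; have [-> -> _] := fext_col Ef; rewrite /at_; lia.
have [v1 _ p1 _] := hooked_swap Hd ltac:(by move: Hk; rewrite Ef).
by have := HE d.+1 i; rewrite v1 p1 /at_; lia.
Qed.

Lemma fmove_ent y z : ent m1 y z -> ent m y z \/ y = d /\ z = i.+1.
Proof.
rewrite /ent; case: fk Hf => -[_ HE HA]; have := HE y z; have := HA y z;
  rewrite /at_; have [->|ne] := eqVneq y d; have [->|ne'] := eqVneq z i.+1; lia.
Qed.

(* The only leg entry that [f_i] can create is an [i.+1] in column [d]: it replaces a leg entry [i]
   of the same cell, or moves there from the cell on the right. *)
Lemma fmove_isleg x y z : isleg m1 x y z -> isleg m x y z \/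
  [/\ y = d, z = i.+1 & fk = FExt /\ isleg m x d i \/ fk = FSwap /\ isleg m x d.+1 i.+1].
Proof.
case/and3P=> Hex Hin Hlt.
have Hz : ent m1 y z by rewrite /ent; lia.
have Hin' : inrow m x y z by move: Hin; rewrite /inrow !fmove_hk_le.
have Hlt' : hk m x y < z by have := fmove_hk_ge x y; lia.
have [E0|E0] := posnP (ex m y z); last by left; rewrite /isleg E0 Hin' Hlt'.
right; case Ef: fk Hf => -[Hh HE HA]; first by move: Hex; rewrite HE E0.
  have := HE y z; rewrite E0 /at_; have [Ey|] := eqVneq y d; have [Ez|] := eqVneq z i.+1; try lia.
  subst y z => _; split=> //; left; split=> //.
  have [v1 p0 u0] := fext_col Ef.
  move: Hlt; rewrite /isleg Hh /shift_hk eqxx v1 /=; case: eqP => Ehk Hlt; first lia.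
  by move: Hin'; rewrite /inrow; lia.
have := HE y z; rewrite E0 /at_; have [Ey|] := eqVneq y d; have [Ez|] := eqVneq z i.+1; try lia.
subst y z => _; split=> //; right; split=> //.
have Hk' : hooked m i d by move: Hk; rewrite Ef.
have [_ _ _ [s [Hs hs Hleg]]] := hooked_swap Hd Hk'.
by rewrite (inrow_uniq vm Hin' (row_succ E0 Hs)).
Qed.

Lemma fmove_isleg_keep x y z : isleg m x y z ->
  ~ [/\ z = i, y = d & fk = FExt] -> ~ [/\ z = i.+1, y = d.+1 & fk = FSwap] -> isleg m1 x y z.
Proof.
move=> /and3P[Hex Hin Hlt] N1 N2.
have [Hex1 Hlt1] : 0 < ex m1 y z /\ hk m1 x y < z.
  case Ef: fk Hf => -[Hh HE HA]; first by rewrite Hh HE.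
    have [v1 p0 u0] := fext_col Ef.
    have := HE y z; rewrite Hh /shift_hk /at_; have [Ey|] := eqVneq y d; last by rewrite /=; lia.
    have [Ez|nez] := eqVneq z i; first by case: N1.
    have [Ez|nez'] := eqVneq z i.+1; first by subst; lia.
    by case: ifP => /=; lia.
  have Hk' : hooked m i d by move: Hk; rewrite Ef.
  have [v1 u1 p1 [s [Hs hs Hleg]]] := hooked_swap Hd Hk'.
  have := HE y z; rewrite Hh /shift_hk /at_; have [Ey|] := eqVneq y d.+1; last by rewrite /=; lia.
  have [Ez|nez'] := eqVneq z i.+1; first by case: N2.
  have [Ez|nez] := eqVneq z i; last by case: ifP => /=; lia.
  by subst y z; move: Hlt; rewrite -(hk_uniq vm i0 hs Hin) hs ltnn.
have Hz : ent m1 y z by rewrite /ent; lia.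
by rewrite /isleg Hex1 Hlt1 andbT; move: Hin; rewrite /inrow !fmove_hk_le.
Qed.
End Hooked.

Section Commute.
Variables (m : model) (r c l e : nat) (bk : bkind) (i d : nat) (fk : fkind).
Hypothesis vm : valid m.
Hypothesis i0 : 0 < i.
Hypothesis top : topleg m r c l.
Hypothesis tgt : target m r l e bk.
Hypothesis Hd : last_minus (na m i) (nb m i) d.
Hypothesis Hk : fkind_at m i d fk.

Lemma top_row s : inrow m s c i -> l = i.+1 -> s = r.
Proof.
move=> Hs li; apply: (inrow_uniq vm Hs).
by have := top_hk top; have := top_inrow top; rewrite /inrow; lia.
Qed.

Lemma not_hooked_top : ~ (d = c /\ (exists2 s, inrow m s d i & hk m s d.+1 = i) /\ l = i.+1).
Proof.
move=> [dc [[s Hs hs] li]]; rewrite dc in Hs hs.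
have E := top_row Hs li; subst s.
have := ent_le vm (r:=r) (c:=c) (z:=l); rewrite /ent (top_ex vm top) /= (top_inrow top) hs; lia.
Qed.

Section Bumped.
Variable m2 : model.
Hypothesis Hb : bmove m r c l e bk m2.

Lemma bmove_hk x y : hk m2 x y = if is_hook bk && (x == r.+1) && (y == e) then l else hk m x y.
Proof. by case: bk Hb => [|k] [->]. Qed.

Lemma bmove_hk_off x y : (x != r.+1) || (y != e) -> hk m2 x y = hk m x y.
Proof. by rewrite bmove_hk -andbA -negb_and; case: is_hook => //= /negbTE ->. Qed.

Lemma bmove_inrow_off x y z : y != e -> inrow m2 x y z = inrow m x y z.
Proof. by move=> ne; rewrite /inrow !bmove_hk_off ?ne ?orbT. Qed.

Lemma bmove_inrow x y z : is_hook bk = false -> inrow m2 x y z = inrow m x y z.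
Proof. by move=> E; rewrite /inrow !bmove_hk E. Qed.

(** The bump can make (S) applicable only by placing the hook entry [l = i] right of the [i] of
    column [d]; that situation is excluded here and settled in [commutes_new_hook]. *)
Lemma bmove_not_hooked : ~ hooked m i d ->
  ~ [/\ l = i, bk = BHook, d.+1 = e, ex m d i.+1 = 0 & inrow m r.+1 d i] -> ~ hooked m2 i d.
Proof.
move=> NH NY [u2 [s Hs hs]].
have Hec := e_le_c vm top tgt.
have [u0|u1] := posnP (ex m d i.+1); last first.
  have [dc li nec] : [/\ d = c, l = i.+1 & e != c].
    by have := bmove_ex Hb d i.+1; rewrite u2 /at_; case: bk Hec => [|k] /=; move=> *; split; lia.
  apply: not_hooked_top; split=> //; split=> //; exists s.
    by move: Hs; rewrite bmove_inrow_off //; lia.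
  by move: hs; rewrite bmove_hk_off //; lia.
have [/andP[/andP[Eh /eqP Es] /eqP Ed]|noff] := boolP (is_hook bk && (s == r.+1) && (d.+1 == e)).
  apply: NY; move: hs Hs; rewrite bmove_hk Eh Es Ed !eqxx /= bmove_inrow_off; last lia.
  by case: bk Eh.
have hs' : hk m s d.+1 = i by move: hs; rewrite bmove_hk (negbTE noff).
apply: NH; split=> //; exists s => //.
have [Eh|Eh] := boolP (is_hook bk); last by move: Hs; rewrite bmove_inrow //; exact/negbTE.
have [Ed|nd] := eqVneq d e; last by move: Hs; rewrite bmove_inrow_off.
subst d; move: Hs; rewrite /inrow !bmove_hk Eh eqxx !andbT /=.
have tg : hk m r.+1 e = 0 \/ l < hk m r.+1 e by case: bk Eh tgt => // _ [].
have [Es|ns] := eqVneq s r.+1.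
  have -> : s.+1 == r.+1 = false by lia.
  have := hk_col_le vm (r:=s) (c:=e) (c':=e.+1) ltac:(lia) ltac:(lia); subst s; lia.
have [Es|ns'] := eqVneq s.+1 r.+1; last by rewrite /=; lia.
have {Es}Es : s = r by lia.
subst s; have := top_hk top; rewrite /= ?eqxx; lia.
Qed.

Lemma bmove_hooked : hooked m i d -> ~ (l = i.+1 /\ d.+1 = c) -> hooked m2 i d.
Proof.
move=> Hh NX; have [v1 u1 p1 [s [Hs hs Hleg]]] := hooked_swap vm i0 Hd Hh.
have q0 := hooked_q vm i0 Hh; have [u0 _] := Hh.
have Hec := e_le_c vm top tgt; have Ht := top_hk top.
have Hs1 := row_succ vm i0 u0 Hs.
have sr : s < r \/ s = r /\ i.+1 < l /\ d < c.
  case: ((proj2 top) _ _ _ Hleg) => [|[E H]]; [by left|right; split=> //].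
  have [dc|ne] := eqVneq d.+1 c; first lia.
  have eu : ent m d.+1 i.+1 by rewrite /ent u1.
  case/and3P: Hleg => _ Hin _; rewrite E in Hin.
  by have := inrow_ent_le vm eu Hin (c':=c); lia.
have hr1 : 0 < hk m r.+1 d -> i.+1 < hk m r.+1 d.
  by move=> H; have := hk_row_le vm (s:=s.+1) (r:=r.+1) (c:=d) ltac:(lia) H; move: Hs1; rewrite /inrow; lia.
split; last first.
  exists s; last by rewrite bmove_hk_off //; lia.
  by move: Hs; rewrite /inrow !bmove_hk; do 2![case: ifP => //]; lia.
have := bmove_ex Hb d i.+1; rewrite u0 /at_.
case: bk Hec tgt => [|k] /= Hec tgt'; last first.
  case: tgt' => H1 H2 H3 H4 H5.
  have [Ed|] := eqVneq d e; last lia.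
  by subst d; have [Ek|] := eqVneq i.+1 k; [subst k|]; lia.
have [Ed|] := eqVneq d e; last lia.
have [El|] := eqVneq i.+1 l; last lia.
subst d l; case: sr => [sr|[E []]]; last lia.
have hre : 0 < hk m r e by have := hk_col_le vm (r:=r) (c:=e) (c':=c); lia.
have := hk_col_le vm (r:=r) (c:=e) (c':=c) ltac:(lia) ltac:(lia).
have := hk_row_le vm (s:=s.+1) (r:=r) (c:=e) sr hre; move: Hs1; rewrite /inrow; lia.
Qed.
End Bumped.

Section Moved.
Variable m1 : model.
Hypothesis Hf : fmove m i d fk m1.

(** The exceptions are those where [f_i] raises [l] itself or carries it to the left by (S); see
    [commutes_top] and [commutes_swap]. *)
Lemma fmove_topleg : ~ [/\ l = i, d = c & fk = FExt] -> ~ [/\ l = i.+1, d.+1 = c & fk = FSwap] ->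
  topleg m1 r c l.
Proof.
move=> N1 N2; have [Hl Hmax] := top; split.
  by apply: (fmove_isleg_keep vm i0 Hd Hk Hf Hl) => -[? ? ?]; [apply: N1|apply: N2].
move=> r' c' z /(fmove_isleg vm i0 Hd Hk Hf) [/Hmax//|[Ec Ez [[Ef H]|[Ef H]]]]; subst c' z.
  have [|[-> [|[dc il]]]] := Hmax _ _ _ H; [by left|by right; lia|right; split=> //; right; split=> //].
  by have [E|ne] := eqVneq l i; [case: N1|lia].
have [|[-> H']] := Hmax _ _ _ H; first by left.
by right; split=> //; lia.
Qed.

Lemma hooked_above x : hooked m i d -> r < x -> 0 < hk m x d -> i.+1 < hk m x d.
Proof.
move=> Hh rx H; have [_ _ _ [s [Hs hs Hleg]]] := hooked_swap vm i0 Hd Hh.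
have [u0 _] := Hh; have := row_succ vm i0 u0 Hs.
have sr : s <= r by case: ((proj2 top) _ _ _ Hleg); lia.
by have := hk_row_le vm (s:=s.+1) (r:=x) (c:=d) ltac:(lia) H; rewrite /inrow; lia.
Qed.

(** The exclusions list how [f_i] can change what [l] bumps: a new [i.+1] appears left of the
    target, the hook entry of the target cell rises above [l], or the only copy of the bumped arm
    entry is renamed. They are settled in [commutes_new_hook], [commutes_hook_raised] and
    [commutes_last_arm]. *)
Lemma fmove_target :
  ~ [/\ l = i, bk = BHook, d.+1 = e, ex m d i.+1 = 0 & inrow m r.+1 d i] ->
  ~ [/\ l = i, is_hook bk = false, d = e & fk = FExt] ->
  ~ [/\ bk = BArm i, d = e, fk = FArm & ar m e i = 1] ->
  target m1 r l e bk.
Proof.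
move=> NY1 NY2 NY3.
have gt0 := fmove_hk_gt0 i0 Hf; have ge := fmove_hk_ge i0 Hf.
have Hle := fmove_hk_le vm i0 Hd Hk Hf; have He := fmove_ent i0 Hf.
have Hec := e_le_c vm top tgt.
have Hsw : fk = FSwap -> hooked m i d by move=> E; move: Hk; rewrite E.
case Eb: bk tgt => [|k] /=; rewrite Eb /= in Hec.
  move=> [H1 H2]; split; first by have := gt0 r.+1 e; have := ge r.+1 e; lia.
  move=> e' ee; have [H3 H4] := H2 e' ee; split; first by rewrite gt0.
  move=> z Hz; rewrite Hle //; have [/H4//|[Ee Ez]] := He _ _ Hz.
  subst e' z.
  have hkl : hk m r.+1 d <= l.
    by have := H4 _ (ent_hk vm H3); have := hk_col vm (r:=r.+1) (c:=d); lia.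
  have [/Hsw Hh|nsw] : fk = FSwap \/ fk <> FSwap by case: fk; [right|right|left].
    by left; have := hooked_above Hh (ltnSn r) H3; lia.
  have ei : ent m d i.
    case: fk nsw Hk => //= _ [H _]; rewrite /ent; first lia.
    by case: Hd => + _; rewrite {2}/na; lia.
  have [il|hr] := H4 _ ei; last by right; lia.
  have [li|nli] := eqVneq l i; last by left; lia.
  have [u0|u1] := posnP (ex m d i.+1); last by apply: H4; rewrite /ent; lia.
  right; have [hr|hr] := boolP (0 < hk m r.+2 d <= i); first by lia.
  by case: NY1; split=> //; rewrite /inrow hr; lia.
move=> [H1 H2 H3 H4 H5]; split=> //.
- rewrite gt0; case Ef: fk Hf => -[-> HE HA] //; rewrite /shift_hk; case: ifP; try lia.
    case/andP => /eqP ed /eqP hi.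
    have [li|nli] := eqVneq l i; last lia.
    by case: NY2; rewrite Eb.
  case/andP => /eqP ed /eqP hi.
  have [_ _ _ [s [Hs hs Hleg]]] := hooked_swap vm i0 Hd (Hsw Ef).
  rewrite ed in hi; have E := hk_inj vm i0 hi hs; subst s.
  by case: ((proj2 top) _ _ _ Hleg); lia.
- case Ef: fk Hf => -[_ HE HA]; rewrite ?HA //.
  have := HA e k; rewrite /at_; have [Ed|] := eqVneq e d; last lia.
  have [Ek|] := eqVneq k i; last lia.
  have [E1|] := eqVneq (ar m e i) 1; first by case: NY3; rewrite Eb Ek.
  by subst k; lia.
- have := gt0 r.+2 e; have := ge r.+2 e; lia.
move=> z /He [/H5//|[Ee Ez]]; subst e z.
have [/Hsw Hh|nsw] : fk = FSwap \/ fk <> FSwap by case: fk; [right|right|left].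
  by left; have := hooked_above Hh (ltnSn r) ltac:(lia); lia.
have ei : ent m d i.
  case: fk nsw Hk => //= _ [H _]; rewrite /ent; first lia.
  by case: Hd => + _; rewrite {2}/na; lia.
have [il|ki] := H5 _ ei; last by right; lia.
have [li|nli] := eqVneq l i; last by left; lia.
(* If [i.+1] were below [k], then [top_paired] would forbid the last unpaired [-] in the target
   column. *)
have [bi|nbi] := boolP (big m r d bk i.+1); first by right; move: bi; rewrite /big Eb.
by have [] := top_paired vm top tgt li nbi Hd ltac:(lia).
Qed.
End Moved.
End Commute.

(** * The two orders of [f_i] and the bump *)

Section CommuteMain.
Variables (m : model) (r c l e : nat) (bk : bkind) (i d : nat) (fk : fkind) (m1 m2 : model).
Hypothesis vm : valid m.
Hypothesis i0 : 0 < i.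
Hypothesis top : topleg m r c l.
Hypothesis tgt : target m r l e bk.
Hypothesis Hd : last_minus (na m i) (nb m i) d.
Hypothesis Hk : fkind_at m i d fk.
Hypothesis Hf : fmove m i d fk m1.
Hypothesis Hb : bmove m r c l e bk m2.

(** [d'], [fk'] describe [f_i] after the bump, the other witnesses the bump after [f_i]; only the
    row [r] is kept. The results [m3], [m3'] are quantified universally because the moves are
    relations; tableaux provide them later. *)
Definition commutes := exists d' fk' c' l' e' bk',
  [/\ last_minus (na m2 i) (nb m2 i) d', fkind_at m2 i d' fk',
      topleg m1 r c' l', target m1 r l' e' bk'
    & forall m3 m3', fmove m2 i d' fk' m3 -> bmove m1 r c' l' e' bk' m3' -> meq m3 m3'].

Lemma commutes_same :
  last_minus (na m2 i) (nb m2 i) d ->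
  ~ [/\ l = i, d = c & ar m c i = 0] -> ~ [/\ l = i.+1, d.+1 = c & hooked m i d] ->
  ~ [/\ l = i, bk = BHook, d.+1 = e, ex m d i.+1 = 0 & inrow m r.+1 d i] ->
  ~ [/\ l = i, is_hook bk = false, d = e & fk = FExt] ->
  ~ [/\ bk = BArm i, d = e, fk = FArm & ar m e i = 1] -> commutes.
Proof.
move=> Hd2 NX1 NX2 NY1 NY2 NY3; exists d, fk, c, l, e, bk; split=> //.
- have nh : ~ hooked m i d -> ~ hooked m2 i d.
    by move=> NH; apply: (bmove_not_hooked vm i0 top tgt Hd Hk Hb NH).
  have := bmove_ar Hb d i; case Ef: fk Hk => /=.
  + move=> [H1 /nh H2] H; split=> //; move: H; rewrite /at_.
    case Eb: bk => [|k]; first lia.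
    have [Ed|] := eqVneq d e; last lia.
    have [Ei|] := eqVneq i k; last lia.
    have [E1|] := eqVneq (ar m e i) 1; first by case: NY3; rewrite Eb -Ei.
    by subst d; lia.
  + move=> [H1 /nh H2] H; split=> //; move: H; rewrite /at_ H1.
    case Eb: bk => [|k]; first lia.
    have [Ed|] := eqVneq d e; last lia.
    have [El|] := eqVneq i l; last lia.
    by case: NY2; rewrite Eb.
  + by move=> H _; apply: (bmove_hooked vm i0 top tgt Hd Hk Hb) => // -[H1 H2]; apply: NX2.
- apply: (fmove_topleg vm i0 top Hd Hk Hf).
    by move=> [H1 H2 H3]; apply: NX1; split=> //; move: Hk; rewrite H3 H2 => -[].
  by move=> [H1 H2 H3]; apply: NX2; split=> //; move: Hk; rewrite H3.
- exact: (fmove_target vm i0 top tgt Hd Hk Hf).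
move=> m3 m3' F3 B3.
(* Otherwise the shift of hook entries [i] by [f_i] would also hit the hook entry [l] that the bump
   has just placed. *)
have nohook : l = i -> is_hook bk -> fk <> FArm -> e <> if fk is FSwap then d.+1 else d.
  move=> li Eh Ef Ee; have Hec := e_le_c vm top tgt; rewrite Eh /= addn0 in Hec.
  have ei : ex m e i = 1.
    rewrite Ee; case E: fk Ef => // _; first by have [] := fext_col vm i0 Hd Hk E.
    have Hh : hooked m i d by move: Hk; rewrite E.
    by have [] := hooked_swap vm i0 Hd Hh.
  have [Ec|nc] := eqVneq e c; last first.
    by have := top_mid0 vm top tgt li (x:=e); rewrite Eh /=; lia.
  case E: fk Ef Ee => // _ Ee.
    by apply: NX1; split=> //; [rewrite -Ee|move: Hk; rewrite E => -[]; rewrite -Ee Ec].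
  have Hh : hooked m i d by move: Hk; rewrite E.
  have [_ _ _ [s [Hs hs _]]] := hooked_swap vm i0 Hd Hh.
  have := top_inrow top; have := top_hk top; rewrite -Ec Ee li => H1 H2.
  by have E2 := hk_uniq vm i0 hs H2; subst s; lia.
have [hm1 hm2] : (forall x y, hk m3 x y = if is_hook bk && (x == r.+1) && (y == e) then l else hk m1 x y)
  /\ forall x y, hk m3' x y = if is_hook bk && (x == r.+1) && (y == e) then l else hk m1 x y.
  split=> x y; last by rewrite (bmove_hk B3).
  have := bmove_hk Hb x y; case Eb: (is_hook bk && (x == r.+1) && (y == e)).
    move: Eb => /andP[/andP[Eh _] /eqP Ey] h2.
    case E: fk F3 nohook => [||] [-> _ _] nohook //; rewrite /shift_hk h2; case: ifP => // /andP[/eqP Hy /eqP Hl];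
      by case: (nohook Hl Eh ltac:(by [])); rewrite -Ey.
  by move=> h2; case: fk F3 Hf => -[-> _ _] [-> _ _]; rewrite /shift_hk h2.
split=> x y; first by rewrite hm1 hm2.
  have := bmove_ex B3 x y; have := bmove_ex Hb x y.
  by case: fk F3 Hf => -[_ /(_ x y) + _] [_ /(_ x y) + _]; lia.
have := bmove_ar B3 x y; have := bmove_ar Hb x y.
by case: fk F3 Hf => -[_ _ /(_ x y) +] [_ _ /(_ x y) +]; case: bk => [|k]; lia.
Qed.

(** Here [f_i] acts on [l] itself. Raised first, it is bumped as [i.+1] to the same place, since
    [i.+1] is still below the bumped entry; bumped first, it is raised in column [e], as a hook
    entry or as an arm entry. *)
Lemma commutes_top : l = i -> d = c -> ar m c i = 0 -> ~~ big m r e bk i.+1 ->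
  last_minus (na m2 i) (nb m2 i) e -> commutes.
Proof.
move=> li dc p0 nbi He2.
have Hec := e_le_c vm top tgt.
have Ef : fk = FExt.
  case E: fk Hk => //=; first by rewrite dc; lia.
  move=> Hh; have [_ _ _ [s [Hs hs Hleg]]] := hooked_swap vm i0 Hd Hh.
  have := top_inrow top; rewrite -dc li => H; have E2 := inrow_uniq vm Hs H; subst s.
  by case: ((proj2 top) _ _ _ Hleg); lia.
have [v1 _ u0] := fext_col vm i0 Hd Hk Ef.
have u0' : ex m c i.+1 = 0 by rewrite -dc.
have nohk x : hk m x c <> i.
  rewrite -li => E; have E2 := hk_uniq vm (z := l) ltac:(lia) E (top_inrow top); subst x.
  by have := top_hk top; lia.
have mid0 := top_mid0 vm top tgt li (x:=e).
have [hm1 em1 am1] : [/\ forall x y, hk m1 x y = hk m x y,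
   forall x y, ex m1 x y + at_ x y c i = ex m x y + at_ x y c i.+1
   & forall x y, ar m1 x y = ar m x y].
  move: Hf; rewrite Ef dc => -[Hh HE HA]; split=> // x y.
  by rewrite Hh /shift_hk; case: ifP => // /andP[/eqP-> /eqP /nohk].
have inr1 x y z : inrow m1 x y z = inrow m x y z by rewrite /inrow !hm1.
have hr1 : 0 < hk m r.+1 c -> i.+1 < hk m r.+1 c.
  move=> H; have H1 := top_above top H; have := ex_hk vm H; move: u0; rewrite dc.
  by have [->|] := eqVneq (hk m r.+1 c) i.+1; lia.
have hki : is_hook bk -> forall s, hk m2 s e = i -> s = r.+1.
  move=> Eh s; rewrite (bmove_hk Hb) Eh eqxx andbT /=; case: eqP => // _ E.
  have [Ec|nc] := eqVneq e c; first by case: (nohk s); rewrite -Ec.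
  by have := ex_hk vm (r:=s) (c:=e); rewrite E; move: mid0; rewrite Eh /=; lia.
have nh2 : ~ hooked m2 i e.
  move=> [u2 [s Hs hs]].
  have hs' : hk m s e.+1 = i by move: hs; rewrite (bmove_hk_off Hb) //; lia.
  have v1' : ex m e.+1 i = 1 by rewrite -hs' ex_hk //; lia.
  have [Ec|nec] := eqVneq e c; last first.
    have [Ec|ne1] := eqVneq e.+1 c; first by case: (nohk s); rewrite -Ec.
    have := top_mid0 vm top tgt li (x:=e.+1); rewrite v1'.
    by case: bk Hec => [|k] /=; lia.
  have Eh : is_hook bk by case: bk Hec => [|k] //=; lia.
  have hbig : 0 < hk m r.+1 e.+1 -> i < hk m r.+1 e.+1.
    move=> H; rewrite -li; apply: (big_gt tgt); apply: (high_big vm tgt (x:=e.+1)); last lia.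
    by rewrite Eh; lia.
  have [Es|ns] := eqVneq s r.+1; first by subst s; lia.
  have hc := hk_adj vm (r:=s) (c:=e).
  move: Hs; rewrite /inrow (bmove_hk_off Hb) ?ns // => Hs.
  have [Es|ns'] := eqVneq s r.
    by subst s; move: Hs; rewrite (bmove_hk Hb) Eh !eqxx /=; lia.
  move: Hs; rewrite (bmove_hk_off Hb); last by rewrite (inj_eq succn_inj) ns'.
  move=> Hs; have := top_hk top; have := hr1; rewrite -Ec => h1 h2.
  have [sr|sr] := ltnP s r; first by have := hk_row_le vm (s:=s.+1) (r:=r) (c:=e) sr; lia.
  by have := hk_row_le vm (s:=r.+1) (r:=s) (c:=e) ltac:(lia); lia.
exists e, (if is_hook bk then FExt else FArm), c, i.+1, e, bk; split=> //.
- case Eb: bk => [|k] /=; split=> //; have := bmove_ar Hb e i; rewrite Eb /at_.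
    have [Ec|nec] := eqVneq e c; first by rewrite Ec p0; lia.
    by move: mid0; rewrite Eb /=; lia.
  by have := tgt; rewrite Eb /= => -[_ _ lk _ _]; lia.
- split; first rewrite /isleg inr1 hm1.
    have := em1 c i.+1; have := top_hk top; have := top_inrow top; rewrite /inrow u0' /at_ !eqxx /=.
    by rewrite li => *; apply/and3P; split; lia.
  move=> r' c' z /and3P[]; rewrite inr1 hm1 => Hex Hin Hlt.
  have [Hex'|Hex'] := ltnP 0 (ex m c' z).
    have := (proj2 top) r' c' z; rewrite /isleg Hex' Hin Hlt => /(_ isT); lia.
  have := em1 c' z; rewrite /at_; have [Ec|] := eqVneq c' c; have [Ez|] := eqVneq z i.+1; try lia.
  subst c' z => _; right; split=> //; last by right.
  apply: (inrow_uniq vm Hin); have := top_inrow top; rewrite li /inrow; have := hr1; lia.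
- case Eb: bk tgt nbi => [|k] /=; rewrite !hm1.
    move=> [H1 H2] nb; split; first by lia.
    move=> e' ee; have [H3 H4] := H2 e' ee; rewrite !hm1; split=> // z.
    rewrite /ent am1; have := em1 e' z; have := H4 z; rewrite /ent /at_; case: eqP => [Ec|_].
      by move: Hec; rewrite Eb /=; lia.
    by rewrite /=; lia.
  move=> [H1 H2 H3 H4 H5] nb; rewrite am1; split=> //; [lia..|].
  move=> z; rewrite /ent am1; have := em1 e z; have := H5 z; rewrite /ent /at_.
  have -> : (e == c) = false by move: Hec; rewrite Eb /=; lia.
  by rewrite /=; lia.
move=> m3 m3' F3 B3.
have FE3 : fmove m2 i e (if is_hook bk then FExt else FArm) m3 by [].
split=> x y.
- rewrite (bmove_hk B3) hm1; have h2 := bmove_hk Hb.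
  case Eb: bk F3 hki h2 => [|k] /= [-> _ _] hki h2; last by rewrite h2.
  rewrite /shift_hk; case: ifP.
    by case/andP=> /eqP Hy /eqP Hx; subst y; rewrite (hki isT _ Hx) !eqxx.
  rewrite h2 /= => Hn; case: ifP => // /andP[/eqP Hx /eqP Hy]; subst x y.
  by move: Hn; rewrite !eqxx /= li eqxx.
- have := bmove_ex B3 x y; have := bmove_ex Hb x y; have := em1 x y; rewrite li.
  by case: bk F3 => [|k] -[_ /(_ x y) H _] /=; try (have := H x y); lia.
have := bmove_ar B3 x y; have := bmove_ar Hb x y; have := am1 x y; rewrite li.
by case: bk F3 => [|k] -[_ _ H] /=; have := H x y; lia.
Qed.

(** If [f_i] acts first, (S) brings [i.+1] into the leg of [(r, d)], from where it is bumped, and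
    the hook entry of [(r, c)] rises to [i.+1]. If the bump comes first, [i.+1] leaves from [(r, c)]
    and [f_i] raises the hook entry [i] there. *)
Lemma commutes_swap : l = i.+1 -> d.+1 = c -> hooked m i d ->
  last_minus (na m2 i) (nb m2 i) c -> commutes.
Proof.
move=> li dc Hh Hc2.
have [hrc Hr Hed] := hooked_top vm top tgt i0 li Hh dc.
have [v1 u1 p1 _] := hooked_swap vm i0 Hd Hh.
have [u0 _] := Hh.
have Ef : fk = FSwap by case: fk Hk => //= -[_ H].
have [hm1 em1 am1] : [/\ forall x y, hk m1 x y = shift_hk m c i x y,
   forall x y, ex m1 x y + at_ x y c i = ex m x y + at_ x y d i.+1
   & forall x y, ar m1 x y = ar m x y] by move: Hf; rewrite Ef -dc.
have nec : e != c by lia.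
have hkc x : hk m x c = i -> x = r.
  by move=> E; apply: (hk_inj vm i0 E).
have hk1 x : x != r -> forall y, hk m1 x y = hk m x y.
  by move=> nx y; rewrite hm1 /shift_hk; case: ifP => // /andP[/eqP-> /eqP/hkc]; lia.
have hk1' x y : y != c -> hk m1 x y = hk m x y.
  by move=> ny; rewrite hm1 /shift_hk (negbTE ny).
exists c, FExt, d, i.+1, e, bk; split=> //.
- split.
    have := bmove_ar Hb c i; rewrite /at_; move: p1; rewrite dc.
    by case: bk => [|k]; lia.
  move=> [u2 [s Hs hs]].
  move: hs; rewrite (bmove_hk_off Hb) => [hs|]; last lia.
  move: Hs; rewrite (bmove_inrow_off Hb) => [Hs|]; last lia.
  by apply: (not_hooked_top vm i0 top (i:=i) (d:=c)); split=> //; split=> //; exists s.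
- have leg1 : isleg m1 r d i.+1.
    have := row_succ vm i0 u0 Hr; rewrite /isleg /inrow !hk1'; try lia.
    by have := em1 d i.+1; rewrite /at_; move: Hr; rewrite /inrow => *; apply/and3P; split; lia.
  split=> // r' c' z Hl.
  have [H|[Ec Ez [[E _]|[_ H]]]] := fmove_isleg vm i0 Hd Hk Hf Hl; last 2 first.
  + by rewrite Ef in E.
  + by case: ((proj2 top) _ _ _ H); lia.
  case: ((proj2 top) _ _ _ H) => [|[Er Hc]]; [by left|right; split=> //].
  have [Ec|nc] := eqVneq c' c; last first.
    have [Ed|nd] := eqVneq c' d; last by left; lia.
    right; split=> //; subst c' r'.
    by case/and3P: H; rewrite /inrow => He /andP[_ Hn] _;
       have := ent_dich vm (r:=r) (c:=d) (c':=c) (z:=z); rewrite /ent; lia.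
  subst c' r'; case/and3P: Hl => He _; rewrite hm1 /shift_hk hrc !eqxx /=; lia.
- have hkn x y : y <= d -> hk m1 x y = hk m x y by move=> yd; apply: hk1'; lia.
  case Eb: bk tgt Hed => [|k] /=; rewrite !hk1; try lia.
    move=> [H1 H2] ed; split; first by lia.
    move=> e' ee; have [H3 H4] := H2 e' ee; rewrite !hk1; try lia; split=> // z.
    rewrite /ent am1; have := em1 e' z; have := H4 z; rewrite /ent /at_.
    have -> : (e' == c) = false by lia.
    have -> : (e' == d) = false by lia.
    by rewrite /=; lia.
  move=> [H1 H2 H3 H4 H5] ed; rewrite am1; split=> //; [lia..|].
  move=> z; rewrite /ent am1; have := em1 e z; have := H5 z; rewrite /ent /at_.
  have -> : (e == c) = false by lia.
  have -> : (e == d) = false by lia.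
  by rewrite /=; lia.
move=> m3 m3' [hm3 em3 am3] B3; split=> x y.
- rewrite (bmove_hk B3) hm3 hm1 /shift_hk (bmove_hk Hb) -li.
  have [Ey|ney] := eqVneq y c; last by rewrite /=.
  have -> : (y == e) = false by lia.
  by rewrite !andbF.
- have := bmove_ex B3 x y; have := bmove_ex Hb x y; have := em1 x y; have := em3 x y.
  by rewrite li; case: bk => [|k]; lia.
have := bmove_ar B3 x y; have := bmove_ar Hb x y; have := am1 x y; have := am3 x y.
by rewrite li; case: bk => [|k]; lia.
Qed.

Lemma target_raised : hk m r.+1 d = i -> l = i -> fk = FExt -> target m1 r l d BHook.
Proof.
move=> hd li Ef; move: Hf; rewrite Ef => -[hm1 em1 am1].
split; first by rewrite hm1 /shift_hk hd !eqxx /=; lia.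
move=> x dx; have nx : (x == d) = false by lia.
rewrite !hm1 /shift_hk nx /=.
have H := hk_adj vm (r:=r.+1) (c:=x); rewrite -dx hd in H; split; first exact: H.
move=> z; have := em1 x z; rewrite /ent am1 /at_ nx => E Hz.
have Hz' : ent m x z by rewrite /ent; lia.
by have := ent_dich vm (r:=r.+1) (c':=d) Hz'; rewrite hd; lia.
Qed.

(* The bump replaces the hook entry [i.+1] right of [(r.+1, d)] by [i], so that [f_i] then acts by (S);
   if [f_i] acts first, it is the new [i.+1] in [(r.+1, d)] that is bumped. *)
Lemma commutes_new_hook : last_minus (na m2 i) (nb m2 i) d ->
  l = i -> bk = BHook -> d.+1 = e -> ex m d i.+1 = 0 -> inrow m r.+1 d i -> commutes.
Proof.
move=> Hd2 li Eb de u0 Hr.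
have Hec := e_le_c vm top tgt; rewrite Eb /= addn0 in Hec.
have Hr1 := row_succ vm i0 u0 Hr.
have q0 : nb m i d = 0.
  rewrite /nb u0 sub0n addn0.
  case: (posnP (ar m d i.+1)) => // q; exfalso.
  move: tgt; rewrite Eb /= => -[H1 H2]; have [H3 H4] := H2 d (esym de).
  by have := H4 i.+1; rewrite /ent; move: Hr1; rewrite /inrow; lia.
(* Otherwise [top_paired] gives column [d] a [+], against [q0]. *)
have bi : big m r e bk i.+1.
  apply/negPn/negP => nb; have := top_paired vm top tgt li nb Hd ltac:(lia) => -[_ /(_ de)]; lia.
have he : hk m r.+1 e = i.+1 by move: bi tgt; rewrite Eb /= => H [H1 _]; lia.
have NS : fk <> FSwap.
  move=> E; have Hh : hooked m i d by move: Hk; rewrite E.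
  have [_ _ _ [s [Hs hs Hleg]]] := hooked_swap vm i0 Hd Hh.
  have E2 := inrow_uniq vm Hs Hr; subst s.
  by case: ((proj2 top) _ _ _ Hleg); lia.
have hke x : hk m x e = i.+1 -> x = r.+1.
  by move=> E; apply: (hk_inj vm (ltn0Sn i) E).
have nohe x : x != r.+1 -> hk m x e <> i.
  move=> nx E; have [Ec|nec] := eqVneq e c; last first.
    have := top_mid0 vm top tgt li (x:=e); have := ex_hk vm (r:=x) (c:=e).
    by rewrite E Eb /=; lia.
  rewrite Ec -li in E; have E2 := hk_uniq vm (z := l) ltac:(lia) E (top_inrow top); subst x.
  by have := top_hk top; lia.
have Hk2 : hooked m2 i d.
  split; first by have := bmove_ex Hb d i.+1; rewrite Eb u0 /at_; lia.
  by exists r.+1; rewrite ?(bmove_inrow_off Hb) //; [lia|rewrite (bmove_hk Hb) Eb de !eqxx].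
have top1 : topleg m1 r c l.
  apply: (fmove_topleg vm i0 top Hd Hk Hf) => -[H1 H2 H3]; lia.
have h3 m3 : fmove m2 i d FSwap m3 -> forall x y, hk m3 x y = hk m x y.
  move=> [hm3 _ _] x y; rewrite hm3 /shift_hk (bmove_hk Hb) Eb de /=.
  have [Ey|ney] := eqVneq y e; last by rewrite andbF.
  subst y; have [Ex|nex] := eqVneq x r.+1; first by subst x; rewrite /= li eqxx he.
  by rewrite /=; case: eqP => // /(nohe x nex).
have e2 x z : ex m2 x z + at_ x z c l = ex m x z + at_ x z e l by have := bmove_ex Hb x z; rewrite Eb.
have a2 x z : ar m2 x z = ar m x z by have := bmove_ar Hb x z; rewrite Eb; lia.
case Ef: fk NS Hk Hf => // _ [H1 NH] [hm1 em1 am1].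
  exists d, FSwap, c, l, d, (BArm i.+1); split=> //.
    have := am1 d i.+1; move: Hr Hr1; rewrite /inrow /at_ => h1 h2 h4.
    by split; rewrite ?hm1; lia.
  move=> m3 m3' F3 [h3' e3' a3']; have := h3 _ F3; case: F3 => _ em3 am3 hm3; split=> x y.
  - by rewrite hm3 h3' hm1.
  - have := em3 x y; have := e3' x y; have := em1 x y; have := e2 x y; rewrite li de; lia.
  - have := am3 x y; have := a3' x y; have := am1 x y; have := a2 x y; rewrite li; lia.
have [v1 _ _] := fext_col vm i0 Hd Hk Ef.
have hd : hk m r.+1 d = i.
  have := no_leg_above vm top (x:=d) (z:=i); move: Hr; rewrite /inrow v1; lia.
exists d, FSwap, c, l, d, BHook; split=> //; first exact: target_raised.
move=> m3 m3' F3 [h3' e3' a3']; have := h3 _ F3; case: F3 => _ em3 am3 hm3; split=> x y.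
- rewrite hm3 h3' hm1 /shift_hk; have [Ey|ney] := eqVneq y d; last by rewrite andbF.
  subst y; have [Ex|nex] := eqVneq x r.+1; first by subst x; rewrite /= hd.
  rewrite /=; case: eqP => // E; case/eqP: nex.
  exact: (hk_uniq vm i0 E Hr).
- have := em3 x y; have := e3' x y; have := em1 x y; have := e2 x y; rewrite li de; lia.
- by rewrite am3 a3' am1 a2.
Qed.

(** The target cell has hook entry [i], and [l = i] bumps an arm entry [i.+1]. Bump first: [i]
    enters the arm and is raised there. [f_i] first: the hook entry becomes [i.+1] and is bumped by
    [i]. Both leave hook entry [i], leg entry [i.+1] and as many arm entries [i.+1] as before. *)
Lemma commutes_hook_raised : last_minus (na m2 i) (nb m2 i) d ->
  l = i -> is_hook bk = false -> d = e -> fk = FExt -> commutes.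
Proof.
move=> Hd2 li Eh de Ef.
have Hec := e_le_c vm top tgt; rewrite Eh /= addn1 in Hec.
have bi : big m r e bk i.+1.
  apply/negPn/negP => nb; have := top_paired vm top tgt li nb Hd ltac:(lia) => -[] //.
have [v1 p0 u0] := fext_col vm i0 Hd Hk Ef.
case Eb: bk Eh bi tgt => [|k] //= _ bi [H1 H2 H3 H4 H5].
have {bi}Ek : k = i.+1 by lia.
subst k.
have hd : hk m r.+1 d = i.
  have := no_leg_above vm top (x:=d) (z:=i); rewrite v1 de; lia.
have := Hb; rewrite Eb => -[hm2 em2 am2].
have := Hf; rewrite Ef => -[hm1 em1 am1].
exists d, FArm, c, l, d, BHook; split=> //.
- split; first by have := am2 d i; rewrite /at_ de li; lia.
  by move=> [+ _]; have := em2 d i.+1; rewrite /at_ de; lia.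
- by apply: (fmove_topleg vm i0 top Hd Hk Hf) => -[*]; [lia|congruence].
- exact: target_raised.
move=> m3 m3' [hm3 em3 am3] [h3' e3' a3']; split=> x y.
- rewrite hm3 h3' hm1 hm2 /shift_hk; have [Ey|ney] := eqVneq y d; last by rewrite andbF.
  subst y; have [Ex|nex] := eqVneq x r.+1; first by subst x; rewrite /= hd.
  rewrite /=; case: eqP => // E; case/eqP: nex.
  exact: (hk_inj vm i0 E hd).
- have := em3 x y; have := e3' x y; have := em1 x y; have := em2 x y; rewrite li de; lia.
- have := am3 x y; have := a3' x y; have := am1 x y; have := am2 x y; rewrite li de; lia.
Qed.

(** The only arm entry [i] of the target cell is bumped and is also the letter of [f_i]. It is
    raised in the leg after the bump, or it is bumped as [i.+1]. *)
Lemma commutes_last_arm : last_minus (na m2 i) (nb m2 i) d ->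
  bk = BArm i -> d = e -> fk = FArm -> ar m e i = 1 -> commutes.
Proof.
move=> Hd2 Eb de Ef a1.
have := tgt; rewrite Eb /= => -[H1 H2 H3 H4 H5].
have := Hb; rewrite Eb => -[hm2 em2 am2].
have := Hf; rewrite Ef => -[hm1 em1 am1].
have v0 : ex m e i = 0.
  have := no_leg_above vm top (x:=e) (z:=i); lia.
have u0 : ex m e i.+1 = 0.
  by case: Hd => + _; rewrite de {2}/na v0 a1; lia.
exists d, FExt, c, l, e, (BArm i.+1); split=> //.
- split; first by have := am2 d i; rewrite /at_ de a1; lia.
  apply: (bmove_not_hooked vm i0 top tgt Hd Hk Hb); first by move: Hk; rewrite Ef => -[].
  by rewrite Eb => -[].
- by apply: (fmove_topleg vm i0 top Hd Hk Hf) => -[*]; congruence.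
- split; rewrite ?hm1; try lia.
  + by have := am1 e i.+1; rewrite /at_ de; lia.
  + have := ex_hk vm (r:=r.+2) (c:=e).
    by have [->|] := eqVneq (hk m r.+2 e) i.+1; lia.
  move=> z; rewrite /ent em1; have := am1 e z; have := H5 z; rewrite /ent /at_ de.
  by have [->|] := eqVneq z i; [rewrite v0 a1|]; lia.
move=> m3 m3' [hm3 em3 am3] [h3' e3' a3']; split=> x y.
- rewrite hm3 h3' hm1 /shift_hk hm2 de; case: ifP => // /andP[/eqP-> /eqP E].
  by have := ex_hk vm (r:=x) (c:=e); rewrite E v0; lia.
- have := em3 x y; have := e3' x y; have := em1 x y; have := em2 x y; rewrite de; lia.
- have := am3 x y; have := a3' x y; have := am1 x y; have := am2 x y; rewrite de; lia.
Qed.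

Lemma bump_commutes : commutes.
Proof.
have [_ _ /(_ d Hd)] := bump_sig vm top tgt Hb i0.
case=> [[Hd2 NX1 NX2]|[li dc p0 nb He2]|[li dc Hh _ Hc2]]; first last.
- exact: commutes_swap.
- exact: commutes_top.
have [Y1|NY1] := boolP [&& l == i, is_hook bk, d.+1 == e, ex m d i.+1 == 0 & inrow m r.+1 d i].
  case/and5P: Y1 => /eqP li Eb /eqP de /eqP u0 Hr; apply: commutes_new_hook => //.
  by case: bk Eb.
have [Y2|NY2] := boolP [&& l == i, ~~ is_hook bk, d == e & if fk is FExt then true else false].
  case/and4P: Y2 => /eqP li Eb /eqP de Ef; apply: commutes_hook_raised => //; first exact: negbTE.
  by case: fk Ef.
have [Y3|NY3] := boolP [&& (if bk is BArm k then k == i else false), d == e, (if fk is FArm then true else false) & ar m e i == 1].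
  case/and4P: Y3 => Eb /eqP de Ef /eqP a1; apply: commutes_last_arm => //; last by case: fk Ef.
  by case: bk Eb => // k /eqP->.
apply: commutes_same => //.
- by move=> [h1 h2 h3 h4 h5]; move/negP: NY1; apply; rewrite h1 h2 h3 h4 h5 !eqxx.
- by move=> [h1 h2 h3 h4]; move/negP: NY2; apply; rewrite h1 h2 h3 h4 !eqxx.
- by move=> [h1 h2 h3 h4]; move/negP: NY3; apply; rewrite h1 h2 h3 h4 !eqxx.
Qed.
End CommuteMain.

(** * Inverting the moves *)

(* The number of [+] that the [-] of columns [x], ..., [x + n - 1] need from the columns before [x]. *)
Fixpoint need (a b : nat -> nat) n x :=
  if n is n'.+1 then (need a b n' x.+1 - b x) + a x else 0.

Lemma need_leP a b n x :
  need a b n x <= pend a b x <-> (forall y, x <= y < x + n -> a y <= pend a b y).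
Proof.
elim: n x => [|n IH] x /=; first by split=> // _ y; lia.
have Ex := IH x.+1; split=> [H y Hy|H].
  have [->|ne] := eqVneq y x; first lia.
  by apply: (proj1 Ex); rewrite /=; lia.
have := H x ltac:(lia); have := proj2 Ex (fun y Hy => H y ltac:(lia)); rewrite /=; lia.
Qed.

(** If every column leaves a [+] over, one [+] more than needed has arrived at column [x]. *)
Lemma need_lt a b n x : 0 < pend a b (x + n) ->
  (forall y, x <= y < x + n -> a y < pend a b y) -> need a b n x < pend a b x.
Proof.
elim: n x => [|n IH] x /=; first by rewrite addn0.
move=> H Hy; have := IH x.+1 ltac:(rewrite addSnnS; exact: H) (fun y h => Hy y ltac:(lia)).
by have := Hy x ltac:(lia); rewrite /=; lia.
Qed.

Lemma need_eq a b a' b' n x : (forall y, x <= y -> a' y = a y /\ b' y = b y) ->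
  need a' b' n x = need a b n x.
Proof.
elim: n x => //= n IH x H; have [-> ->] := H x (leqnn x).
by rewrite IH // => y xy; apply: H; apply: ltnW.
Qed.

(** No [+] from before [d] survives the [-] of [d], and the [+] of [d] outnumber what the later
    columns need. The width [n] is there because [need] looks at finitely many columns. *)
Definition first_plus a b n d :=
  [/\ d < n, pend a b d <= a d & need a b (n - d.+1) d.+1 < b d].

(** Brings [last_minus] to the shape of [first_plus], so that changing one sign turns one into the
    other by arithmetic. *)
Lemma last_minusP a b n d : (forall x, n <= x -> a x = 0) ->
  last_minus a b d <-> [/\ d < n, pend a b d < a d & need a b (n - d.+1) d.+1 <= b d].
Proof.
move=> an; split=> [[H1 H2]|[H0 H1 H2]].
  have dn : d < n by have := an d; lia.
  split=> //; have /= := proj2 (need_leP a b (n - d.+1) d.+1) (fun y Hy => H2 y ltac:(lia)).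
  by lia.
split=> // x dx; have [nx|xn] := leqP n x; first by rewrite an.
by apply: (proj1 (need_leP a b (n - d.+1) d.+1)); rewrite /=; lia.
Qed.

Lemma last_minus_ex a b n : (forall x, n <= x -> a x = 0) ->
  all_paired a b \/ exists d, last_minus a b d.
Proof.
move=> an; have [/existsP [x0 Hx0]|/existsPn Hn] := boolP [exists x : 'I_n, pend a b x < a x].
  right; have exP : exists x, pend a b x < a x by exists x0.
  have ub x : pend a b x < a x -> x <= n by have := an x; lia.
  case: (ex_maxnP exP ub) => d Hd Hmax; exists d; split=> // x dx.
  by rewrite leqNgt; apply/negP => /Hmax; lia.
left=> x; have [nx|xn] := leqP n x; first by rewrite an.
by have := Hn (Ordinal xn); rewrite /= -leqNgt.
Qed.

Lemma first_plus_ex a b n : pend a b n = 0 \/ exists d, first_plus a b n d.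
Proof.
have [->|Hn] := posnP (pend a b n); [by left|right].
have n0 : 0 < n by case: n Hn.
(* The column sought is the last whose [-] use up all that is pending; column [0] qualifies since
   nothing is pending there. *)
have exP : exists x, (x < n) && (pend a b x <= a x) by exists 0; rewrite n0.
have ub x : (x < n) && (pend a b x <= a x) -> x <= n by lia.
case: (ex_maxnP exP ub) => d /andP[dn Hd] Hmax; exists d; split=> //.
have := @need_lt a b (n - d.+1) d.+1; rewrite subnKC // => /(_ Hn) H.
have /= := H (fun y Hy => ltac:(rewrite ltnNge; apply/negP => Hy'; have := Hmax y ltac:(lia); lia)).
lia.
Qed.

(* [e_i] acts in column [d] by (S). *)
Definition unhooked m i d := ex m d i + ar m d i = 0 /\
  exists r d0, [/\ d = d0.+1, isleg m r d0 i.+1 & hk m r d = i.+1].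

(** An [i.+1] in the extended legs is read first in its column and is paired exactly when the column
    has an [i]. If it is not, it precedes all arm letters and is the first unpaired [+]; this
    separates [FExt] from [FArm]. *)
Definition ekind_at m i d k :=
  match k with
  | FArm => [/\ 0 < ar m d i.+1, ex m d i + ar m d i = 0 -> ex m d i.+1 = 0 & ~ unhooked m i d]
  | FExt => [/\ ex m d i.+1 = 1, ex m d i + ar m d i = 0 & ~ unhooked m i d]
  | FSwap => unhooked m i d
  end.

Definition unshift_hk m d i r c := if (c == d) && (hk m r c == i.+1) then i else hk m r c.

Definition emove m i d k m' :=
  match k with
  | FArm => [/\ forall r c, hk m' r c = hk m r c,
               forall c z, ex m' c z = ex m c z
             & forall c z, ar m' c z + at_ c z d i.+1 = ar m c z + at_ c z d i]
  | FExt => [/\ forall r c, hk m' r c = unshift_hk m d i r c,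
               forall c z, ex m' c z + at_ c z d i.+1 = ex m c z + at_ c z d i
             & forall c z, ar m' c z = ar m c z]
  | FSwap => [/\ forall r c, hk m' r c = unshift_hk m d i r c,
               forall c z, ex m' c z + at_ c z d.-1 i.+1 = ex m c z + at_ c z d i
             & forall c z, ar m' c z = ar m c z]
  end.

Definition narrow m n := forall c z, n <= c -> ex m c z = 0 /\ ar m c z = 0.

Section Inverse.
Variables (m : model) (n i d : nat) (k : fkind) (m' : model).
Hypothesis vm : valid m.
Hypothesis nm : narrow m n.
Hypothesis i0 : 0 < i.

Let a := na m i.
Let b := nb m i.
Let a' := na m' i.
Let b' := nb m' i.

Let a_out x : n <= x -> a x = 0.
Proof. by move=> nx; rewrite /a /na !(proj1 (nm _ nx)) !(proj2 (nm _ nx)). Qed.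

Lemma same_sig x : (forall z, ex m' x z = ex m x z) -> (forall z, ar m' x z = ar m x z) ->
  a' x = a x /\ b' x = b x.
Proof. by move=> H1 H2; rewrite /a /a' /b /b' /na /nb !H1 !H2. Qed.

(** In the kinds [FArm] and [FExt] an unpaired [-] of column [d] turns into a [+]. In (S) column [d]
    loses its [-] to the arriving [i.+1], while the [i.+1] of column [d.+1] loses its partner; so
    [e_i] acts in column [d.+1]. *)
Lemma fmove_inverse : last_minus a b d -> fkind_at m i d k -> fmove m i d k m' ->
  exists d', [/\ first_plus a' b' n d', ekind_at m' i d' k
    & forall m'', emove m' i d' k m'' -> meq m'' m].
Proof.
move=> Hd Hk F; have [dn Hd1 Hd2] := proj1 (@last_minusP a b n d a_out) Hd.
have other x : x != d -> x != (if k is FSwap then d.+1 else d) -> a' x = a x /\ b' x = b x.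
  move=> nx nk; apply: same_sig => z; case: k Hk nk F => _ nk [_ E1 A1];
   have := E1 x z; have := A1 x z; rewrite /at_; lia.
have fp : (if k is FSwap then d.+1 else d) = d -> b' d = (b d).+1 -> a d = (a' d).+1 -> first_plus a' b' n d.
  move=> Ek Eb Ea; rewrite Ek in other; split=> //.
    by rewrite (pend_eq (a := a) (b := b)); [lia|move=> x xd; apply: other; lia].
  by rewrite (need_eq (a := a) (b := b)); [lia|move=> x xd; apply: other; lia].
case Ek: k other fp Hk F => other fp Hk F.
- have [hm em am] := F.
  have Ai := am d i; have Ai1 := am d i.+1; rewrite /at_ !eqxx in Ai Ai1.
  have [p0 nh] := Hk.
  have ad : 0 < na m i d by move: Hd1; rewrite -/a; lia.
  exists d; split.
  + by apply: fp => //; move: ad; rewrite /b' /b /nb /a' /a /na !em; lia.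
  + split; [lia| |].
      by rewrite !em; move: ad; rewrite /na; lia.
    move=> [H [r [d0 [dd H1 H2]]]]; rewrite hm in H2; rewrite em in H.
    by have := ex_hk vm (r:=r) (c:=d); rewrite H2; move: ad; rewrite /na; lia.
  move=> m'' [hm' em' am']; split=> x y; rewrite ?hm' ?hm ?em' ?em //.
  by have := am' x y; have := am x y; lia.
- have [hm em am] := F.
  have [v1 p0 u0] := fext_col vm i0 Hd Hk erefl.
  have Ei := em d i; have Ei1 := em d i.+1; rewrite /at_ !eqxx in Ei Ei1.
  exists d; split.
  + by apply: fp; rewrite // /b' /b /nb /a' /a /na !am; lia.
  + split; [lia|rewrite am; lia|].
    move=> [H [r [d0 [dd H1 H2]]]].
    have hi : hk m r d = i.
      move: H2; rewrite hm /shift_hk eqxx /=; case: eqP => // _ E.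
      by have := ex_hk vm (r:=r) (c:=d); rewrite E; lia.
    have Hl : isleg m r d0 i.+1.
      move: H1; rewrite /isleg /inrow !hm /shift_hk.
      have -> : (d0 == d) = false by lia.
      by have := em d0 i.+1; rewrite /at_ /= => E /and3P[? ? ?]; apply/and3P; split=> //; lia.
    case/and3P: Hl => He Hin _.
    by have := ent_le vm (r:=r) (c:=d0) (z:=i.+1); rewrite /ent -dd hi Hin; lia.
  move=> m'' [hm' em' am']; split=> x y; last by rewrite am' am.
    rewrite hm' /unshift_hk hm /shift_hk; have [->|] := eqVneq y d; rewrite //=.
    have [E|h1] := eqVneq (hk m x d) i; first by rewrite /= eqxx E.
    case: eqP => // E.
    by have := ex_hk vm (r:=x) (c:=d); rewrite E; lia.
  by have := em' x y; have := em x y; lia.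
have [hm em am] := F.
have Hh : hooked m i d := Hk.
have [v1 u1 p1 [s [Hs hs Hleg]]] := hooked_swap vm i0 Hd Hh.
have q0 := hooked_q vm i0 Hh; have [u0 _] := Hh.
have vd := ex_le1 vm d i.
have Ei := em d i; have Ei1 := em d i.+1; have Es := em d.+1 i; have Es1 := em d.+1 i.+1.
have dd1 : (d == d.+1) = false by lia.
have d1d : (d.+1 == d) = false by lia.
have ii1 : (i == i.+1) = false by lia.
have i1i : (i.+1 == i) = false by lia.
rewrite /at_ ?eqxx ?dd1 ?d1d ?ii1 ?i1i /= in Ei Ei1 Es Es1.
have leg' : isleg m' s d i.+1.
  have := row_succ vm i0 u0 Hs; rewrite /isleg /inrow !hm /shift_hk !dd1 /=.
  by move: Hs; rewrite /inrow => *; apply/and3P; split; lia.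
have dn1 : d.+1 < n by rewrite ltnNge; apply/negP => nd; have := nm i nd; lia.
have aE : a d = (a' d).+1 /\ a' d.+1 = 0.
  by move: Hd1; rewrite /a' /a /na !am; lia.
have ad : 0 < na m i d by move: Hd1; rewrite -/a; lia.
have bE : [/\ b d = 0, b' d = 0 & b' d.+1 = (b d.+1).+1].
  by move: ad; rewrite /b' /b /nb /na !am => ad; split; lia.
have [bd bd' bd1] := bE.
exists d.+1; split.
- split=> //.
    by rewrite /= bd' (pend_eq (a := a) (b := b)); [lia|move=> x xd; apply: other; lia].
  rewrite (need_eq (a := a) (b := b)); last by move=> x xd; apply: other; lia.
  by move: Hd2; rewrite (_ : n - d.+1 = (n - d.+2).+1) /= ?bd1; lia.
- split; first by rewrite am; lia.
  by exists s, d; split=> //; rewrite hm /shift_hk eqxx hs eqxx.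
move=> m'' [hm' em' am']; split=> x y; last by rewrite am' am.
  rewrite hm' /unshift_hk hm /shift_hk; have [->|] := eqVneq y d.+1; rewrite //=.
  have [E|/eqP h1] := eqVneq (hk m x d.+1) i; first by rewrite /= eqxx E.
  case: eqP => // E.
  by case/and3P: Hleg => _ Hin _; case: h1; rewrite (hk_uniq vm (ltn0Sn i) E Hin).
by have := em' x y; have := em x y; rewrite /=; lia.
Qed.

Lemma emove_inverse : valid m' -> first_plus a b n d -> ekind_at m i d k -> emove m i d k m' ->
  exists d', [/\ last_minus a' b' d', fkind_at m' i d' k
    & forall m'', fmove m' i d' k m'' -> meq m'' m].
Proof.
move=> vm' [dn Hd1 Hd2] Hk F.
have other x : x != d -> x != (if k is FSwap then d.-1 else d) -> a' x = a x /\ b' x = b x.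
  move=> nx nk; apply: same_sig => z; case: k Hk nk F => _ nk [_ E1 A1];
   have := E1 x z; have := A1 x z; rewrite /at_; lia.
have nm' : forall x, n <= x -> a' x = 0.
  by move=> x nx; have [->] := other x ltac:(lia) ltac:(case: k; lia); rewrite a_out.
have fp : (if k is FSwap then d.-1 else d) = d -> b d = (b' d).+1 -> a' d = (a d).+1 -> last_minus a' b' d.
  move=> Ek Eb Ea; rewrite Ek in other; apply/(last_minusP _ _ nm'); split=> //.
    by rewrite (pend_eq (a := a) (b := b)); [lia|move=> x xd; apply: other; lia].
  by rewrite (need_eq (a := a) (b := b)); [lia|move=> x xd; apply: other; lia].
case Ek: k other fp Hk F => other fp Hk F.
- have [hm em am] := F.
  have Ai := am d i; have Ai1 := am d i.+1; rewrite /at_ !eqxx in Ai Ai1.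
  have [q0 Hu nh] := Hk; have u1 := ex_le1 vm d i.+1.
  exists d; split.
  + by apply: fp; rewrite // /b' /b /nb /a' /a /na !em; lia.
  + split; first lia.
    move=> [u0 [s Hs hs]]; rewrite em in u0; rewrite hm in hs.
    have Hs' : inrow m s d i by move: Hs; rewrite /inrow !hm.
    have := ent_le vm (r:=s) (c:=d) (z:=i.+1); rewrite (row_succ vm i0 u0 Hs') hs /ent; lia.
  move=> m'' [hm' em' am']; split=> x y; rewrite ?hm' ?hm ?em' ?em //.
  by have := am' x y; have := am x y; lia.
- have [hm em am] := F.
  have [u1 vp0 nh] := Hk.
  have Ei := em d i; have Ei1 := em d i.+1; rewrite /at_ !eqxx in Ei Ei1.
  exists d; split.
  + by apply: fp; rewrite // /b' /b /nb /a' /a /na !am; lia.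
  + split; first by rewrite am; lia.
    move=> [u0 [s Hs hs]].
    have hs' : hk m s d.+1 = i by move: hs; rewrite hm /unshift_hk; case: ifP => //; lia.
    have Hin : inrow m s d i.+1.
      by move: Hs; rewrite /inrow !hm /unshift_hk eqxx /=; do 2!case: eqP; lia.
    by have := ent_le vm (r:=s) (c:=d) (z:=i.+1); rewrite Hin hs' /ent; lia.
  move=> m'' [hm' em' am']; split=> x y; last by rewrite am' am.
    rewrite hm' /shift_hk hm /unshift_hk; have [->|] := eqVneq y d; rewrite //=.
    have [E|h1] := eqVneq (hk m x d) i.+1; first by rewrite /= eqxx E.
    case: eqP => // E.
    by have := ex_hk vm (r:=x) (c:=d); rewrite E; lia.
  by have := em' x y; have := em x y; lia.
have [hm em am] := F.
have [vp0 [s [d0 [dd Hleg hs]]]] := Hk.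
have u1 : ex m d i.+1 = 1 by rewrite -hs ex_hk // hs.
have u0d : ex m d0 i.+1 = 1 by case/and3P: Hleg => H _ _; have := ex_le1 vm d0 i.+1; lia.
rewrite dd /= in em.
have dd1 : (d0 == d0.+1) = false by lia.
have d1d : (d0.+1 == d0) = false by lia.
have ii1 : (i == i.+1) = false by lia.
have i1i : (i.+1 == i) = false by lia.
have Ei := em d0 i; have Ei1 := em d0 i.+1; have Es := em d i; have Es1 := em d i.+1.
rewrite /at_ dd ?eqxx ?dd1 ?d1d ?ii1 ?i1i /= in Ei Ei1 Es Es1.
rewrite dd in u1 vp0 Hd1 Hd2 dn.
have ad : a d0.+1 = 0 by rewrite /a /na; lia.
(* Column [d] has no unpaired [-], so a [+] of [d0] would be unpaired or pending before the first
   unpaired one. *)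
have [b0 Hd0] : b d0 = 0 /\ pend a b d0 <= a d0 by move: Hd1; rewrite ad /=; lia.
have bd : b d0.+1 = (b' d0.+1).+1 /\ a' d0.+1 = 0.
  by rewrite /b /b' /a' /nb /na !am; lia.
have a0 : a' d0 = (a d0).+1 /\ b' d0 = 0.
  by move: b0; rewrite /b /b' /a' /a /nb /na !am; lia.
exists d0; split.
- apply/(last_minusP _ _ nm'); split; first lia.
    by rewrite (pend_eq (a := a) (b := b)); [lia|move=> x xd; apply: other; lia].
  have -> : n - d0.+1 = (n - d0.+2).+1 by lia.
  by rewrite /= (need_eq (a := a) (b := b)); [lia|move=> x xd; apply: other; lia].
- split; first lia.
  exists s; last by rewrite hm /unshift_hk -dd eqxx hs eqxx.
  have nd : (d0 == d) = false by lia.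
  rewrite /inrow !hm /unshift_hk nd /=.
  by case/and3P: Hleg; rewrite /inrow; lia.
move=> m'' [hm' em' am']; split=> x y; last by rewrite am' am.
  rewrite hm' /shift_hk hm /unshift_hk -dd; have [->|] := eqVneq y d; rewrite //=.
  have [E|h1] := eqVneq (hk m x d) i.+1; first by rewrite /= eqxx E.
  case: eqP => // E.
  by have := ex_hk vm (r:=x) (c:=d); rewrite E dd; lia.
by have := em' x y; have := em x y; lia.
Qed.
End Inverse.

(** * From tableaux to the model *)

Lemma row_size_gt0 t r c : c < size (row t r) -> r < size t.
Proof. by rewrite /row; case: (ltnP r) => // H; rewrite nth_default. Qed.

Lemma has_cellE t r c : has_cell t r c = (c < size (row t r)).
Proof. by rewrite /has_cell; case: (ltnP c) => [/row_size_gt0->|]; rewrite ?andbF. Qed.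

Lemma cellat_out t r c : size (row t r) <= c -> cellat t r c = dcell.
Proof. exact: nth_default. Qed.

Lemma size_row_upd t r c g r' :
  size (row (upd t r c g) r') = if r' == r then maxn c.+1 (size (row t r)) else size (row t r').
Proof. by rewrite /row nth_set_nth /=; case: eqP => // _; rewrite size_set_nth. Qed.

Lemma cellat_upd t r c g r' c' :
  cellat (upd t r c g) r' c' = if (r' == r) && (c' == c) then g (cellat t r c) else cellat t r' c'.
Proof.
rewrite {1}/cellat /row nth_set_nth /=; case: eqP => [->|] //=; rewrite nth_set_nth /=.
by case: eqP.
Qed.

Lemma size_upd t r c g : size (upd t r c g) = maxn r.+1 (size t).
Proof. exact: size_set_nth. Qed.

Lemma valid_hookP (U : cell) : reflect
  [/\ U.1 != [::], sorted ltn U.1, sorted leq U.2, (forall z, z \in entries U -> 0 < z)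
    & forall z, z \in U.2 -> hook_entry U <= z] (valid_hook U).
Proof.
apply: (iffP and5P) => -[H1 H2 H3 H4 H5]; split=> //.
- by move=> z Hz; apply: (allP H4).
- case: U.2 H3 H5 => // a s /= Hs ha z; rewrite inE => /orP[/eqP->//|zs].
  by apply: (leq_trans ha); have := order_path_min leq_trans Hs => /allP/(_ z zs).
- by apply/allP.
by case: U.2 H5 => // a s H5; apply: H5; rewrite mem_head.
Qed.

Lemma cmax_leP U n : reflect (forall y, y \in entries U -> y <= n) (cmax U <= n).
Proof.
rewrite /cmax; elim: (entries U) => [|x s IH] /=; first by apply: (iffP idP).
rewrite geq_max; apply: (iffP andP) => [[H1 /IH H2] y|H].
  by rewrite inE => /orP[/eqP->//|/H2].
split; first by apply: H; rewrite mem_head.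
by apply/IH => y ys; apply: H; rewrite inE ys orbT.
Qed.

Lemma cmin_geP U n : entries U != [::] ->
  reflect (forall y, y \in entries U -> n <= y) (n <= cmin U).
Proof.
rewrite /cmin; case: (entries U) => // x s _; rewrite [head _ _]/=.
have -> : (n <= foldr minn x (x :: s)) = all (leq n) (x :: s).
  rewrite /= leq_min; case: (leqP n x) => //= nx.
  by elim: s => //= y s IH; rewrite leq_min IH.
exact: allP.
Qed.

(** Cells outside the shape equal [dcell] and have no entries, so the two inequalities hold without
    bounds on [r] and [c]. *)
Record HVTP (t : hvt) : Prop := MkHVT {
  hv_row : forall r, r < size t -> 0 < size (row t r);
  hv_shape : forall r, size (row t r.+1) <= size (row t r);
  hv_cell : forall r c, c < size (row t r) -> valid_hook (cellat t r c);
  hv_right : forall r c y z, y \in entries (cellat t r c) ->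
     z \in entries (cellat t r c.+1) -> y <= z;
  hv_up : forall r c y z, y \in entries (cellat t r c) ->
     z \in entries (cellat t r.+1 c) -> y < z }.

Lemma entries_in t r c z : z \in entries (cellat t r c) -> c < size (row t r).
Proof. by case: ltnP => // H; rewrite cellat_out. Qed.

Lemma valid_entries U : valid_hook U -> entries U != [::].
Proof. by case/valid_hookP; rewrite /entries; case: U.1. Qed.

Lemma HVT_iff t : is_HVT t <-> HVTP t.
Proof.
split.
  case/and4P => /allP H1 /(sortedP 0) H2 /allP H3 /allP H4.
  have Hv r c : c < size (row t r) -> valid_hook (cellat t r c).
    move=> cr; have rt := row_size_gt0 cr.
    by have /andP[_ /allP] := H1 _ (mem_nth [::] rt); apply; apply: mem_nth.
  have Hs r : size (row t r.+1) <= size (row t r).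
    have [rt|rt] := ltnP r.+1 (size t); last by rewrite /row nth_default.
    have := H2 r; rewrite size_map => /(_ rt).
    by rewrite !(nth_map [::]) //; lia.
  split=> //.
  - by move=> r rt; have /andP[] := H1 _ (mem_nth [::] rt); rewrite -size_eq0 lt0n.
  - move=> r c y z Hy Hz; have cz := entries_in Hz; have rt := row_size_gt0 cz.
    have := H3 r; rewrite mem_iota /= add0n => /(_ rt) /allP /(_ c).
    rewrite mem_iota => /(_ ltac:(lia)) Hm.
    have /cmin_geP := leq_trans (elimT (cmax_leP _ _) (leqnn _) y Hy) Hm.
    by apply=> //; apply: valid_entries; apply: Hv.
  move=> r c y z Hy Hz; have cz := entries_in Hz; have rt := row_size_gt0 cz.
  have := H4 r; rewrite mem_iota => /(_ ltac:(lia)) /allP /(_ c).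
  rewrite mem_iota => /(_ ltac:(lia)) Hm.
  have /cmin_geP := leq_ltn_trans (elimT (cmax_leP _ _) (leqnn _) y Hy) Hm.
  by apply=> //; apply: valid_entries; apply: Hv.
case=> H1 H2 H3 H4 H5; apply/and4P; split.
- apply/allP => rw /(nthP [::]) [r rt <-]; apply/andP; split.
    by have := H1 r rt; rewrite /row; case: nth.
  by apply/allP => U /(nthP dcell) [c cr <-]; apply: H3.
- apply/(sortedP 0) => r; rewrite size_map => rt.
  by rewrite !(nth_map [::]) //; [apply: H2|lia].
- apply/allP => r _; apply/allP => c; rewrite mem_iota => cr.
  have Hv : valid_hook (cellat t r c.+1) by apply: H3; lia.
  apply/cmax_leP => y Hy; apply/cmin_geP; first exact: valid_entries.
  by move=> z; apply: H4.
apply/allP => r _; apply/allP => c; rewrite mem_iota => cr.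
have Hv : valid_hook (cellat t r.+1 c) by apply: H3; lia.
have Hc : 0 < cmin (cellat t r.+1 c).
  by apply/cmin_geP; [exact: valid_entries|case/valid_hookP: Hv].
rewrite -(prednK Hc) ltnS; apply/cmax_leP => y Hy; rewrite -ltnS prednK //.
by apply/cmin_geP; [exact: valid_entries|move=> z; apply: H5].
Qed.

(** The bounds on [r] and [c] admit a new cell at the end of a row or on top, as a bump may
    create. *)
Lemma HVTP_upd t r c g (U := g (cellat t r c)) : HVTP t ->
  r <= size t -> c <= size (row t r) -> (0 < r -> c < size (row t r.-1)) -> valid_hook U ->
  (forall c0 y z, c = c0.+1 -> y \in entries (cellat t r c0) -> z \in entries U -> y <= z) ->
  (forall y z, y \in entries U -> z \in entries (cellat t r c.+1) -> y <= z) ->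
  (forall r0 y z, r = r0.+1 -> y \in entries (cellat t r0 c) -> z \in entries U -> y < z) ->
  (forall y z, y \in entries U -> z \in entries (cellat t r.+1 c) -> y < z) ->
  HVTP (upd t r c g).
Proof.
move=> [H1 H2 H3 H4 H5] rt cr cr1 HU K1 K2 K3 K4; split.
- move=> r'; rewrite size_upd size_row_upd => Hr; case: eqP => [_|ne]; first lia.
  by apply: H1; lia.
- move=> r'; rewrite !size_row_upd; case: eqP => [E|ne]; case: eqP => [E'|ne'].
  + lia.
  + by subst r; have := H2 r'; have := cr1 isT; rewrite /=; lia.
  + by subst r; have := H2 r'; lia.
  exact: H2.
- move=> r' c'; rewrite size_row_upd cellat_upd; case: (eqVneq r' r) => [->|ne]; last exact: H3.
  by case: (eqVneq c' c) => [//|ne] /= H; apply: H3; lia.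
- move=> r' c' y z; rewrite !cellat_upd.
  case: (eqVneq r' r) => [->|ne]; last exact: H4.
  case: (eqVneq c' c) => [->|nc]; case: (eqVneq _ c) => [Ec|nc'] /=; [lia|exact: K2| |exact: H4].
  exact: K1.
move=> r' c' y z; rewrite !cellat_upd.
case: (eqVneq c' c) => [->|nc]; rewrite ?andbF ?andbT; last exact: H5.
case: (eqVneq r' r) => [->|nc]; case: (eqVneq _ r) => [Ec|nc'] /=; [lia|exact: K4| |exact: H5].
exact: K3.
Qed.

Lemma HVTP_upd_in t r c g x (U := g (cellat t r c)) : HVTP t -> c < size (row t r) -> valid_hook U ->
  {subset entries U <= x :: entries (cellat t r c)} ->
  (forall c0 y, c = c0.+1 -> y \in entries (cellat t r c0) -> y <= x) ->
  (forall z, z \in entries (cellat t r c.+1) -> x <= z) ->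
  (forall r0 y, r = r0.+1 -> y \in entries (cellat t r0 c) -> y < x) ->
  (forall z, z \in entries (cellat t r.+1 c) -> x < z) ->
  HVTP (upd t r c g).
Proof.
move=> Ht cr HU sub K1 K2 K3 K4; have [H1 H2 H3 H4 H5] := Ht.
apply: HVTP_upd => //.
- exact: ltnW (row_size_gt0 cr).
- exact: ltnW.
- by case: r cr {HU sub K1 K2 K3 K4 U} => //= r cr _; apply: leq_trans cr (H2 r).
- move=> c0 y z E Hy /sub; rewrite inE => /orP[/eqP->|Hz]; first exact: K1 E Hy.
  by apply: (H4 r c0) => //; rewrite -E.
- by move=> y z /sub; rewrite inE => /orP[/eqP->|Hy Hz]; [exact: K2|exact: (H4 r c)].
- move=> r0 y z E Hy /sub; rewrite inE => /orP[/eqP->|Hz]; first exact: K3 E Hy.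
  by apply: (H5 r0 c) => //; rewrite -E.
by move=> y z /sub; rewrite inE => /orP[/eqP->|Hy Hz]; [exact: K4|exact: (H5 r c)].
Qed.

Lemma HVTP_upd_sub t r c g (U := g (cellat t r c)) : HVTP t -> c < size (row t r) -> valid_hook U ->
  {subset entries U <= entries (cellat t r c)} -> HVTP (upd t r c g).
Proof.
move=> Ht cr HU sub; have [H1 H2 H3 H4 H5] := Ht.
have [x Hx] : exists x, x \in entries (cellat t r c).
  have := valid_entries (H3 _ _ cr); case: (entries _) => // x s _.
  by exists x; rewrite mem_head.
apply: (HVTP_upd_in (x := x)) => //.
- by move=> y /sub Hy; rewrite inE Hy orbT.
- by move=> c0 y E Hy; apply: (H4 r c0) => //; rewrite -E.
- by move=> z Hz; apply: (H4 r c).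
- by move=> c0 y E Hy; apply: (H5 c0 c) => //; rewrite -E.
by move=> z Hz; apply: (H5 r c).
Qed.

Lemma ltn_transitive : transitive ltn.
Proof. by move=> a b d; apply: ltn_trans. Qed.

Lemma ltn_uniq s : sorted ltn s -> uniq s.
Proof. exact: (sorted_uniq ltn_transitive ltnn). Qed.

Lemma ltn_leq_sorted s : sorted ltn s -> sorted leq s.
Proof. by rewrite ltn_sorted_uniq_leq => /andP[]. Qed.

Definition colsum (pr : cell -> seq nat) (t : hvt) (c z : nat) :=
  \sum_(0 <= r < size t) count_mem z (pr (cellat t r c)).

Definition xl (U : cell) : seq nat := U.1.
Definition arm (U : cell) : seq nat := U.2.

(** [hook_entry dcell] is [0], which gives the value [0] outside the shape. *)
Definition md (t : hvt) : model :=
  Model (fun r c => hook_entry (cellat t r c)) (colsum xl t) (colsum arm t).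

Lemma sum_nat_upd N r (f f' : nat -> nat) : r < N ->
  (forall x, x != r -> f' x = f x) ->
  \sum_(0 <= x < N) f' x + f r = \sum_(0 <= x < N) f x + f' r.
Proof.
move=> rN H; rewrite !(bigD1_seq r) ?iota_uniq ?mem_index_iota //=.
by rewrite (eq_bigr f) //; lia.
Qed.

Lemma colsum_widen pr t c z N : pr dcell = [::] -> size t <= N ->
  colsum pr t c z = \sum_(0 <= r < N) count_mem z (pr (cellat t r c)).
Proof.
move=> H tN; rewrite [RHS](@big_cat_nat _ _ _ (size t)) //= [X in _ = _ + X]big_nat_cond [X in _ = _ + X]big1 ?addn0 //.
by move=> r /andP[/andP[Hr _] _]; rewrite /cellat /row !nth_default // H.
Qed.

Lemma colsum_upd pr t r c g c' z : pr dcell = [::] ->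
  colsum pr (upd t r c g) c' z + (c' == c) * count_mem z (pr (cellat t r c)) =
  colsum pr t c' z + (c' == c) * count_mem z (pr (g (cellat t r c))).
Proof.
move=> Hp; rewrite (colsum_widen _ _ Hp (leqnn _)) (@colsum_widen pr t c' z (size (upd t r c g))) //; last first.
  by rewrite size_upd leq_maxr.
case: (eqVneq c' c) => [->|ne]; last first.
  by rewrite !addn0; apply: eq_bigr => x _; rewrite cellat_upd (negbTE ne) andbF.
rewrite !mul1n.
have rN : r < size (upd t r c g) by rewrite size_upd leq_max ltnSn.
have -> : g (cellat t r c) = cellat (upd t r c g) r c by rewrite cellat_upd !eqxx.
apply: (sum_nat_upd (f' := fun x => count_mem z (pr (cellat (upd t r c g) x c))) (f := fun x => count_mem z (pr (cellat t x c)))) => // x ne.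
by rewrite cellat_upd (negbTE ne).
Qed.

Section Model.
Variable t : hvt.
Hypothesis Ht : HVTP t.
Let m := md t.

Lemma md_validP r c : c < size (row t r) ->
  [/\ (cellat t r c).1 != [::], sorted ltn (cellat t r c).1, sorted leq (cellat t r c).2,
    (forall z, z \in entries (cellat t r c) -> 0 < z)
    & forall z, z \in (cellat t r c).2 -> hook_entry (cellat t r c) <= z].
Proof. by move=> /(hv_cell Ht) /valid_hookP. Qed.

Lemma hook_in r c : c < size (row t r) -> hook_entry (cellat t r c) \in (cellat t r c).1.
Proof.
by move/md_validP => [+ _ _ _ _]; rewrite /hook_entry; case: (cellat t r c).1 => // x s _; rewrite mem_head.
Qed.

Lemma hk_mem r c : c < size (row t r) -> hk m r c \in entries (cellat t r c).
Proof. by move=> H; rewrite mem_cat (hook_in H). Qed.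

Lemma hk_gt0 r c : (0 < hk m r c) = (c < size (row t r)).
Proof.
case: (ltnP c) => [H|H]; last by rewrite /= cellat_out.
have [_ _ _ H4 _] := md_validP H; apply: H4.
exact: hk_mem.
Qed.

Lemma hook_le r c z : z \in entries (cellat t r c) -> hk m r c <= z.
Proof.
move=> Hz; have [H1 H2 H3 H4 H5] := md_validP (entries_in Hz).
move: Hz; rewrite mem_cat => /orP[Hz|]; last exact: H5.
rewrite /= /hook_entry; case: (cellat t r c).1 H2 Hz => // x s /= Hs; rewrite inE => /orP[/eqP->//|].
by have /allP H := order_path_min ltn_transitive Hs => /H /ltnW.
Qed.

Lemma leg_gt r c z : z \in leg (cellat t r c) -> hk m r c < z.
Proof.
rewrite /leg => Hz; have [|H1 H2 H3 H4 H5] := @md_validP r c.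
  by apply: (@entries_in t r c z); rewrite mem_cat mem_behead.
rewrite /= /hook_entry; case: (cellat t r c).1 H2 Hz => // x s /= Hs.
by have /allP H := order_path_min ltn_transitive Hs => /H.
Qed.

Lemma size_row_mono r s : r <= s -> size (row t s) <= size (row t r).
Proof.
elim: s => [|s IH]; first by rewrite leqn0 => /eqP->.
rewrite leq_eqVlt => /orP[/eqP->//|/IH]; apply: leq_trans; exact: hv_shape Ht s.
Qed.

Lemma entries_lt r s c y z : r < s -> y \in entries (cellat t r c) -> z \in entries (cellat t s c) -> y < z.
Proof.
elim: s z => // s IH z; rewrite ltnS leq_eqVlt => /orP[/eqP<- Hy Hz|rs Hy Hz].
  exact: (hv_up Ht (r:=r) (c:=c) Hy Hz).
have cs : c < size (row t s) by apply: leq_trans (entries_in Hz) (hv_shape Ht s).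
have Hh := hk_mem cs.
exact: ltn_trans (IH _ rs Hy Hh) (hv_up Ht (r:=s) (c:=c) Hh Hz).
Qed.

Lemma entries_inrow r c z : z \in entries (cellat t r c) -> inrow m r c z.
Proof.
move=> Hz; rewrite /inrow hk_gt0 (entries_in Hz) hook_le // andTb hk_gt0.
case: (ltnP c (size (row t r.+1))) => // H; rewrite andTb -ltnNge.
exact: (hv_up Ht (r:=r) (c:=c) Hz (hk_mem H)).
Qed.

Lemma hk_lt r s c : r < s -> 0 < hk m s c -> 0 < hk m r c < hk m s c.
Proof.
move=> rs; rewrite !hk_gt0 => H.
have H' : c < size (row t r) by apply: leq_trans H (size_row_mono (ltnW rs)).
by rewrite H' /=; apply: (entries_lt rs); apply: hk_mem.
Qed.

Lemma inrow_inj r s c z : inrow m r c z -> inrow m s c z -> r = s.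
Proof.
wlog rs : r s / r < s => [H Hr Hs|].
  by have [/H/(_ Hr Hs)//|/H/(_ Hs Hr)->//|//] := ltngtP r s.
rewrite /inrow => Hr Hs; have [E|ne] := eqVneq s r.+1; first by subst s; lia.
by have := @hk_lt r.+1 s c ltac:(lia); lia.
Qed.

(** Columns are strict, so all copies of [z] in a column share one cell and the column count is a
    cell count. *)
Lemma colsum_cell pr r c z : pr dcell = [::] -> (forall U, {subset pr U <= entries U}) ->
  inrow m r c z -> colsum pr t c z = count_mem z (pr (cellat t r c)).
Proof.
move=> Hp sub Hr; rewrite (@colsum_widen pr t c z (maxn r.+1 (size t))) ?leq_maxr //.
rewrite (bigD1_seq r) ?iota_uniq ?mem_index_iota ?leq_max ?ltnSn //= big1 ?addn0 // => s sr.
apply/count_memPn/negP => /sub/entries_inrow Hs; case/eqP: sr; exact: (inrow_inj Hs Hr).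
Qed.

Lemma xl_sub U : {subset xl U <= entries U}.
Proof. by move=> z; rewrite mem_cat => ->. Qed.

Lemma arm_sub U : {subset arm U <= entries U}.
Proof. by move=> z; rewrite mem_cat orbC => ->. Qed.

Lemma count_xl r c z : count_mem z (cellat t r c).1 = inrow m r c z * ex m c z.
Proof.
case Hr: inrow; first by rewrite mul1n; apply/esym/colsum_cell => //; exact: xl_sub.
rewrite mul0n; apply/count_memPn/negP => Hz.
by rewrite entries_inrow // in Hr; apply: xl_sub.
Qed.

Lemma count_arm r c z : count_mem z (cellat t r c).2 = inrow m r c z * ar m c z.
Proof.
case Hr: inrow; first by rewrite mul1n; apply/esym/colsum_cell => //; exact: arm_sub.
rewrite mul0n; apply/count_memPn/negP => Hz.
by rewrite entries_inrow // in Hr; apply: arm_sub.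
Qed.

Lemma mem_xl r c z : (z \in (cellat t r c).1) = inrow m r c z && (0 < ex m c z).
Proof. by rewrite -has_pred1 has_count count_xl; case: inrow; rewrite ?mul1n. Qed.

Lemma mem_arm r c z : (z \in (cellat t r c).2) = inrow m r c z && (0 < ar m c z).
Proof. by rewrite -has_pred1 has_count count_arm; case: inrow; rewrite ?mul1n. Qed.

Lemma mem_entries r c z : (z \in entries (cellat t r c)) = inrow m r c z && ent m c z.
Proof. by rewrite mem_cat mem_xl mem_arm /ent -andb_orr addn_gt0. Qed.

Lemma mem_leg r c z : (z \in leg (cellat t r c)) = isleg m r c z.
Proof.
apply/idP/idP => [H|/and3P[He Hi Hl]].
  rewrite /isleg leg_gt // andbT andbC -mem_xl; exact: mem_behead.
have := mem_xl r c z; rewrite He Hi /= /leg; move: Hl; rewrite /= /hook_entry.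
case: (cellat t r c).1 => //= x s xz; rewrite inE => /orP[/eqP E|//]; lia.
Qed.

Lemma colsum_ex pr c z : (forall U, {subset pr U <= entries U}) ->
  0 < colsum pr t c z -> exists2 r, inrow m r c z & z \in pr (cellat t r c).
Proof.
move=> sub; rewrite /colsum lt0n sum_nat_seq_neq0 => /hasP[r _ /=].
rewrite -lt0n -has_count has_pred1 => Hz; exists r => //.
by apply: entries_inrow; apply: sub.
Qed.

Lemma md_valid : valid m.
Proof.
have entr c z : ent m c z -> exists r, inrow m r c z.
  rewrite /ent addn_gt0 => /orP[|] H.
    by have [r Hr _] := colsum_ex xl_sub H; exists r.
  by have [r Hr _] := colsum_ex arm_sub H; exists r.
split=> //.
- move=> c z; case: (posnP (ex m c z)) => [->//|H].
  have [r Hr Hz] := colsum_ex xl_sub H.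
  have := count_xl r c z; rewrite Hr mul1n => <-.
  have [_ Hs _ _ _] := md_validP (entries_in (xl_sub Hz)).
  by rewrite count_uniq_mem ?leq_b1 // ltn_uniq.
- move=> r c; rewrite hk_gt0 => H.
  have Hin := hook_in H; have := count_xl r c (hk m r c).
  have Hr : inrow m r c (hk m r c) by apply: entries_inrow; apply: xl_sub.
  rewrite Hr mul1n => <-.
  have [_ Hs _ _ _] := md_validP H.
  by rewrite count_uniq_mem ?ltn_uniq //= Hin.
- by move=> r c; apply: hk_lt.
- by move=> r c; rewrite !hk_gt0; apply: ltnW.
move=> r c z Hz Hr; rewrite hk_gt0 => H.
apply: (hv_right Ht (r := r) (c := c)); first by rewrite mem_entries Hr.
exact: hk_mem.
Qed.

Lemma md_narrow : narrow m (size (row t 0)).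
Proof.
move=> c z Hc; have H r : cellat t r c = dcell.
  by apply: cellat_out; apply: leq_trans (size_row_mono (leq0n r)) Hc.
by split; apply: big1 => r _; rewrite H.
Qed.
End Model.

Lemma hk_shape t t' : HVTP t -> HVTP t' ->
  (forall r c, (0 < hk (md t') r c) = (0 < hk (md t) r c)) ->
  size t' = size t /\ forall r, size (row t' r) = size (row t r).
Proof.
move=> Ht Ht' H; have Hs r : size (row t' r) = size (row t r).
  have Hc c : (c < size (row t' r)) = (c < size (row t r)).
    by rewrite -(hk_gt0 Ht) -(hk_gt0 Ht') H.
  by apply/eqP; rewrite eqn_leq; apply/andP; split; rewrite leqNgt; [rewrite Hc|rewrite -Hc]; rewrite ltnn.
have Hst (s s' : hvt) : HVTP s -> (forall r, size (row s r) = size (row s' r)) -> size s <= size s'.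
  move=> Hs1 E; rewrite leqNgt; apply/negP => Hlt; have := hv_row Hs1 Hlt.
  by rewrite E /row nth_default.
by split=> //; apply/eqP; rewrite eqn_leq !Hst.
Qed.

(** Hook entries give the shape and the row of every value; the legs and arms are sorted, hence
    fixed by their multiplicities. *)
Lemma md_inj t t' : HVTP t -> HVTP t' -> meq (md t) (md t') -> t = t'.
Proof.
move=> Ht Ht' [Hh He Ha].
have Hin r c z : inrow (md t) r c z = inrow (md t') r c z by rewrite /inrow !Hh.
have [Hst Hs] := hk_shape Ht' Ht (fun r c => congr1 (leq 1) (Hh r c)).
apply: (@eq_from_nth _ [::]) => // r rt.
apply: (@eq_from_nth _ dcell) => [|c cr]; first exact: Hs.
have H1 := md_validP Ht (r := r) (c := c) cr.
have H2 := @md_validP _ Ht' r c ltac:(rewrite -Hs; exact: cr).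
case: H1 => _ s1 s2 _ _; case: H2 => _ s1' s2' _ _.
have E1 : (cellat t r c).1 = (cellat t' r c).1.
  apply: (sorted_eq leq_trans anti_leq); rewrite ?sorted_leq_nat //.
  - exact: ltn_leq_sorted s1.
  - exact: ltn_leq_sorted s1'.
  by apply/allP => z _ /=; rewrite (count_xl Ht) (count_xl Ht') Hin He.
have E2 : (cellat t r c).2 = (cellat t' r c).2.
  apply: (sorted_eq leq_trans anti_leq) => //.
  by apply/allP => z _ /=; rewrite (count_arm Ht) (count_arm Ht') Hin Ha.
rewrite -/(row t r) -/(row t' r) -/(cellat t r c) -/(cellat t' r c).
by rewrite [cellat t r c]surjective_pairing E1 E2 -surjective_pairing.
Qed.

(** * Unpaired signs *)

(** In front of a reduced word a new sign can cancel only with its first letter, so a single fold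
    from the right computes the word of unpaired signs. *)
Definition push (x : bool * letter) (s : seq (bool * letter)) :=
  if s is y :: s' then if x.1 && ~~ y.1 then s' else x :: s else [:: x].

Definition red (s : seq (bool * letter)) := foldr push [::] s.

Lemma push_pair x y s : x.1 && ~~ y.1 -> push x (push y s) = s.
Proof. by case: y => [[] q]; rewrite ?andbF //; case: x => [[] p] //; case: s. Qed.

Lemma rm_pairE x y s :
  rm_pair [:: x, y & s] = if x.1 && ~~ y.1 then s else x :: rm_pair (y :: s).
Proof. by []. Qed.

Lemma red_rm_pair s : red (rm_pair s) = red s.
Proof.
elim: (size s) {-2}s (leqnn (size s)) => [|n IH] {}s; first by case: s.
case: s => [|x [|y s]] // Hn.
rewrite rm_pairE; case: ifP => [Hxy|_]; first by rewrite [RHS]/= push_pair.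
by rewrite -[LHS]/(push x (red (rm_pair (y :: s)))) IH.
Qed.

Lemma red_rm_fix s : rm_pair s = s -> red s = s.
Proof.
elim: s => // x [|y s] IH //; rewrite rm_pairE; case: ifP => [Hxy E|Hxy [E]].
  by have := congr1 size E => /=; lia.
by rewrite -[LHS]/(push x (red (y :: s))) (IH E) /= Hxy.
Qed.

Lemma size_rm_pair s : rm_pair s = s \/ size (rm_pair s) < size s.
Proof.
elim: s => [|x [|y s] IH]; [by left|by left|].
rewrite rm_pairE; case: ifP => [_|_]; first by right => /=; lia.
by case: IH => [->|H]; [left|right; rewrite /= ltnS].
Qed.

(** A round of [rm_pair] preserves [red] and either shortens the word or fixes it; a fixed word is
    its own reduction. *)
Lemma unpaired_red s : unpaired s = red s.
Proof.
suff H n : size s <= n -> iter n rm_pair s = red s by exact: H.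
elim: n s => [|n IH] s; first by case: s.
move=> Hn; rewrite iterSr; case: (size_rm_pair s) => [E|H].
  by rewrite E iter_fix // red_rm_fix.
by rewrite IH ?red_rm_pair //; lia.
Qed.

Definition mins (s : seq (bool * letter)) := [seq p <- s | ~~ p.1].
Definition plus (s : seq (bool * letter)) := [seq p <- s | p.1].

(* A reduced word is a block of [-] followed by a block of [+]. *)
Lemma red_shape s : red s = mins (red s) ++ plus (red s).
Proof.
suff [m [p [-> Hm Hp]]] : exists m p, [/\ red s = m ++ p, all (fun x => ~~ x.1) m & all fst p].
  rewrite /mins /plus !filter_cat (all_filterP Hm) (all_filterP Hp).
  have -> : [seq x <- p | ~~ x.1] = [::].
    by apply/eqP; rewrite -[_ == _]negbK -has_filter -all_predC /=; apply: sub_all Hp => x /= ->.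
  have -> : [seq x <- m | x.1] = [::].
    by apply/eqP; rewrite -[_ == _]negbK -has_filter -all_predC.
  by rewrite cats0.
elim: s => [|x s [m [p [E Hm Hp]]]]; first by exists [::], [::].
rewrite /= -/(red s) E; case Ex: x.1; last first.
  by exists (x :: m), p; rewrite /= Ex Hm Hp; split=> //; case: m {E Hm} => [|y m] /=; [case: p Hp => //= y p; rewrite Ex|rewrite Ex].
case: m E Hm => [|y m] E Hm.
  exists [::], (x :: p); rewrite /= Ex Hp; split=> //.
  by case: p Hp {E} => //= y p /andP[-> _]; rewrite andbF.
by exists m, p; case/andP: Hm => Hy Hm; rewrite /= Ex Hy.
Qed.

Lemma foldr_push_red s u : foldr push (red u) s = foldr push (red u) (red s).
Proof.
elim: s => //= x s ->; rewrite -/(red s).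
case: (red s) => //= y r; case: ifP => // Hxy.
by rewrite push_pair.
Qed.

(* The element [(n, p)] of the bicyclic monoid records [n] unpaired [-] followed by [p] unpaired [+]. *)
Definition bic (x y : nat * nat) := (x.1 + (y.1 - x.2), y.2 + (x.2 - y.1)).

Lemma bicA : associative bic.
Proof. by move=> [a b] [c d] [e f]; rewrite /bic /=; congr pair; lia. Qed.

Definition sg (s : seq bool) := foldr (fun x v => bic (if x then (0, 1) else (1, 0)) v) (0, 0) s.

Lemma sg_cat s u : sg (s ++ u) = bic (sg s) (sg u).
Proof.
elim: s => [|x s IH] /=; first by case: (sg u) => a b; rewrite /bic /=; congr pair; lia.
by rewrite IH bicA.
Qed.

Lemma sg_minus n : sg (nseq n false) = (n, 0).
Proof. by elim: n => //= n ->; rewrite /bic /=; congr pair; lia. Qed.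

Lemma sg_plus n : sg (nseq n true) = (0, n).
Proof. by elim: n => //= n ->; rewrite /bic /=; congr pair; lia. Qed.

Lemma size_red s : (size (mins (red s)), size (plus (red s))) = sg (map fst s).
Proof.
elim: s => //= x s <-; rewrite -/(red s) {1 2}red_shape.
have Hm : all (fun x => ~~ x.1) (mins (red s)) by exact: filter_all.
have Hp : all fst (plus (red s)) by exact: filter_all.
move: (mins _) (plus _) Hm Hp => m p Hm Hp; rewrite /bic.
have Em : plus m = [::].
  by apply/eqP; rewrite -[_ == _]negbK -has_filter -all_predC.
have Ep : mins p = [::].
  by apply/eqP; rewrite -[_ == _]negbK -has_filter -all_predC /=; apply: sub_all Hp => z /= ->.
have Em' : mins m = m by apply/all_filterP.
have Ep' : plus p = p by apply/all_filterP.
have HC z t : (mins (z :: t) = if z.1 then mins t else z :: mins t) /\ (plus (z :: t) = if z.1 then z :: plus t else plus t).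
  by rewrite /mins /plus /=; case: z.1.
have HA a b : mins (a ++ b) = mins a ++ mins b /\ plus (a ++ b) = plus a ++ plus b.
  by rewrite /mins /plus !filter_cat.
case Ex: x.1.
  case: m Hm Em Em' => [|y m] Hm Em Em'.
    have -> : push x ([::] ++ p) = x :: p.
      by rewrite /=; case: p Hp {Ep Ep'} => //= y p /andP[-> _]; rewrite andbF.
    by rewrite !(HC x p).1 !(HC x p).2 Ex Ep Ep' /=; congr pair; lia.
  case/andP: Hm => Hy Hm; rewrite /= Ex Hy /=.
  move: Em Em'; rewrite (HC y m).1 (HC y m).2 (negbTE Hy) => Em [Em'].
  by rewrite (HA m p).1 (HA m p).2 Em Em' Ep Ep' cats0 /=; congr pair; lia.
have -> : push x (m ++ p) = x :: m ++ p by case: (m ++ p) => //= y r; rewrite Ex.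
by rewrite (HC x _).1 (HC x _).2 Ex (HA m p).1 (HA m p).2 Em Em' Ep Ep' cats0 /=; congr pair; lia.
Qed.

(** No [+] is left over before [x] and no [-] after it, so [x] survives whatever its sign. This
    identifies the letter that an operator picks. *)
Lemma red_split s x u : (sg (map fst s)).2 = 0 -> (sg (map fst u)).1 = 0 ->
  red (s ++ x :: u) = mins (red s) ++ x :: plus (red u).
Proof.
rewrite -!size_red /= => /size0nil Hs /size0nil Hu.
have Es := red_shape s; rewrite Hs cats0 in Es.
have Eu := red_shape u; rewrite Hu in Eu.
rewrite /red foldr_cat /= -/(red u).
have Ex : push x (red u) = x :: plus (red u).
  rewrite -[plus _]cat0s -Eu; have : all fst (red u) by rewrite Eu; exact: filter_all.
  by case: (red u) => //= y r /andP[-> _]; rewrite andbF.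
have E1 : red (x :: u) = x :: plus (red u) by [].
rewrite Ex -E1 foldr_push_red E1.
rewrite Es; have : all (fun x => ~~ x.1) (mins (red s)) by exact: filter_all.
elim: (mins (red s)) => //= y r IH /andP[Hy Hr]; rewrite IH //.
by case: (r ++ _) => //= z q; rewrite (negbTE Hy).
Qed.

Lemma signs_cat i w1 w2 : signs i (w1 ++ w2) = signs i w1 ++ signs i w2.
Proof. by rewrite /signs filter_cat map_cat. Qed.

Lemma map_fst_signs i w :
  map fst (signs i w) = [seq z == i.+1 | z <- map fst w & (z == i) || (z == i.+1)].
Proof. by rewrite /signs -map_comp filter_map -map_comp. Qed.

Lemma two_valued_geq i s : sorted geq s -> all (fun z => (z == i) || (z == i.+1)) s ->
  s = nseq (count_mem i.+1 s) i.+1 ++ nseq (count_mem i s) i.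
Proof.
elim: s => //= x s IH Hs /andP[Hx Ha]; have IH' := IH (path_sorted Hs) Ha.
case/orP: Hx => /eqP Ex; subst x; last first.
  by rewrite eqxx (_ : (i.+1 == i) = false) /= ?add0n -?IH' //; lia.
rewrite eqxx (_ : (i == i.+1) = false) /= ?add0n; last lia.
have geq_tr : transitive geq by move=> a b d /= H1 H2; apply: leq_trans H2 H1.
have /allP Hm := order_path_min geq_tr Hs.
have c0 : count_mem i.+1 s = 0 by apply/count_memPn/negP => /Hm /=; lia.
by rewrite c0 {1}IH' c0.
Qed.

Lemma two_valued_leq i s : sorted leq s -> all (fun z => (z == i) || (z == i.+1)) s ->
  s = nseq (count_mem i s) i ++ nseq (count_mem i.+1 s) i.+1.
Proof.
elim: s => //= x s IH Hs /andP[Hx Ha]; have IH' := IH (path_sorted Hs) Ha.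
case/orP: Hx => /eqP Ex; subst x.
  by rewrite eqxx (_ : (i == i.+1) = false) /= ?add0n -?IH' //; lia.
rewrite eqxx (_ : (i.+1 == i) = false) /= ?add0n; last lia.
have /allP Hm := order_path_min leq_trans Hs.
have c0 : count_mem i s = 0 by apply/count_memPn/negP => /Hm /=; lia.
by rewrite c0 {1}IH' c0.
Qed.

(** Recovers the letter behind a position that is known only in the word of signs. *)
Lemma map_eq_split (S T : Type) (f : S -> T) s l1 b l2 : map f s = l1 ++ b :: l2 ->
  exists s1 x s2, [/\ s = s1 ++ x :: s2, map f s1 = l1, f x = b & map f s2 = l2].
Proof.
elim: l1 s => [|a l1 IH] [|x s] //= [E1 E2]; first by exists [::], x, s.
have [s1 [y [s2 [-> <- <- <-]]]] := IH _ E2.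
by exists (x :: s1), y, s2; split=> //=; rewrite E1.
Qed.

Definition ext_word (t : hvt) (c : nat) : seq letter :=
  flatten [seq [seq (z, (r, c, true)) | z <- rev (cellat t r c).1] | r <- col_rows t c].

Definition arm_word (t : hvt) (c : nat) : seq letter :=
  sort (fun p q : letter => p.1 <= q.1)
       (flatten [seq [seq (z, (r, c, false)) | z <- (cellat t r c).2] | r <- col_rows t c]).

Lemma mem_ext_word t c p : p \in ext_word t c ->
  exists2 r, p = (p.1, (r, c, true)) & p.1 \in (cellat t r c).1.
Proof.
case/flattenP => _ /mapP[r _ ->] /mapP[z zr ->]; exists r => //.
by rewrite mem_rev in zr.
Qed.

Lemma mem_arm_word t c p : p \in arm_word t c ->
  exists2 r, p = (p.1, (r, c, false)) & p.1 \in (cellat t r c).2.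
Proof. by rewrite mem_sort => /flattenP[_ /mapP[r _ ->] /mapP[z zr ->]]; exists r. Qed.

Lemma mem_signs i w x : x \in signs i w ->
  [/\ x.2 \in w, x.1 = (x.2.1 == i.+1) & (x.2.1 == i) || (x.2.1 == i.+1)].
Proof. by case/mapP => p; rewrite mem_filter => /andP[Hp pw] ->. Qed.

Lemma sum_col_rows t c (pr : cell -> seq nat) z : pr dcell = [::] ->
  \sum_(r <- col_rows t c) count_mem z (pr (cellat t r c)) = colsum pr t c z.
Proof.
move=> Hp; rewrite /col_rows big_filter.
rewrite (perm_big (index_iota 0 (size t))) /=; last by rewrite /index_iota subn0 perm_rev.
rewrite /colsum big_mkcond; apply: eq_bigr => r _; case: ltnP => // H.
by rewrite cellat_out // Hp.
Qed.

Section Column.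
Variables (t : hvt) (i c : nat).
Hypothesis Ht : HVTP t.
Let m := md t.

Lemma ext_values : map fst (ext_word t c) = flatten [seq rev (cellat t r c).1 | r <- col_rows t c].
Proof.
rewrite /ext_word map_flatten -map_comp; congr flatten; apply: eq_map => r /=.
by rewrite -map_comp map_id.
Qed.

Lemma ext_sorted : sorted geq (map fst (ext_word t c)).
Proof.
have geq_tr : transitive geq by move=> a b d /= H1 H2; apply: leq_trans H2 H1.
rewrite ext_values sorted_pairwise //.
have : pairwise gtn (col_rows t c).
  rewrite -sorted_pairwise; last by move=> a b d /= H1 H2; apply: ltn_trans H2 H1.
  apply: sorted_filter; first by move=> a b d /= H1 H2; apply: ltn_trans H2 H1.
  by rewrite rev_sorted iota_ltn_sorted.
elim: (col_rows t c) => //= r rs IH /andP[/allP Hr /IH Hrs].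
rewrite pairwise_cat Hrs andbT; apply/andP; split.
  apply/allrelP => y z; rewrite mem_rev => Hy /flattenP[_ /mapP[s srs ->]]; rewrite mem_rev => Hz.
  by apply: ltnW; apply: (entries_lt Ht (Hr _ srs) (c := c)); apply: xl_sub.
case: (ltnP c (size (row t r))) => H; last by rewrite cellat_out.
have [_ Hs _ _ _] := md_validP Ht H.
rewrite -sorted_pairwise // rev_sorted.
by move: Hs; rewrite ltn_sorted_uniq_leq => /andP[].
Qed.

Lemma count_ext z : count_mem z (map fst (ext_word t c)) = ex m c z.
Proof.
rewrite ext_values count_flatten sumnE !big_map -[RHS](@sum_col_rows t c xl z) //.
by apply: eq_bigr => r _; rewrite /= count_rev.
Qed.

Lemma arm_values : map fst (arm_word t c) = sort leq (flatten [seq (cellat t r c).2 | r <- col_rows t c]).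
Proof.
rewrite -[LHS]/(map fst (sort (relpre fst leq) _)) -sort_map map_flatten -map_comp; congr (sort _ (flatten _)).
by apply: eq_map => r /=; rewrite -map_comp map_id.
Qed.

Lemma count_arm_word z : count_mem z (map fst (arm_word t c)) = ar m c z.
Proof.
rewrite arm_values (permP (permEl (perm_sort _ _))) count_flatten sumnE !big_map.
exact: (@sum_col_rows t c arm z).
Qed.

Lemma count_filter_two (z : nat) (s : seq nat) : (z == i) || (z == i.+1) ->
  count_mem z [seq z <- s | (z == i) || (z == i.+1)] = count_mem z s.
Proof.
move=> Hz; rewrite count_filter; apply: eq_count => y /=.
by case: eqP => // ->; rewrite Hz.
Qed.

Lemma signs_ext : map fst (signs i (ext_word t c)) = nseq (ex m c i.+1) true ++ nseq (ex m c i) false.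
Proof.
rewrite map_fst_signs (@two_valued_geq i (filter _ _)).
- rewrite map_cat !map_nseq eqxx !count_filter_two ?eqxx ?orbT // !count_ext.
  by rewrite (_ : (i == i.+1) = false) //; lia.
- by apply: sorted_filter ext_sorted => a b d /= H1 H2; apply: leq_trans H2 H1.
exact: filter_all.
Qed.

Lemma signs_arm : map fst (signs i (arm_word t c)) = nseq (ar m c i) false ++ nseq (ar m c i.+1) true.
Proof.
rewrite map_fst_signs (@two_valued_leq i (filter _ _)).
- rewrite map_cat !map_nseq eqxx !count_filter_two ?eqxx ?orbT // !count_arm_word.
  by rewrite (_ : (i == i.+1) = false) //; lia.
- by apply: (sorted_filter leq_trans); rewrite arm_values; apply: (sort_sorted leq_total).
exact: filter_all.
Qed.

Lemma signs_col : signs i (col_word t c) = signs i (ext_word t c) ++ signs i (arm_word t c).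
Proof. exact: signs_cat. Qed.

Lemma sg_col : sg (map fst (signs i (col_word t c))) = (na m i c, nb m i c).
Proof.
rewrite signs_col map_cat signs_ext signs_arm !sg_cat !sg_plus !sg_minus /bic /na /nb /=.
by congr pair; lia.
Qed.
End Column.

Section Word.
Variables (t : hvt) (i : nat).
Hypothesis Ht : HVTP t.
Let m := md t.
Let n := size (row t 0).

Definition seg x k := signs i (flatten [seq col_word t c | c <- iota x k]).

Lemma seg_cat x k l : seg x (k + l) = seg x k ++ seg (x + k) l.
Proof. by rewrite /seg iotaD map_cat flatten_cat signs_cat. Qed.

Lemma seg1 x : seg x 1 = signs i (col_word t x).
Proof. by rewrite /seg /= cats0. Qed.

Lemma sg_prefix d : (sg (map fst (seg 0 d))).2 = pend (na m i) (nb m i) d.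
Proof.
elim: d => // d IH; rewrite -addn1 seg_cat map_cat sg_cat seg1 sg_col // addn1 /= IH add0n.
by rewrite addnC.
Qed.

Lemma sg_suffix k x : (sg (map fst (seg x k))).1 = need (na m i) (nb m i) k x.
Proof.
elim: k x => // k IH x; rewrite -add1n seg_cat map_cat sg_cat seg1 sg_col // addn1 /= IH.
by rewrite addnC.
Qed.

Lemma word_split d : d < n ->
  signs i (rword t) = seg 0 d ++ signs i (ext_word t d) ++ signs i (arm_word t d) ++ seg d.+1 (n - d.+1).
Proof.
move=> dn; rewrite -/(seg 0 n) -{1}(subnKC dn) -addn1 seg_cat seg_cat seg1 signs_col add0n addn1.
by rewrite -!catA.
Qed.

Lemma unpaired_split d s1 x s2 : d < n ->
  signs i (ext_word t d) ++ signs i (arm_word t d) = s1 ++ x :: s2 ->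
  (bic (sg (map fst (seg 0 d))) (sg (map fst s1))).2 = 0 ->
  (bic (sg (map fst s2)) (sg (map fst (seg d.+1 (n - d.+1))))).1 = 0 ->
  exists u1 u2, [/\ unpaired (signs i (rword t)) = u1 ++ x :: u2,
     all (fun p => ~~ p.1) u1 & all fst u2].
Proof.
move=> dn E H1 H2; rewrite unpaired_red (word_split dn).
rewrite [X in _ ++ X]catA E -!catA cat_cons catA.
rewrite red_split ?map_cat ?sg_cat //.
exists (mins (red (seg 0 d ++ s1))), (plus (red (s2 ++ seg d.+1 (n - d.+1)))).
by split=> //; exact: filter_all.
Qed.

(** [fl] tells whether the letter lies in the extended legs; [pre] and [post] are the signatures of
    column [d] before and after it. The four conditions say that nothing pending reaches the letter
    from the left and no unpaired [-] remains to its right. *)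
Lemma column_pick d fl x l1 l2 (z := if x then i.+1 else i) : d < n ->
  map fst (signs i (if fl then ext_word t d else arm_word t d)) = l1 ++ x :: l2 ->
  let pre := sg (if fl then l1 else map fst (signs i (ext_word t d)) ++ l1) in
  let post := sg (if fl then l2 ++ map fst (signs i (arm_word t d)) else l2) in
  pend (na m i) (nb m i) d <= pre.1 -> pre.2 = 0 ->
  need (na m i) (nb m i) (n - d.+1) d.+1 <= post.2 -> post.1 = 0 ->
  exists r u1 u2, [/\ inrow m r d z, unpaired (signs i (rword t)) = u1 ++ (x, (z, (r, d, fl))) :: u2,
     all (fun p => ~~ p.1) u1 & all fst u2].
Proof.
move=> dn E pre post H1 H2 H3 H4; have [s1 [y [s2 [Ew E1 Ey E2]]]] := map_eq_split E.
have [r [Er Hr]] : exists r, y = (x, (z, (r, d, fl))) /\ inrow m r d z.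
  have : y \in signs i (if fl then ext_word t d else arm_word t d) by rewrite Ew mem_cat mem_head orbT.
  case/mem_signs => Hy Ey1 Hz.
  have Ez : y.2.1 = z.
    move: Ey1 Hz; rewrite Ey /z; case: (x) => [/esym/eqP //|].
    by case: (y.2.1 =P i.+1) => //= _ _; rewrite orbF => /eqP.
  case: (fl) Hy => [/mem_ext_word|/mem_arm_word] [r Er Hin]; exists r;
    (split; first by rewrite [y]surjective_pairing Ey Er Ez);
    by apply: (entries_inrow Ht); rewrite mem_cat -Ez Hin ?orbT.
have Esplit : signs i (ext_word t d) ++ signs i (arm_word t d) =
  (if fl then s1 else signs i (ext_word t d) ++ s1) ++ y :: (if fl then s2 ++ signs i (arm_word t d) else s2).
  by move: Ew; case: (fl) => ->; rewrite -catA.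
have [||u1 [u2 [-> Hu1 Hu2]]] := unpaired_split dn Esplit.
- by move: H1 H2; rewrite -sg_prefix /pre -E1 /bic; case: (fl); rewrite ?map_cat /=; clear; lia.
- by move: H3 H4; rewrite -sg_suffix /post -E2 /bic; case: (fl); rewrite ?map_cat /=; clear; lia.
by exists r, u1, u2; rewrite -Er.
Qed.

(** Arms are read after the extended legs, so the last [i] of the column is an arm letter as soon as
    an arm contains [i]. *)
Lemma f_pick_at d : last_minus (na m i) (nb m i) d ->
  exists r u, [/\ inrow m r d i, d < n &
    rev [seq p <- unpaired (signs i (rword t)) | ~~ p.1] = (false, (i, (r, d, ar m d i == 0))) :: u].
Proof.
have nrw := md_narrow Ht.
move=> Hd; have an x : n <= x -> na m i x = 0.
  by move=> nx; rewrite /na !(proj1 (nrw _ _ nx)) !(proj2 (nrw _ _ nx)).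
have [dn Hd1 Hd2] := proj1 (@last_minusP _ (nb m i) n d an) Hd.
suff [r [u1 [u2 [Hr -> Hu1 Hu2]]]] : exists r u1 u2, [/\ inrow m r d i,
    unpaired (signs i (rword t)) = u1 ++ (false, (i, (r, d, ar m d i == 0))) :: u2,
    all (fun p => ~~ p.1) u1 & all fst u2].
  exists r; rewrite filter_cat /=.
  have -> : [seq p <- u2 | ~~ p.1] = [::].
    by apply/eqP; rewrite -[_ == _]negbK -has_filter -all_predC /=; apply: sub_all Hu2 => z /= ->.
  by exists (rev [seq p <- u1 | ~~ p.1]); split=> //; rewrite cats1 rev_rcons.
have He := signs_ext i d Ht; have Ha := signs_arm t i d; rewrite -/m in He Ha.
have v1 : ex m d i <= 1 := ex_le1 (md_valid Ht) d i.
have naE : na m i d = (ex m d i + ar m d i) - ex m d i.+1 by [].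
have nbE : nb m i d = ar m d i.+1 + (ex m d i.+1 - (ex m d i + ar m d i)) by [].
have [p0|p0] := posnP (ar m d i).
  have [u0 v0] : ex m d i.+1 = 0 /\ ex m d i = 1 by lia.
  apply: (@column_pick d true false [::] [::]) => //; rewrite ?He ?Ha ?u0 ?v0 ?p0 ?cat0s ?sg_plus //;
    by cbn [sg foldr fst snd]; lia.
apply: (@column_pick d false false (nseq (ar m d i).-1 false) (nseq (ar m d i.+1) true)) => //;
  rewrite ?Ha ?He ?sg_cat ?sg_plus ?sg_minus /bic //.
- by rewrite -{1}(prednK p0) -addn1 nseqD -catA.
- by cbn [fst snd]; lia.
- by cbn [fst snd]; lia.
by cbn [fst snd]; lia.
Qed.

Lemma rword_seg : signs i (rword t) = seg 0 n.
Proof. by []. Qed.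

Lemma f_pick_none : all_paired (na m i) (nb m i) ->
  [seq p <- unpaired (signs i (rword t)) | ~~ p.1] = [::].
Proof.
move=> H; apply: size0nil; rewrite unpaired_red.
have := size_red (signs i (rword t)); rewrite rword_seg => E.
have := congr1 fst E; rewrite sg_suffix /= => ->.
have := proj2 (need_leP (na m i) (nb m i) n 0) (fun y _ => H y); rewrite /=; lia.
Qed.

Lemma e_pick_none : pend (na m i) (nb m i) n = 0 ->
  [seq p <- unpaired (signs i (rword t)) | p.1] = [::].
Proof.
move=> H; apply: size0nil; rewrite unpaired_red.
have := size_red (signs i (rword t)); rewrite rword_seg => E.
by have := congr1 snd E; rewrite sg_prefix /= H.
Qed.

Lemma e_pick_at d : first_plus (na m i) (nb m i) n d ->
  exists r u, [/\ inrow m r d i.+1, d < n &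
    [seq p <- unpaired (signs i (rword t)) | p.1] =
      (true, (i.+1, (r, d, (ex m d i + ar m d i == 0) && (ex m d i.+1 == 1)))) :: u].
Proof.
move=> [dn Hd1 Hd2].
suff [r [u1 [u2 [Hr -> Hu1 Hu2]]]] : exists r u1 u2, [/\ inrow m r d i.+1,
    unpaired (signs i (rword t)) = u1 ++ (true, (i.+1, (r, d, (ex m d i + ar m d i == 0) && (ex m d i.+1 == 1)))) :: u2,
    all (fun p => ~~ p.1) u1 & all fst u2].
  exists r; rewrite filter_cat /=.
  have -> : [seq p <- u1 | p.1] = [::].
    by apply/eqP; rewrite -[_ == _]negbK -has_filter -all_predC /=.
  by exists [seq p <- u2 | p.1]; split.
have He := signs_ext i d Ht; have Ha := signs_arm t i d; rewrite -/m in He Ha.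
have u1 : ex m d i.+1 <= 1 := ex_le1 (md_valid Ht) d i.+1.
have naE : na m i d = (ex m d i + ar m d i) - ex m d i.+1 by [].
have nbE : nb m i d = ar m d i.+1 + (ex m d i.+1 - (ex m d i + ar m d i)) by [].
have [/andP[/eqP p0 /eqP u1']|Hc] := boolP ((ex m d i + ar m d i == 0) && (ex m d i.+1 == 1)).
  have [v0 a0] : ex m d i = 0 /\ ar m d i = 0 by lia.
  apply: (@column_pick d true true [::] [::]) => //; rewrite ?He ?Ha ?u1' ?v0 ?a0 ?cat0s ?sg_plus //;
    by cbn [sg foldr fst snd]; lia.
have q0 : 0 < ar m d i.+1 by lia.
apply: (@column_pick d false true (nseq (ar m d i) false) (nseq (ar m d i.+1).-1 true)) => //;
  rewrite ?Ha ?He ?sg_cat ?sg_plus ?sg_minus /bic //.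
- by rewrite -{1}(prednK q0).
- by cbn [fst snd]; lia.
- by cbn [fst snd]; lia.
by cbn [fst snd]; lia.
Qed.
End Word.

(** * Crystal operators in the model *)

Lemma count_ins z x s : count_mem z (ins x s) = (x == z) + count_mem z s.
Proof. by rewrite /ins (permP (permEl (perm_sort _ _))). Qed.

Lemma mem_ins z x s : (z \in ins x s) = (z == x) || (z \in s).
Proof. by rewrite /ins mem_sort inE. Qed.

Lemma ins_sorted x s : sorted leq (ins x s).
Proof. exact: (sort_sorted leq_total). Qed.

Lemma ins_sorted_ltn x s : sorted ltn s -> x \notin s -> sorted ltn (ins x s).
Proof.
rewrite !ltn_sorted_uniq_leq => /andP[U _] xs.
by rewrite ins_sorted andbT /ins sort_uniq /= xs.
Qed.

Lemma count_rem_mem z x (s : seq nat) : x \in s -> count_mem z (rem x s) + (x == z) = count_mem z s.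
Proof.
move=> xs; rewrite [RHS](permP (perm_to_rem xs)) /= addnC.
by [].
Qed.

Lemma rem_sorted (e : rel nat) x s : transitive e -> sorted e s -> sorted e (rem x s).
Proof. by move=> H; apply: subseq_sorted => //; apply: rem_subseq. Qed.

Lemma head_sorted_le (s : seq nat) x : sorted leq s -> x \in s -> head 0 s <= x.
Proof.
case: s => //= a s Hs; rewrite inE => /orP[/eqP->//|].
by move/allP: (order_path_min leq_trans Hs); apply.
Qed.

Lemma head_sorted_eq (s : seq nat) x : sorted leq s -> x \in s ->
  (forall y, y \in s -> x <= y) -> head 0 s = x.
Proof.
move=> Hs xs Hx; apply/eqP; rewrite eqn_leq head_sorted_le //=.
by apply: Hx; case: s xs {Hs} => // a s _; rewrite mem_head.
Qed.

Lemma md_ex_upd t r c g c' z :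
  ex (md (upd t r c g)) c' z + (c' == c) * count_mem z (cellat t r c).1 =
  ex (md t) c' z + (c' == c) * count_mem z (g (cellat t r c)).1.
Proof. exact: (@colsum_upd xl). Qed.

Lemma md_ar_upd t r c g c' z :
  ar (md (upd t r c g)) c' z + (c' == c) * count_mem z (cellat t r c).2 =
  ar (md t) c' z + (c' == c) * count_mem z (g (cellat t r c)).2.
Proof. exact: (@colsum_upd arm). Qed.

Lemma md_hk_upd t r c g r' c' :
  hk (md (upd t r c g)) r' c' = if (r' == r) && (c' == c) then head 0 (g (cellat t r c)).1 else hk (md t) r' c'.
Proof. by rewrite /= cellat_upd; case: ifP. Qed.

(** This and the next two lemmas turn [colsum_upd], which counts in the old and the new cell, into
    the additive equations of the moves. *)
Lemma delta_move (b p q : bool) (x' x o n k : nat) :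
  x' + b * o = x + b * n -> n = q + k -> k + p = o -> x' + (b && p) = x + (b && q).
Proof. by case: b p q => [] [] []; rewrite ?mul1n ?mul0n /=; lia. Qed.

Lemma delta_rem (b p : bool) (x' x o n : nat) :
  x' + b * o = x + b * n -> n + p = o -> x' + (b && p) = x.
Proof. by case: b p => [] []; rewrite ?mul1n ?mul0n /=; lia. Qed.

Lemma delta_ins (b q : bool) (x' x o n : nat) :
  x' + b * o = x + b * n -> n = q + o -> x' = x + (b && q).
Proof. by case: b q => [] []; rewrite ?mul1n ?mul0n /=; lia. Qed.

Lemma eqnS n : (n == n.+1) = false.
Proof. by rewrite ltn_eqF. Qed.

Lemma eqSn n : (n.+1 == n) = false.
Proof. by rewrite gtn_eqF. Qed.

(** * Changing one entry of a cell *)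

Section Replace.
Variables (t : hvt) (r d x y : nat).
Local Notation Bd := (cellat t r d).
Hypothesis Ht : HVTP t.
Let m := md t.
Hypothesis left_le : forall c0 z, d = c0.+1 -> z \in entries (cellat t r c0) -> z <= y.
Hypothesis right_ge : forall z, z \in entries (cellat t r d.+1) -> y <= z.
Hypothesis below_lt : forall r0 z, r = r0.+1 -> z \in entries (cellat t r0 d) -> z < y.
Hypothesis above_gt : forall z, z \in entries (cellat t r.+1 d) -> y < z.

Lemma replace_arm (t' := upd t r d (fun B => (B.1, ins y (rem x B.2)))) :
  x \in Bd.2 -> 0 < y -> hk m r d <= y ->
  HVTP t' /\ [/\ forall r' c', hk (md t') r' c' = hk m r' c',
    forall c' z, ex (md t') c' z = ex m c' z &
    forall c' z, ar (md t') c' z + at_ c' z d x = ar m c' z + at_ c' z d y].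
Proof.
move=> xarm y0 hy; have ds : d < size (row t r) by apply: (@entries_in t r d x); rewrite mem_cat xarm orbT.
have [V1 V2 V3 V4 V5] := md_validP Ht ds; split.
  apply: (HVTP_upd_in (x := y)) => //.
    apply/valid_hookP; split=> //=.
    - exact: ins_sorted.
    - by move=> z; rewrite mem_cat mem_ins => /or3P[Hz|/eqP->//|/mem_rem Hz]; apply: V4; rewrite mem_cat Hz ?orbT.
    by move=> z; rewrite mem_ins => /orP[/eqP->//|/mem_rem/V5].
  by move=> z; rewrite mem_cat mem_ins inE mem_cat => /or3P[->|->//|/mem_rem->]; rewrite ?orbT.
split=> [r' c'|c' z|c' z].
- by rewrite md_hk_upd; case: ifP => // /andP[/eqP-> /eqP->].
- exact: (addIn (md_ex_upd t r d (fun B => (B.1, ins y (rem x B.2))) c' z)).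
rewrite /at_ !(eq_sym z).
apply: delta_move (md_ar_upd t r d (fun B => (B.1, ins y (rem x B.2))) c' z) _ (count_rem_mem z xarm).
exact: count_ins.
Qed.

(** [x] and [y] differ by at most one and [y] is new to the extended leg, so no other entry of it
    lies between them; the hook entry changes only if it was [x]. *)
Lemma replace_ext (t' := upd t r d (fun B => (ins y (rem x B.1), B.2))) :
  x \in Bd.1 -> y \notin Bd.1 -> 0 < y -> y <= x.+1 -> x <= y.+1 ->
  (hk m r d = x -> forall z, z \in Bd.2 -> y <= z) ->
  HVTP t' /\ [/\ forall r' c', hk (md t') r' c' = if (c' == d) && (hk m r' c' == x) then y else hk m r' c',
    forall c' z, ex (md t') c' z + at_ c' z d x = ex m c' z + at_ c' z d y &
    forall c' z, ar (md t') c' z = ar m c' z].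
Proof.
move=> xin yin y0 yx xy Harm; have xent : x \in entries Bd by rewrite mem_cat xin.
have ds := entries_in xent; have [V1 V2 V3 V4 V5] := md_validP Ht ds.
have hx := hook_le Ht xent; rewrite -/m in hx.
have remE z : (z \in rem x Bd.1) = (z != x) && (z \in Bd.1).
  by rewrite (mem_rem_uniq _ (ltn_uniq V2)) inE.
have Hsort : sorted ltn (ins y (rem x Bd.1)).
  apply: ins_sorted_ltn; first by apply: rem_sorted => //; exact: ltn_transitive.
  by rewrite remE (negbTE yin) andbF.
have Hhead : head 0 (ins y (rem x Bd.1)) = if hk m r d == x then y else hk m r d.
  apply: head_sorted_eq; first exact: ins_sorted.
    by rewrite mem_ins remE; have [//|E] := eqVneq (hk m r d) x; rewrite ?eqxx // (hook_in Ht ds) E orbT.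
  move=> z; rewrite mem_ins remE => /orP[/eqP->|/andP[nz Hz]].
    by case: eqP => // /eqP ne; rewrite -ltnS; apply: leq_trans xy; rewrite ltn_neqAle ne.
  have hz : hk m r d <= z by apply: (hook_le Ht); rewrite mem_cat Hz.
  by case: eqP => [E|//]; apply: leq_trans yx _; rewrite ltn_neqAle eq_sym nz -E.
split.
  apply: (HVTP_upd_in (x := y)) => //.
    apply/valid_hookP; split=> //=.
    - by rewrite -size_eq0 /ins size_sort.
    - by move=> z; rewrite mem_cat mem_ins => /orP[/orP[/eqP->//|/mem_rem Hz]|Hz]; apply: V4; rewrite mem_cat Hz ?orbT.
    by move=> z Hz; rewrite /hook_entry Hhead; case: eqP => [E|_]; [apply: Harm|apply: V5].
  by move=> z; rewrite mem_cat mem_ins inE mem_cat => /orP[/orP[->//|/mem_rem->]|->]; rewrite ?orbT.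
split=> [r' c'|c' z|c' z].
- rewrite md_hk_upd; case: (eqVneq c' d) => [->|]; rewrite ?andbF ?andbT ?andTb ?andFb //.
  have [->|nr] := eqVneq r' r; first exact: Hhead.
  case: eqP => // E; case/eqP: nr; apply: (hk_uniq (md_valid Ht) (V4 x xent) E).
  exact: entries_inrow.
- rewrite /at_ !(eq_sym z).
  apply: delta_move (md_ex_upd t r d (fun B => (ins y (rem x B.1), B.2)) c' z) _ (count_rem_mem z xin).
  exact: count_ins.
exact: (addIn (md_ar_upd t r d (fun B => (ins y (rem x B.1), B.2)) c' z)).
Qed.

Lemma insert_ext (t' := upd t r d (fun B => (ins y B.1, B.2))) :
  d < size (row t r) -> y \notin Bd.1 -> 0 < y ->
  HVTP t' /\ [/\ forall r' c', hk (md t') r' c' =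
      if (r' == r) && (c' == d) then minn y (hk m r d) else hk m r' c',
    forall c' z, ex (md t') c' z = ex m c' z + at_ c' z d y &
    forall c' z, ar (md t') c' z = ar m c' z].
Proof.
move=> ds yin y0; have [V1 V2 V3 V4 V5] := md_validP Ht ds.
have Hhead : head 0 (ins y Bd.1) = minn y (hk m r d).
  apply: head_sorted_eq; first exact: ins_sorted.
    by rewrite mem_ins /minn; case: ifP => _; rewrite ?eqxx // (hook_in Ht ds) orbT.
  move=> z; rewrite mem_ins geq_min => /orP[/eqP->|Hz]; first by rewrite leqnn.
  by apply/orP; right; apply: (hook_le Ht); rewrite mem_cat Hz.
split.
  apply: (HVTP_upd_in (x := y)) => //.
    apply/valid_hookP; split=> //=.
    - by rewrite -size_eq0 /ins size_sort.
    - exact: ins_sorted_ltn.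
    - by move=> z; rewrite mem_cat mem_ins => /orP[/orP[/eqP->//|Hz]|Hz]; apply: V4; rewrite mem_cat Hz ?orbT.
    by move=> z Hz; rewrite /hook_entry Hhead geq_min; apply/orP; right; apply: V5.
  by move=> z; rewrite mem_cat mem_ins inE mem_cat orbA.
split=> [r' c'|c' z|c' z].
- by rewrite md_hk_upd; case: ifP.
- rewrite /at_ (eq_sym z).
  exact: delta_ins (md_ex_upd t r d (fun B => (ins y B.1, B.2)) c' z) (count_ins _ _ _).
exact: (addIn (md_ar_upd t r d (fun B => (ins y B.1, B.2)) c' z)).
Qed.
End Replace.

Lemma remove_ext t r d x h g (t' := upd t r d g) : HVTP t -> g (cellat t r d) = (rem x (cellat t r d).1, (cellat t r d).2) ->
  x \in (cellat t r d).1 -> head 0 (rem x (cellat t r d).1) = h -> 0 < h ->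
  (forall z, z \in (cellat t r d).2 -> h <= z) ->
  HVTP t' /\ [/\ forall r' c', hk (md t') r' c' = if (r' == r) && (c' == d) then h else hk (md t) r' c',
    forall c' z, ex (md t') c' z + at_ c' z d x = ex (md t) c' z &
    forall c' z, ar (md t') c' z = ar (md t) c' z].
Proof.
move=> Ht Eg xin Hh h0 Harm; have xent : x \in entries (cellat t r d) by rewrite mem_cat xin.
have [V1 V2 V3 V4 V5] := md_validP Ht (entries_in xent); split.
  apply: HVTP_upd_sub; rewrite ?Eg //; first exact: entries_in xent.
    apply/valid_hookP; split=> //=.
    - by case: (rem _ _) Hh h0 => //= <-.
    - by apply: rem_sorted => //; exact: ltn_transitive.
    - by move=> z; rewrite mem_cat => /orP[/mem_rem Hz|Hz]; apply: V4; rewrite mem_cat Hz ?orbT.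
    by move=> z Hz; rewrite /hook_entry Hh; apply: Harm.
  by move=> z; rewrite !mem_cat => /orP[/mem_rem->|->]; rewrite ?orbT.
split=> [r' c'|c' z|c' z].
- by rewrite md_hk_upd Eg /= Hh.
- have := md_ex_upd t r d g c' z; rewrite Eg /at_ (eq_sym z) => E.
  exact: delta_rem E (count_rem_mem z xin).
by have := md_ar_upd t r d g c' z; rewrite Eg; apply: addIn.
Qed.

(** * Effect of [f_i] on a tableau *)

Section FOp.
Variables (t : hvt) (i d r : nat).
Local Notation Bd := (cellat t r d).
Hypothesis Ht : HVTP t.
Hypothesis i0 : 0 < i.
Let m := md t.
Hypothesis Hd : last_minus (na m i) (nb m i) d.
Hypothesis Hr : inrow m r d i.

Let vm : valid m. Proof. exact: md_valid. Qed.

Lemma f_in : i \in entries Bd.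
Proof.
rewrite mem_entries // Hr /ent; case: Hd => + _; rewrite {2}/na -/m; clear; lia.
Qed.

Lemma f_size : d < size (row t r).
Proof. exact: entries_in f_in. Qed.

Lemma f_left c0 y : d = c0.+1 -> y \in entries (cellat t r c0) -> y <= i.+1.
Proof. by move=> dc Hy; apply: leqW; apply: (hv_right Ht Hy); rewrite -dc f_in. Qed.

Lemma f_below r0 y : r = r0.+1 -> y \in entries (cellat t r0 d) -> y < i.+1.
Proof. by move=> rr Hy; apply: leqW; apply: (hv_up Ht Hy); rewrite -rr f_in. Qed.

Hypothesis HM : i.+1 \in entries (cellat t r.+1 d) = false.

Lemma f_above z : z \in entries (cellat t r.+1 d) -> i.+1 < z.
Proof.
move=> Hz; have := hv_up Ht f_in Hz; rewrite leq_eqVlt => /orP[/eqP E|//].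
by move: HM; rewrite E Hz.
Qed.

Lemma f_ex1 : ex m d i.+1 = 0 -> i.+1 \notin Bd.1.
Proof. by move=> u0; rewrite (mem_xl Ht) -/m u0 andbF. Qed.

Lemma f_upd_arm : 0 < ar m d i -> (forall z, z \in entries (cellat t r d.+1) -> i.+1 <= z) ->
  let t' := upd t r d (fun B => (B.1, ins i.+1 (rem i B.2))) in
  HVTP t' /\ fmove m i d FArm (md t').
Proof.
move=> p0 Hright; apply: replace_arm => //; [exact: f_left|exact: f_below|exact: f_above| |].
  by rewrite (mem_arm Ht) Hr.
by apply: leqW; apply: (hook_le Ht f_in).
Qed.

Lemma f_upd_ext : ar m d i = 0 -> (forall z, z \in entries (cellat t r d.+1) -> i.+1 <= z) ->
  ~ hooked m i d ->
  let t' := upd t r d (fun B => (ins i.+1 (rem i B.1), B.2)) in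
  HVTP t' /\ fmove m i d FExt (md t').
Proof.
move=> p0 Hright nh.
have [v1 _ u0] : [/\ ex m d i = 1, ar m d i = 0 & ex m d i.+1 = 0].
  by apply: (fext_col vm i0 Hd (fk := FExt)).
apply: replace_ext => //; [exact: f_left|exact: f_below|exact: f_above| |exact: f_ex1|exact: leqW (leqnSn i)|].
  by rewrite (mem_xl Ht) Hr -/m v1.
move=> hi z Hz; rewrite ltn_neqAle -{2}hi (hook_le Ht) ?andbT; last by rewrite mem_cat Hz orbT.
by apply/negP => /eqP E; move: Hz; rewrite (mem_arm Ht) -/m -E p0 andbF.
Qed.

(** The test of (S) implies [hooked]. The [i] on the right is a hook entry, since [i] also occurs to
    its left. An [i.+1] in the extended legs of column [d] would violate the row condition in row
    [r], or else be the hook entry of the cell above, where (M) would apply. *)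
Lemma f_upd_swap : i \in (cellat t r d.+1).1 ->
  let t' := upd (upd t r d.+1 (fun B => (rem i B.1, B.2))) r d (fun B => (ins i.+1 B.1, B.2)) in
  [/\ hooked m i d, HVTP t' & fmove m i d FSwap (md t')].
Proof.
move=> ixl t'.
have ient : i \in entries (cellat t r d.+1) by rewrite mem_cat ixl.
have hi : hk m r d.+1 = i.
  apply/eqP; rewrite eqn_leq (hook_le Ht ient) /=.
  exact: (hv_right Ht f_in (hk_mem Ht (entries_in ient))).
have Hh : hooked m i d.
  split; last by exists r.
  apply/eqP; rewrite -leqn0 leqNgt; apply/negP => u.
  have eu : ent m d i.+1 by rewrite /ent addn_gt0 u.
  have [s Hs] := ent_row vm eu.
  have [sr|sr|sr] := ltngtP s r.
  - have h := hk_row_le vm (s := s.+1) (r := r) (c := d) sr.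
    by move: Hs Hr h; rewrite /inrow; clear; lia.
  - have h := hk_row_le vm (s := r.+1) (r := s) (c := d) sr.
    have E : hk m r.+1 d = i.+1 by move: Hs Hr h; rewrite /inrow -/m; clear; lia.
    have : i.+1 \in entries (cellat t r.+1 d).
      by rewrite -E; apply: (hk_mem Ht); rewrite -(hk_gt0 Ht) -/m E.
    by rewrite HM.
  by subst s; have := ent_le vm eu Hs; rewrite hi ltnn => /(_ i0).
have [v1 u1 p1 [s [Hs hs Hleg]]] := hooked_swap vm i0 Hd Hh.
have E := inrow_uniq vm Hs Hr; subst s; have [u0 _] := Hh.
have [W1 W2 W3 W4 W5] := md_validP Ht (entries_in ient).
have ent_gt z : z \in rem i (cellat t r d.+1).1 ++ (cellat t r d.+1).2 -> i.+1 <= z.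
  rewrite mem_cat (mem_rem_uniq _ (ltn_uniq W2)) inE => Hz; have iz : i <= z.
    rewrite -{1}hi; apply: (hook_le Ht); rewrite mem_cat; case/orP: Hz => [/andP[_ ->]//|->]; exact: orbT.
  rewrite ltn_neqAle iz andbT eq_sym; case/orP: Hz => [/andP[]//|Hz]; apply/negP => /eqP E.
  by move: Hz; rewrite (mem_arm Ht) E -/m p1 andbF.
have rhead : head 0 (rem i (cellat t r d.+1).1) = i.+1.
  apply: head_sorted_eq; first by apply: ltn_leq_sorted; apply: rem_sorted => //; exact: ltn_transitive.
    rewrite (mem_rem_uniq _ (ltn_uniq W2)) inE eqSn (mem_xl Ht) -/m u1 andbT.
    by case/and3P: Hleg.
  by move=> y Hy; apply: ent_gt; rewrite mem_cat Hy.
have [Ht1 [h1 e1 a1]] := remove_ext (g := fun B => (rem i B.1, B.2)) Ht erefl ixl rhead isT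
  (fun z Hz => ent_gt z ltac:(by rewrite mem_cat Hz orbT)).
set t1 := upd _ _ _ _ in Ht1 h1 e1 a1.
have cE : cellat t1 r d = Bd by rewrite cellat_upd eqnS andbF.
have [] := @insert_ext t1 r d i.+1 Ht1; rewrite -?/t' ?cE //.
- move=> c0 z dc; rewrite cellat_upd dc; have -> : (c0 == c0.+2) = false by rewrite ltn_eqF.
  by rewrite andbF; exact: f_left.
- by move=> z; rewrite cellat_upd !eqxx; apply: ent_gt.
- by move=> r0 z rr; rewrite cellat_upd rr eqnS; exact: f_below.
- by move=> z; rewrite cellat_upd eqSn; exact: f_above.
- by rewrite size_row_upd eqxx leq_max f_size orbT.
- exact: f_ex1.
move=> Ht2 [h2 e2 a2]; split=> //; split=> [r' c'|c' z|c' z].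
- rewrite h2 !h1 eqnS andbF /shift_hk -/m.
  have hm : minn i.+1 (hk m r d) = hk m r d by apply/minn_idPr; apply: leqW; exact: (hook_le Ht f_in).
  have [->|nc] := eqVneq c' d.+1; last by rewrite !andbF hm; case: ifP => // /andP[/eqP-> /eqP->].
  rewrite eqSn andbF andbT andTb; have [->|nr] := eqVneq r' r; first by rewrite hi eqxx.
  case: eqP => // E; case/eqP: nr.
  by apply: (hk_uniq vm i0 E); apply: entries_inrow.
- by rewrite e2 addnAC e1.
by rewrite a2 a1.
Qed.
End FOp.

Lemma f_op_none t i : HVTP t -> all_paired (na (md t) i) (nb (md t) i) -> f_op i t = None.
Proof. by move=> Ht H; rewrite /f_op f_pick_none. Qed.

Lemma e_op_none t i : HVTP t -> pend (na (md t) i) (nb (md t) i) (size (row t 0)) = 0 -> e_op i t = None.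
Proof. by move=> Ht H; rewrite /e_op e_pick_none. Qed.

(* The two moves (M), with [r' = r.+1] for [f_i] and [r = r'.+1] for [e_i]. *)
Lemma merge_upd t r r' c x y : HVTP t -> r != r' -> x \in (cellat t r c).2 -> y \in entries (cellat t r' c) ->
  let t' := upd (upd t r c (fun B => (B.1, rem x B.2))) r' c (fun B => (B.1, ins y B.2)) in
  [/\ HVTP t', (forall r0 c0, hk (md t') r0 c0 = hk (md t) r0 c0),
   (forall c0 z, ex (md t') c0 z = ex (md t) c0 z) &
   (forall c0 z, ar (md t') c0 z + at_ c0 z c x = ar (md t) c0 z + at_ c0 z c y)].
Proof.
move=> Ht ne xarm yin t'; rewrite {}/t'; set t1 := upd t r c _.
have cs : c < size (row t r) by apply: (@entries_in t r c x); rewrite mem_cat xarm orbT.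
have cs' := entries_in yin.
have [V1 V2 V3 V4 V5] := md_validP Ht cs; have [W1 W2 W3 W4 W5] := md_validP Ht cs'.
have Ht1 : HVTP t1.
  apply: HVTP_upd_sub => //.
    apply/valid_hookP; split=> //=.
    - by apply: rem_sorted => //; exact: leq_trans.
    - by move=> z Hz; apply: V4; move: Hz; rewrite !mem_cat => /orP[->//|/mem_rem->]; rewrite orbT.
    by move=> z /mem_rem; apply: V5.
  by move=> z; rewrite !mem_cat => /orP[->//|/mem_rem->]; rewrite orbT.
have cE : cellat t1 r' c = cellat t r' c by rewrite cellat_upd eq_sym (negbTE ne).
split.
- apply: HVTP_upd_sub; rewrite ?cE //.
  + by rewrite size_row_upd eq_sym (negbTE ne).
  + apply/valid_hookP; split=> //=.
    * exact: ins_sorted.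
    * move=> z; rewrite mem_cat mem_ins => /or3P[Hz|/eqP->|Hz]; apply: W4 => //; by rewrite mem_cat Hz ?orbT.
    move=> z; rewrite mem_ins => /orP[/eqP->|/W5//]; exact: (hook_le Ht yin).
  by move=> z; rewrite mem_cat mem_ins => /or3P[Hz|/eqP->//|Hz]; rewrite mem_cat Hz ?orbT.
- move=> r0 c0; rewrite !md_hk_upd cE.
  by case: ifP => [/andP[/eqP-> /eqP->]|_] //; case: ifP => // /andP[/eqP-> /eqP->].
- move=> c0 z; have := addIn (md_ex_upd t1 r' c (fun B => (B.1, ins y B.2)) c0 z) => ->.
  exact: (addIn (md_ex_upd t r c (fun B => (B.1, rem x B.2)) c0 z)).
move=> c0 z; have E1 := md_ar_upd t1 r' c (fun B => (B.1, ins y B.2)) c0 z; rewrite cE in E1.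
have E2 := md_ar_upd t r c (fun B => (B.1, rem x B.2)) c0 z.
rewrite /at_ (eq_sym z x) (eq_sym z y) (delta_ins E1 (count_ins _ _ _)).
by rewrite addnAC; congr (_ + _); exact: delta_rem E2 (count_rem_mem z xarm).
Qed.

Lemma size_ins x s : size (ins x s) = (size s).+1.
Proof. by rewrite /ins size_sort. Qed.

Lemma sumn_set_nth (T : Type) (x0 : T) (f : T -> nat) s n x : n < size s ->
  sumn (map f (set_nth x0 s n x)) + f (nth x0 s n) = sumn (map f s) + f x.
Proof.
elim: s n => // y s IH [|n] /=; first by rewrite addnC addnA addnAC.
by rewrite ltnS => /IH; rewrite -!addnA => ->.
Qed.

Lemma leg_excess_rows t : leg_excess t = sumn [seq sumn [seq size (leg U) | U <- rw] | rw <- t].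
Proof. by rewrite /leg_excess map_flatten sumn_flatten -map_comp. Qed.

Lemma leg_excess_upd t r c g : c < size (row t r) ->
  leg_excess (upd t r c g) + size (leg (cellat t r c)) =
  leg_excess t + size (leg (g (cellat t r c))).
Proof.
move=> Hc; rewrite !leg_excess_rows /upd.
set h := fun rw => sumn [seq size (leg U) | U <- rw].
have := @sumn_set_nth _ [::] h t r (set_nth dcell (row t r) c (g (cellat t r c))) (row_size_gt0 Hc).
have := @sumn_set_nth _ dcell (fun U => size (leg U)) (row t r) c (g (cellat t r c)) Hc.
rewrite -/(row t r) -/(cellat t r c) /h /=; clear; lia.
Qed.

Lemma leg_excess_upd_eq t r c g : c < size (row t r) ->
  size (g (cellat t r c)).1 = size (cellat t r c).1 -> leg_excess (upd t r c g) = leg_excess t.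
Proof.
move=> Hc E; have := leg_excess_upd g Hc; rewrite /leg !size_behead E; exact: addIn.
Qed.

Lemma f_op_some t i d : HVTP t -> 0 < i -> last_minus (na (md t) i) (nb (md t) i) d ->
  exists k t', [/\ f_op i t = Some t', HVTP t', fkind_at (md t) i d k, fmove (md t) i d k (md t')
    & leg_excess t' = leg_excess t].
Proof.
move=> Ht i0 Hd; have [r [u [Hr dn Hpick]]] := f_pick_at Ht Hd.
have ds := f_size Ht Hd Hr.
have na0 : 0 < na (md t) i d by case: Hd; lia.
have v1 := ex_le1 (md_valid Ht) d i.
rewrite /f_op Hpick; cbv beta iota zeta delta [snd fst]; rewrite !has_cellE.
have cellE r' c' z : (z \in entries (cellat t r' c')) = (c' < size (row t r')) && (z \in entries (cellat t r' c')).
  by case: (boolP (z \in entries _)) => [/entries_in->|]; rewrite ?andbF.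
have xlE r' c' z : (c' < size (row t r')) && (z \in (cellat t r' c').1) = (z \in (cellat t r' c').1).
  case: (boolP (z \in (cellat t r' c').1)) => [H|]; rewrite ?andbF ?andbT //.
  by apply: (@entries_in t r' c' z); rewrite mem_cat H.
rewrite -cellE xlE; case: (boolP (i.+1 \in _)) => [HM|/negbTE HM].
  (* In (M) the [i.+1] above is a hook entry. It brackets one [i] of the column, and the extended
     legs hold at most one, so an unpaired [i] implies an arm letter. *)
  have hi : hk (md t) r.+1 d = i.+1.
    have := entries_inrow Ht HM; move: Hr; rewrite /inrow; lia.
  have u1 := ex_hk (md_valid Ht) (r := r.+1) (c := d); rewrite hi in u1.
  have p0 : 0 < ar (md t) d i by move: na0; rewrite /na u1 //; lia.
  have nh : ~ hooked (md t) i d by case; rewrite u1.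
  have iarm : i \in (cellat t r d).2 by rewrite (mem_arm Ht) Hr.
  have ne : r != r.+1 by rewrite eqnS.
  have [H1 H2 H3 H4] := merge_upd Ht ne iarm HM.
  exists FArm; eexists; split; [reflexivity| |split|split|] => //.
  rewrite !leg_excess_upd_eq //; first by rewrite size_row_upd eqSn (entries_in HM).
have [HS|HS] := boolP (i \in (cellat t r d.+1).1).
  have [H1 H2 H3] := f_upd_swap Ht i0 Hd Hr HM HS.
  exists FSwap; eexists; split; [reflexivity| | | |] => //.
  have cs : d.+1 < size (row t r) by apply: (@entries_in t r d.+1 i); rewrite mem_cat HS.
  have [_ H4 _ [s [H5 H6 H7]]] := hooked_swap (md_valid Ht) i0 Hd H1.
  have E := inrow_uniq (md_valid Ht) H5 Hr; subst s.
  rewrite -(mem_leg Ht) in H7; have [N1 _ _ _ _] := md_validP Ht ds.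
  have E1 := leg_excess_upd (fun B => (rem i B.1, B.2)) cs.
  have cs' : d < size (row (upd t r d.+1 (fun B => (rem i B.1, B.2))) r).
    by rewrite size_row_upd eqxx leq_max ds orbT.
  have E2 := leg_excess_upd (fun B => (ins i.+1 B.1, B.2)) cs'.
  move: E1 E2 H7 N1; rewrite cellat_upd eqnS andbF /leg !size_behead /= size_rem // size_ins.
  case: (cellat t r d.+1).1 => [|x [|y s]] //=; case: (cellat t r d).1 => //= a0 l0 E1 E2 _ _.
  apply: (@addIn (size l0)); rewrite E2 addnS -addSn; congr (_ + _).
  by apply: (@addIn (size s)); rewrite -E1 addnS addSn.
have Hright z : z \in entries (cellat t r d.+1) -> i.+1 <= z.
  move=> Hz; have iz := hv_right Ht (f_in Ht Hd Hr) Hz.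
  rewrite ltn_neqAle iz andbT; apply/negP => /eqP E; subst z.
  case/negP: HS; have cs := entries_in Hz.
  have := hv_right Ht (f_in Ht Hd Hr) (hk_mem Ht cs).
  have := hook_le Ht Hz => h1 h2.
  have <- : hk (md t) r d.+1 = i by lia.
  exact: (hook_in Ht).
have nh : ~ hooked (md t) i d.
  move=> [u0 [s Hs hs]]; have E := inrow_uniq (md_valid Ht) Hs Hr; subst s.
  case/negP: HS; rewrite -hs; apply: (hook_in Ht).
  by rewrite -(hk_gt0 Ht) hs.
have [p0|p0] := posnP (ar (md t) d i).
  have [H1 H2] := f_upd_ext Ht i0 Hd Hr HM p0 Hright nh.
  exists FExt; eexists; split; [reflexivity| |split| |] => //.
  have ixl : i \in (cellat t r d).1.
    by rewrite (mem_xl Ht) Hr; case: Hd; rewrite /na p0; clear; lia.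
  apply: leg_excess_upd_eq => //.
  rewrite -[LHS]/(size (ins i.+1 (rem i (cellat t r d).1))) size_ins size_rem // prednK //.
  by case: (cellat t r d).1 ixl.
have [H1 H2] := f_upd_arm Ht Hd Hr HM p0 Hright.
exists FArm; eexists; split; [reflexivity| |split| |] => //.
by rewrite leg_excess_upd_eq.
Qed.

(** * Effect of [e_i] on a tableau *)

Section EOp.
Variables (t : hvt) (i d r : nat).
Local Notation Bd := (cellat t r d).
Hypothesis Ht : HVTP t.
Hypothesis i0 : 0 < i.
Let m := md t.
Hypothesis Hd : first_plus (na m i) (nb m i) (size (row t 0)) d.
Hypothesis Hr : inrow m r d i.+1.

Let vm : valid m. Proof. exact: md_valid. Qed.
Let naE c : na m i c = (ex m c i + ar m c i) - ex m c i.+1. Proof. by []. Qed.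
Let nbE c : nb m i c = ar m c i.+1 + (ex m c i.+1 - (ex m c i + ar m c i)). Proof. by []. Qed.
Let nb0 : 0 < nb m i d. Proof. by case: Hd; clear; lia. Qed.

Lemma e_in : i.+1 \in entries Bd.
Proof. by rewrite mem_entries // Hr -/m; move: nb0; rewrite nbE /ent; clear; lia. Qed.

Lemma e_size : d < size (row t r).
Proof. exact: entries_in e_in. Qed.

Lemma e_right z : z \in entries (cellat t r d.+1) -> i <= z.
Proof. by move=> Hz; apply: ltnW; apply: (hv_right Ht e_in Hz). Qed.

Lemma e_above z : z \in entries (cellat t r.+1 d) -> i < z.
Proof. by move=> Hz; apply: ltnW; apply: (hv_up Ht e_in Hz). Qed.

Lemma e_hook_le : hk m r d <= i.+1.
Proof. exact: (hook_le Ht e_in). Qed.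

Lemma e_prev d0 : d = d0.+1 -> na m i d = 0 -> nb m i d0 = 0.
Proof. by move=> dd E; case: Hd => _ + _; rewrite E leqn0 dd /= addn_eq0 => /andP[_ /eqP]. Qed.

Hypothesis HM : forall r0, r = r0.+1 -> i \notin entries (cellat t r0 d).

Lemma e_below r0 y : r = r0.+1 -> y \in entries (cellat t r0 d) -> y < i.
Proof.
move=> rr Hy; have yi : y < i.+1 by apply: (hv_up Ht Hy); rewrite -rr e_in.
rewrite ltn_neqAle -ltnS yi andbT; apply/negP => /eqP E.
by have := HM rr; rewrite -E Hy.
Qed.

(* Nothing equal to [i] lies below [i.+1], so an [i] of column [d] would sit in the same cell. *)
Lemma e_hook_no_i : hk m r d = i.+1 -> ex m d i + ar m d i = 0.
Proof.
move=> E; apply/eqP; rewrite -leqn0 leqNgt; apply/negP => Hi.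
have ei : ent m d i by [].
have [s Hs] := ent_row vm ei.
have Hsi : i \in entries (cellat t s d) by rewrite mem_entries // Hs.
have sr : s < r.
  rewrite ltnNge; apply/negP => rs.
  have h := hk_row_le vm (s := r) (r := s) (c := d) rs.
  by move: Hs h; rewrite /inrow E; clear; lia.
case: (r) (HM) E Hr sr => // r0 HM' E Hr' sr.
have sr0 : s = r0.
  apply/eqP; rewrite eqn_leq -ltnS sr leqNgt; apply/negP => sr'.
  have h := hk_row_le vm (s := s.+1) (r := r0) (c := d) sr'.
  have h2 := hk_col vm (r := r0) (c := d).
  have h3 : i < hk m s.+1 d.
    have h4 := hk_row_le vm (s := s.+1) (r := r0.+1) (c := d) (leqW sr').
    by move: Hs h4; rewrite /inrow E; clear; lia.
  by move: h h2 h3; rewrite E; clear; lia.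
by subst s; have := HM' r0 erefl; rewrite Hsi.
Qed.

(** If the left cell contained [i.+1], then [(r, d)] would have hook entry [i.+1] and column [d] no
    [i]. As the first unpaired [+] is in [d], column [d0] then has no [+], so its [i.+1] is the hook
    entry of [(r, d0)] and is bracketed with an [i] in a lower row. The hook entry right of that [i]
    must be [i], a contradiction in column [d]. *)
Lemma e_left d0 : d = d0.+1 -> i.+1 \notin leg (cellat t r d0) ->
  forall y, y \in entries (cellat t r d0) -> y <= i.
Proof.
move=> dd HS y Hy; have yi : y <= i.+1 by apply: (hv_right Ht Hy); rewrite -dd e_in.
rewrite leqNgt; apply/negP => iy; have E : y = i.+1 by apply/eqP; rewrite eqn_leq yi.
subst y; have cs : d < size (row t r) := e_size.
have hd : hk m r d = i.+1.
  apply/eqP; rewrite eqn_leq e_hook_le; apply: (hv_right Ht Hy); rewrite -dd; exact: (hk_mem Ht).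
have vp := e_hook_no_i hd.
have b0 : nb m i d0 = 0 by apply: e_prev => //; rewrite naE vp.
have Hy' : inrow m r d0 i.+1 by apply: (entries_inrow Ht).
have q0 : ar m d0 i.+1 = 0 by move: b0; rewrite nbE; clear; lia.
have yxl : i.+1 \in (cellat t r d0).1.
  by move: Hy; rewrite mem_cat => /orP[//|]; rewrite (mem_arm Ht) -/m q0 andbF.
have u1 : 0 < ex m d0 i.+1 by move: yxl; rewrite (mem_xl Ht) => /andP[].
have hd0 : hk m r d0 = i.+1.
  apply/eqP; rewrite eqn_leq (hook_le Ht Hy) /= leqNgt; apply/negP => hlt.
  by move: HS; rewrite (mem_leg Ht) /isleg u1 Hy' hlt.
have ei : ent m d0 i by move: b0; rewrite nbE /ent; move: u1; clear; lia.
have [s Hs] := ent_row vm ei.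
have sr : s < r.
  rewrite ltnNge; apply/negP => rs.
  have h := hk_row_le vm (s := r) (r := s) (c := d0) rs.
  by move: Hs h; rewrite /inrow hd0; clear; lia.
have hsd : 0 < hk m s d < i.+1 by rewrite -hd; apply: (hk_row_lt vm) => //; rewrite hd.
have := ent_le vm ei Hs; rewrite -dd => /(_ ltac:(by case/andP: hsd)) h.
have E : hk m s d = i by move: h hsd; clear; lia.
have := ex_hk vm (r := s) (c := d); rewrite E => /(_ i0).
by move: vp; clear; lia.
Qed.

Lemma e_upd_arm : 0 < ar m d i.+1 -> (ex m d i + ar m d i = 0 -> ex m d i.+1 = 0) ->
  (forall d0, d = d0.+1 -> i.+1 \notin leg (cellat t r d0)) ->
  let t' := upd t r d (fun B => (B.1, ins i (rem i.+1 B.2))) in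
  HVTP t' /\ emove m i d FArm (md t').
Proof.
move=> q0 Hu HS; apply: replace_arm => //;
  [by move=> c0 z dc; apply: (e_left dc); apply: HS|exact: e_right|exact: e_below|exact: e_above| |].
  by rewrite (mem_arm Ht) Hr.
rewrite leqNgt; apply/negP => h.
have E : hk m r d = i.+1 by apply/eqP; rewrite eqn_leq e_hook_le.
by have := ex_hk vm (r := r) (c := d); rewrite E (Hu (e_hook_no_i E)) => /(_ isT).
Qed.

Lemma e_upd_ext : ex m d i.+1 = 1 -> ex m d i + ar m d i = 0 ->
  (forall d0, d = d0.+1 -> i.+1 \notin leg (cellat t r d0)) ->
  let t' := upd t r d (fun B => (ins i (rem i.+1 B.1), B.2)) in
  HVTP t' /\ emove m i d FExt (md t').
Proof.
move=> u1 vp HS; apply: replace_ext => //;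
  [by move=> c0 z dc; apply: (e_left dc); apply: HS|exact: e_right|exact: e_below|exact: e_above| | | |].
- by rewrite (mem_xl Ht) Hr -/m u1.
- by rewrite (mem_xl Ht) -/m; move/eqP: vp; rewrite addn_eq0 => /andP[/eqP-> _]; rewrite andbF.
- exact: leqW (leqnSn i).
by move=> hd z Hz; apply: ltnW; rewrite -hd; apply: (hook_le Ht); rewrite mem_cat Hz orbT.
Qed.

Lemma e_upd_swap d0 : d = d0.+1 -> i.+1 \in leg (cellat t r d0) ->
  let t' := upd (upd t r d0 (fun B => (head 0 B.1 :: rem i.+1 (behead B.1), B.2)))
              r d (fun B => (ins i B.1, B.2)) in
  [/\ unhooked m i d, HVTP t' & emove m i d FSwap (md t')].
Proof.
move=> dd Hleg t'.
have Hl : isleg m r d0 i.+1 by rewrite -(mem_leg Ht).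
have lxl : i.+1 \in (cellat t r d0).1 by apply: mem_behead.
have lent : i.+1 \in entries (cellat t r d0) by rewrite mem_cat lxl.
have hd : hk m r d = i.+1.
  by apply/eqP; rewrite eqn_leq e_hook_le; apply: (hv_right Ht lent); rewrite -dd; apply: (hk_mem Ht e_size).
have vp := e_hook_no_i hd.
have q0 : ar m d0 i.+1 = 0.
  by have := e_prev dd; rewrite naE vp nbE => /(_ erefl)/eqP; rewrite addn_eq0 => /andP[/eqP].
have [W1 W2 W3 W4 W5] := md_validP Ht (entries_in lent).
have xlE : head 0 (cellat t r d0).1 :: rem i.+1 (behead (cellat t r d0).1) = rem i.+1 (cellat t r d0).1.
  have := leg_gt Ht Hleg; rewrite /= /hook_entry; case: (cellat t r d0).1 W1 => //= x s _ xi.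
  by rewrite ltn_eqF.
have [||z Hz|] := @remove_ext t r d0 i.+1 (hk m r d0)
  (fun B => (head 0 B.1 :: rem i.+1 (behead B.1), B.2)) Ht (congr1 (pair^~ _) xlE) lxl.
- by rewrite -xlE.
- by rewrite (hk_gt0 Ht) (entries_in lent).
- exact: W5.
set t1 := upd _ _ _ _ => Ht1 [h1 e1 a1].
have nd : (d == d0) = false by rewrite dd eqSn.
have cE : cellat t1 r d = Bd by rewrite cellat_upd nd andbF.
have [] := @insert_ext t1 r d i Ht1; rewrite -?/t' ?cE //.
- move=> c0 z dc; have -> : c0 = d0 by apply: succn_inj; rewrite -dc.
  rewrite cellat_upd !eqxx /= mem_cat xlE (mem_rem_uniq _ (ltn_uniq W2)) inE => Hz.
  have zin : z \in entries (cellat t r d0).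
    by rewrite mem_cat; case/orP: Hz => [/andP[_ ->]//|->]; exact: orbT.
  have := hv_right Ht (r := r) (c := d0) zin; rewrite -dd => /(_ _ e_in).
  rewrite leq_eqVlt => /orP[/eqP E|//].
  by case/orP: Hz => [/andP[/eqP]//|]; rewrite E (mem_arm Ht) -/m q0 andbF.
- move=> z; rewrite cellat_upd; have -> : (d.+1 == d0) = false by rewrite dd gtn_eqF.
  by rewrite andbF; apply: e_right.
- by move=> r0 z rr; rewrite cellat_upd rr eqnS; apply: e_below.
- by move=> z; rewrite cellat_upd eqSn; apply: e_above.
- by rewrite size_row_upd eqxx leq_max e_size orbT.
- by rewrite (mem_xl Ht) -/m; move/eqP: vp; rewrite addn_eq0 => /andP[/eqP-> _]; rewrite andbF.
move=> Ht2 [h2 e2 a2]; split=> //; first by split=> //; exists r, d0; split.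
split=> [r' c'|c' z|c' z].
- rewrite h2 !h1 nd andbF hd /unshift_hk -/m (minn_idPl (leqnSn i)).
  have [->|nc] := eqVneq c' d; last by rewrite andbF; case: ifP => // /andP[/eqP-> /eqP->].
  rewrite nd andbF andbT; have [->|nr] := eqVneq r' r; first by rewrite hd eqxx.
  case: eqP => // E; case/eqP: nr; exact: (hk_uniq vm (ltn0Sn i) E Hr).
- by have -> : d.-1 = d0 by [rewrite dd]; rewrite e2 addnAC e1.
by rewrite a2 a1.
Qed.
End EOp.

Lemma e_op_some t i d : HVTP t -> 0 < i ->
  first_plus (na (md t) i) (nb (md t) i) (size (row t 0)) d ->
  exists k t', [/\ e_op i t = Some t', HVTP t', ekind_at (md t) i d k & emove (md t) i d k (md t')].
Proof.
move=> Ht i0 Hd; have [r [u [Hr dn Hpick]]] := e_pick_at Ht Hd.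
have nb0 : 0 < nb (md t) i d by case: Hd; clear; lia.
have u1 := ex_le1 (md_valid Ht) d i.+1.
rewrite /e_op Hpick; cbv beta iota zeta delta [snd fst]; rewrite !has_cellE.
have [/andP[/andP[r0 _] HM]|HM] := boolP ((0 < r) && (d < size (row t r.-1)) && (i \in _)).
  (* In (M) the [i] below brackets any [i.+1] of the extended legs, so the unpaired [i.+1] is an arm
     letter. *)
  have vp : 0 < ex (md t) d i + ar (md t) d i.
    by move: HM; rewrite (mem_entries Ht) => /andP[].
  have q0 : 0 < ar (md t) d i.+1 by move: nb0; rewrite /nb; move: vp u1; clear; lia.
  have iarm : i.+1 \in (cellat t r d).2 by rewrite (mem_arm Ht) Hr.
  have ne : r != r.-1 by rewrite -{1}(prednK r0) eqSn.
  have [H1 H2 H3 H4] := merge_upd Ht ne iarm HM.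
  exists FArm; eexists; split; [reflexivity| |split|split] => //.
    by move: vp; clear; lia.
  by move=> [E _]; move: vp; rewrite E.
have {}HM r0 : r = r0.+1 -> i \notin entries (cellat t r0 d).
  move=> E; apply: contra HM => H; rewrite E /= H andbT; exact: (entries_in H).
have [/andP[d0 HS]|HS] := boolP ((0 < d) && (i.+1 \in _)).
  have [H1 H2 H3] := e_upd_swap Ht i0 Hd Hr HM (esym (prednK d0)) HS.
  by exists FSwap; eexists; split; [reflexivity| | |].
have {}HS d0 : d = d0.+1 -> i.+1 \notin leg (cellat t r d0).
  by move=> E; apply: contra HS => H; rewrite E /= H.
have nh : ~ unhooked (md t) i d.
  move=> [vp [s [d0 [dd Hleg hs]]]].
  have E := hk_uniq (md_valid Ht) (ltn0Sn i) hs Hr; subst s.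
  by have := HS d0 dd; rewrite (mem_leg Ht) Hleg.
have [/andP[/eqP vp /eqP u1']|Hc] := boolP (_ && _).
  have [H1 H2] := e_upd_ext Ht i0 Hd Hr HM u1' vp HS.
  by exists FExt; eexists; split; [reflexivity| |split|].
have q0 : 0 < ar (md t) d i.+1 by move: nb0 Hc; rewrite /nb; move: u1; clear; lia.
have Hu : ex (md t) d i + ar (md t) d i = 0 -> ex (md t) d i.+1 = 0 by move: Hc u1; clear; lia.
have [H1 H2] := e_upd_arm Ht i0 Hd Hr HM q0 Hu HS.
by exists FArm; eexists; split; [reflexivity| |split|].
Qed.

(** * The bump in the model *)

Lemma last_filter_iota (p : pred nat) n r : r < n -> p r ->
  (forall s, r < s < n -> ~~ p s) -> last 0 [seq x <- iota 0 n | p x] = r.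
Proof.
move=> rn pr H; have -> : n = r + (n - r.+1).+1 by clear -rn; lia.
rewrite iotaD filter_cat /= add0n pr last_cat /=.
rewrite (@eq_in_filter _ p pred0) ?filter_pred0 //= => s; rewrite mem_iota => Hs.
by apply/negbTE/H; clear -Hs rn; lia.
Qed.

Lemma foldr_maxn_eq (s : seq nat) x : x \in s -> (forall y, y \in s -> y <= x) -> foldr maxn 0 s = x.
Proof.
move=> xs H; apply/eqP; rewrite eqn_leq; apply/andP; split.
  elim: s H {xs} => //= y s IH H; rewrite geq_max H ?mem_head //.
  by apply: IH => z zs; apply: H; rewrite inE zs orbT.
elim: s xs {H} => //= y s IH; rewrite inE leq_max => /orP[/eqP->|/IH->]; by rewrite ?leqnn ?orbT.
Qed.

Lemma filter_gt_head (s : seq nat) l k : sorted leq s -> k \in s -> l < k ->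
  (forall z, z \in s -> z <= l \/ k <= z) -> exists s', [seq z <- s | l < z] = k :: s'.
Proof.
move=> Hs ks lk H; have kf : k \in [seq z <- s | l < z] by rewrite mem_filter lk.
case E : [seq z <- s | l < z] (kf) => [//|x s'] _.
have : x \in [seq z <- s | l < z] by rewrite E mem_head.
rewrite mem_filter => /andP[lx xs].
have Hxk : x <= k.
  have := sorted_filter leq_trans (fun z => l < z) Hs; rewrite E => Hs'.
  by have := head_sorted_le Hs'; rewrite -E => /(_ k kf); rewrite E.
exists s'; congr cons; apply/eqP; rewrite eqn_leq Hxk /=.
by case: (H x xs) => //; rewrite leqNgt lx.
Qed.

Lemma last_sorted_ge (s : seq nat) z : sorted leq s -> z \in s -> z <= last 0 s.
Proof.
case: s => //= a s; elim: s a z => [|b s IH] a z /=; first by rewrite inE => _ /eqP->.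
case/andP=> ab Hs; rewrite inE => /orP[/eqP->|]; last exact: IH.
by apply: leq_trans ab _; apply: IH => //; rewrite mem_head.
Qed.

Lemma leg_excess_eq0 t : (leg_excess t == 0) = all (fun U => leg U == [::]) (flatten t).
Proof. by rewrite /leg_excess; elim: (flatten t) => //= U s <-; rewrite addn_eq0 size_eq0. Qed.

Lemma leg_excess_neq0 t : HVTP t -> leg_excess t != 0 <-> exists r c z, isleg (md t) r c z.
Proof.
move=> Ht; rewrite leg_excess_eq0 -has_predC; split.
  case/hasP=> U /flattenP[rw /(nthP [::]) [r rt <-]] /(nthP dcell) [c cr <-] /=.
  rewrite -/(row t r) -/(cellat t r c); case E: (leg _) => [|z s] // _.
  by exists r, c, z; rewrite -(mem_leg Ht) E mem_head.
case=> r [c [z]]; rewrite -(mem_leg Ht) => Hz.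
have cs : c < size (row t r) by apply: (@entries_in t r c z); rewrite mem_cat (mem_behead Hz).
apply/hasP; exists (cellat t r c); last by rewrite /=; case: (leg _) Hz.
apply/flattenP; exists (row t r); first exact: mem_nth (row_size_gt0 cs).
exact: mem_nth.
Qed.

Section Exists.
Variable t : hvt.
Hypothesis Ht : HVTP t.
Let m := md t.

Lemma topleg_ex : leg_excess t != 0 -> exists r c l, topleg m r c l.
Proof.
move/(leg_excess_neq0 Ht) => [r0 [c0 [z0 H0]]].
pose pc r c := leg (cellat t r c) != [::].
have pcP r c z : isleg m r c z -> pc r c by rewrite -(mem_leg Ht) /pc; case: (leg _).
have pc_size r c : pc r c -> c < size (row t r).
  by rewrite /pc; case: ltnP => // H; rewrite cellat_out.
pose pr r := has (pc r) (iota 0 (size (row t r))).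
have prP r c z : isleg m r c z -> pr r.
  move=> /pcP H; apply/hasP; exists c => //; rewrite mem_iota; exact: pc_size H.
have exr : exists r, pr r by exists r0; exact: prP H0.
have ubr r : pr r -> r <= size t.
  by move=> /hasP[c _ /pc_size/row_size_gt0/ltnW].
case: (ex_maxnP exr ubr) => r Hr Hmax.
have exc : exists c, pc r c by case/hasP: Hr => c _ Hc; exists c.
case: (ex_maxnP exc (fun c H => ltnW (pc_size r c H))) => c Hc Hcmax.
pose pl z := z \in leg (cellat t r c).
have exl : exists z, pl z by move: Hc; rewrite /pc /pl; case: (leg _) => // z s; exists z; rewrite mem_head.
have ubl z : pl z -> z <= cmax (cellat t r c).
  by move=> Hz; apply: (elimT (cmax_leP _ _) (leqnn _)); rewrite mem_cat (mem_behead Hz).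
case: (ex_maxnP exl ubl) => l Hl Hlmax; exists r, c, l; split; first by rewrite -(mem_leg Ht).
move=> r' c' z Hz; have := Hmax _ (prP _ _ _ Hz); rewrite leq_eqVlt => /orP[/eqP E|]; [right|by left].
subst r'; split=> //; have := Hcmax _ (pcP _ _ _ Hz); rewrite leq_eqVlt => /orP[/eqP E|]; [right|by left].
by subst c'; split=> //; apply: Hlmax; rewrite /pl (mem_leg Ht).
Qed.

Variables (r c l : nat).
Hypothesis top : topleg m r c l.

Let vm : valid m. Proof. exact: md_valid. Qed.

Lemma above_xl e z : z \in (cellat t r.+1 e).1 -> z = hk m r.+1 e.
Proof.
move=> Hz; have Hin : z \in entries (cellat t r.+1 e) by rewrite mem_cat Hz.
have := hook_le Ht Hin; rewrite leq_eqVlt => /orP[/eqP->//|h].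
have : isleg m r.+1 e z by move: Hz; rewrite (mem_xl Ht) /isleg h => /andP[-> ->].
by case/(proj2 top) => [|[]]; clear; lia.
Qed.

Lemma above_xlE e : e < size (row t r.+1) -> (cellat t r.+1 e).1 = [:: hk m r.+1 e].
Proof.
move=> He; have [V1 V2 _ _ _] := md_validP Ht He; have := @above_xl e.
case: (cellat t r.+1 e).1 V1 (ltn_uniq V2) => // x s _ U H.
have Ex : x = hk m r.+1 e by apply: H; rewrite mem_head.
case: s U H => [_ _|y s]; first by rewrite Ex.
move=> U H; have Ey : y = hk m r.+1 e by apply: H; rewrite !inE eqxx orbT.
by move: U; rewrite Ex Ey /= inE eqxx.
Qed.

Lemma target_ex : exists e bk, target m r l e bk.
Proof.
(* The target is the first column satisfying [P]; cells of row [r.+1] have no leg, so hook entry and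
   arm are all there is to inspect. *)
pose P e := [|| hk m r.+1 e == 0, l < hk m r.+1 e | has (fun z => l < z) (cellat t r.+1 e).2].
have exP : exists e, P e by exists (size (row t r.+1)); rewrite /P /= cellat_out.
case: (ex_minnP exP) => e He Hmin; exists e.
have split_ent e' z : ent m e' z -> z < hk m r.+1 e' \/ 0 < hk m r.+2 e' <= z \/ z \in entries (cellat t r.+1 e') \/ hk m r.+1 e' = 0.
  move=> ez; rewrite (mem_entries Ht) -/m ez andbT /inrow; clear; lia.
have [Hh|Hh] := boolP ((hk m r.+1 e == 0) || (l < hk m r.+1 e)).
  exists BHook; split; first by case/orP: Hh => [/eqP|]; [left|right].
  move=> e' ee; have : ~~ P e' by apply/negP => /Hmin; rewrite ee ltnn.
  rewrite /P !negb_or -lt0n -leqNgt => /and3P[h0 hl /hasPn Ha]; split=> // z.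
  case/split_ent => [h|[h|[h|h]]]; [left; exact: leq_trans (ltnW h) hl|by right| |by rewrite h in h0].
  left; move: h; rewrite mem_cat => /orP[/above_xl->//|/Ha]; by rewrite -leqNgt.
move: He; rewrite /P orbA (negbTE Hh) /= => /hasP[k0 k0in lk0].
have exk : exists k, (k \in (cellat t r.+1 e).2) && (l < k) by exists k0; rewrite k0in.
case: (ex_minnP exk) => k /andP[kin lk] kmin; exists (BArm k).
move: Hh; rewrite negb_or -lt0n -leqNgt => /andP[h0 hl].
have := kin; rewrite (mem_arm Ht) -/m => /andP[Hin ak].
split=> //; first by rewrite h0.
  by move: Hin; rewrite /inrow => /andP[].
move=> z; case/split_ent => [h|[h|[h|h]]]; [left; exact: leq_trans (ltnW h) hl| | |by rewrite h in h0].
  by right; move: Hin h; rewrite /inrow; clear; lia.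
move: h; rewrite mem_cat => /orP[/above_xl->|h]; first by left.
by case: (leqP z l) => [|lz]; [left|right]; rewrite // kmin // h.
Qed.
End Exists.

Lemma delta_swap (b : bool) (x2 x1 x o n o' n' : nat) :
  x2 + b * o = x1 + b * n -> x1 + b * o' = x + b * n' -> n + n' = o + o' -> x2 = x.
Proof. by case: b; rewrite ?mul1n ?mul0n; lia. Qed.

Lemma delta_keep (b : bool) (x' x o n : nat) : x' + b * o = x + b * n -> n = o -> x' = x.
Proof. by move=> H E; move: H; rewrite E => /addIn. Qed.

Section BumpSpec.
Variables (t : hvt) (r c l e : nat).
Local Notation Be := (cellat t r.+1 e).
Hypothesis Ht : HVTP t.
Let m := md t.
Hypothesis top : topleg m r c l.

Let vm : valid m. Proof. exact: md_valid. Qed.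
Let B := cellat t r c.
Let N := size (row t r.+1).

Lemma top_leg_in : l \in leg B.
Proof. by rewrite (mem_leg Ht); case: top. Qed.

Lemma top_in : l \in B.1.
Proof. exact: mem_behead top_leg_in. Qed.

Lemma top_ent : l \in entries B.
Proof. by rewrite mem_cat top_in. Qed.

Lemma top_size : c < size (row t r).
Proof. exact: entries_in top_ent. Qed.

Lemma top_leg_max r' c' z : z \in leg (cellat t r' c') ->
  r' < r \/ r' = r /\ (c' < c \/ c' = c /\ z <= l).
Proof. by rewrite (mem_leg Ht); apply: (proj2 top). Qed.

Lemma top_excess : leg_excess t != 0.
Proof. by apply/(leg_excess_neq0 Ht); exists r, c, l; case: top. Qed.

Lemma top_leg_rowE : top_leg_row t = r.
Proof.
apply: last_filter_iota; first exact: row_size_gt0 top_size.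
  apply/hasP; exists B; first exact: mem_nth top_size.
  by case: (leg B) top_leg_in.
move=> s /andP[rs _]; apply/hasPn => U /(nthP dcell) [c' _ <-]; rewrite negbK.
case E : (leg _) => [//|z u].
have : z \in leg (cellat t s c') by rewrite /cellat E mem_head.
by case/top_leg_max => [|[]]; move: rs; clear; lia.
Qed.

Lemma legmaxE : legmax B = l.
Proof.
apply: foldr_maxn_eq; first exact: top_leg_in.
by move=> z /top_leg_max [|[_ [|[_ //]]]]; rewrite ltnn.
Qed.

(** Leg entries left of [c] are at most the hook entry of [(r, c)], which is below [l]; this
    reconciles largest value with rightmost cell. *)
Lemma legmax_le c' : leg (cellat t r c') != [::] -> c' < c -> legmax (cellat t r c') < l.
Proof.
move=> Hc cc; have H : foldr maxn 0 (leg (cellat t r c')) \in leg (cellat t r c').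
  elim: (leg _) Hc => // z s IH _ /=; case: (s =P [::]) => [->|/eqP/IH]; first by rewrite maxn0 inE.
  by rewrite inE /maxn; case: ifP => _ h; rewrite ?eqxx ?h ?orbT.
rewrite /legmax.
have Hin : foldr maxn 0 (leg (cellat t r c')) \in entries (cellat t r c') by rewrite mem_cat (mem_behead H).
have hc : 0 < hk m r c by have := top_hk top; case/andP.
have := inrow_ent_le vm (r := r) (c := c') (c' := c) (z := foldr maxn 0 (leg (cellat t r c'))).
have := entries_inrow Ht Hin; have : ent m c' (foldr maxn 0 (leg (cellat t r c'))).
  by move: Hin; rewrite (mem_entries Ht) => /andP[].
move=> h1 h2 /(_ h1 h2 cc hc) h3; apply: leq_ltn_trans h3 _.
by have := top_hk top; case/andP.
Qed.

Lemma top_colE : last 0 [seq c' <- [seq c' <- iota 0 (size (row t r)) | leg (cellat t r c') != [::]]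
   | legmax (cellat t r c') == foldr maxn 0 [seq legmax (cellat t r c') | c' <- iota 0 (size (row t r)) & leg (cellat t r c') != [::]]] = c.
Proof.
have Hleg : leg B != [::] by case: (leg B) top_leg_in.
have Hcol : c \in [seq c' <- iota 0 (size (row t r)) | leg (cellat t r c') != [::]].
  by rewrite mem_filter Hleg mem_iota top_size.
have Hright c' : leg (cellat t r c') != [::] -> c' <= c.
  case E: (leg _) => [//|z s] _; have : z \in leg (cellat t r c') by rewrite E mem_head.
  by case/top_leg_max => [|[_ []]]; clear; lia.
have -> : foldr maxn 0 [seq legmax (cellat t r c') | c' <- iota 0 (size (row t r)) & leg (cellat t r c') != [::]] = l.
  apply: foldr_maxn_eq; first by apply/mapP; exists c => //; rewrite legmaxE.
  move=> y /mapP[c']; rewrite mem_filter => /andP[Hc' _] ->.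
  have := Hright c' Hc'; rewrite leq_eqVlt => /orP[/eqP->|cc]; first by rewrite legmaxE.
  exact: ltnW (legmax_le Hc' cc).
rewrite -filter_predI; apply: last_filter_iota; first exact: top_size.
  by rewrite /= Hleg andbT -/B legmaxE.
move=> s /andP[cs _]; rewrite /= negb_and; apply/orP; right; rewrite negbK.
by apply: contraLR cs => /Hright; rewrite -leqNgt.
Qed.

Lemma take_rem : take 1 B.1 ++ rem l (behead B.1) = rem l B.1.
Proof.
have := leg_gt Ht top_leg_in; rewrite /= /hook_entry -/B.
have := top_in; case: B.1 => //= x s _ xl; rewrite take0.
by rewrite ltn_eqF.
Qed.

Lemma row_entriesE rw : row_entries rw = flatten [seq (hook_entry (nth dcell rw c'), (c', true))
                 :: [seq (z, (c', false)) | z <- (nth dcell rw c').2] | c' <- iota 0 (size rw)].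
Proof. by []. Qed.

(** The cells left of [e] contribute no candidate, so the first one comes from cell [e]. *)
Lemma cand_split : e <= N ->
  (forall e', e' < e -> forall z, z \in entries (cellat t r.+1 e') -> z <= l) ->
  [seq p <- row_entries (row t r.+1) | l < p.1] =
  if e < N then [seq p <- (hook_entry Be, (e, true)) ::
       [seq (z, (e, false)) | z <- Be.2] | l < p.1] ++
    [seq p <- flatten [seq (hook_entry (nth dcell (row t r.+1) c'), (c', true))
                 :: [seq (z, (c', false)) | z <- (nth dcell (row t r.+1) c').2] | c' <- iota e.+1 (N - e.+1)] | l < p.1]
  else [::].
Proof.
move=> eN Hle; rewrite row_entriesE -/N -{1}(subnKC eN) iotaD map_cat flatten_cat filter_cat add0n.
have -> : forall s, [seq p <- flatten [seq (hook_entry (nth dcell (row t r.+1) c'), (c', true))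
   :: [seq (z, (c', false)) | z <- (nth dcell (row t r.+1) c').2] | c' <- iota 0 e] | l < p.1] ++ s = s.
  move=> s; rewrite (@eq_in_filter _ _ pred0) ?filter_pred0 // => p /flattenP[_ /mapP[e' + ->]].
  rewrite mem_iota add0n => /andP[_ He'] Hp; apply/negbTE; rewrite -leqNgt.
  apply: (Hle e' He'); rewrite -/(cellat t r.+1 e') in Hp.
  have He'N : e' < size (row t r.+1) by apply: leq_trans He' eN.
  move: Hp; rewrite inE => /orP[/eqP->|/mapP[z Hz ->]] /=; last by rewrite mem_cat Hz orbT.
  exact: (hk_mem Ht He'N).
case: ltnP => [ltN|geN]; last by have -> : N - e = 0 by apply/eqP; rewrite subn_eq0.
have -> : N - e = (N - e.+1).+1 by move: ltN; clear; lia.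
by rewrite [iota e _]/= [map _ (_ :: _)]/= [flatten (_ :: _)]/= -cat_cons filter_cat.
Qed.

Lemma set_row_upd t1 U : row t1 r.+1 = row t r.+1 ->
  set_nth [::] t1 r.+1 (set_nth dcell (row t r.+1) e U) = upd t1 r.+1 e (fun=> U).
Proof. by move=> E; rewrite /upd E. Qed.

Lemma row_upd_above g : row (upd t r c g) r.+1 = row t r.+1.
Proof. by rewrite {1}/row /upd nth_set_nth /= eqSn. Qed.

Lemma bumpE : bump t =
  let rowup := row t r.+1 in
  let cand := [seq p <- row_entries rowup | l < p.1] in
  let ct := if cand is p :: _ then p.2.1 else size rowup in
  let C := nth dcell rowup ct in
  if ct != c then
    let t1 := upd t r c (fun U => (take 1 U.1 ++ rem l (behead U.1), U.2)) in
    let C' :=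
      match cand with
      | [::] => ([:: l], [::])
      | (k, (_, true)) :: _ => (l :: ins k (behead C.1), C.2)
      | (k, (_, false)) :: _ => (head 0 C.1 :: ins k (behead C.1), ins l (rem k C.2))
      end in
    set_nth [::] t1 r.+1 (set_nth dcell rowup ct C')
  else
    let M := [seq z <- B.2 | l <= z <= last 0 B.2] in
    let t1 := upd t r c (fun U => (take 1 U.1 ++ rem l (behead U.1),
                                   [seq z <- U.2 | ~~ (l <= z <= last 0 B.2)])) in
    let C' :=
      match cand with
      | [::] => ([:: l], sort leq M)
      | (k, _) :: _ => (l :: ins k (behead C.1), sort leq (C.2 ++ M))
      end in
    set_nth [::] t1 r.+1 (set_nth dcell rowup ct C').
Proof.
rewrite /bump (negbTE top_excess); cbv zeta.
by rewrite top_leg_rowE top_colE -/B legmaxE.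
Qed.

Lemma filter_last (s : seq nat) : sorted leq s ->
  [seq z <- s | l <= z <= last 0 s] = [seq z <- s | l <= z] /\
  [seq z <- s | ~~ (l <= z <= last 0 s)] = [seq z <- s | z < l].
Proof.
move=> Hs; split; apply: eq_in_filter => z zs; rewrite (last_sorted_ge Hs zs) andbT // ltnNge //.
Qed.

Lemma B_validP : [/\ B.1 != [::], sorted ltn B.1, sorted leq B.2,
    (forall z, z \in entries B -> 0 < z)
    & forall z, z \in B.2 -> hook_entry B <= z].
Proof. exact: (md_validP Ht top_size). Qed.

Lemma rem_remE z : (z \in rem l B.1) = (z != l) && (z \in B.1).
Proof. by case: B_validP => _ H _ _ _; rewrite (mem_rem_uniq _ (ltn_uniq H)) inE. Qed.

Lemma rem_head : head 0 (rem l B.1) = hook_entry B /\ rem l B.1 != [::].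
Proof. by rewrite -take_rem /hook_entry; have := top_in; case: B.1 => //= x s _; rewrite take0. Qed.

Lemma down_valid arm1 : sorted leq arm1 -> {subset arm1 <= B.2} ->
  HVTP (upd t r c (fun U => (rem l U.1, arm1))).
Proof.
move=> Hs Hsub; have [V1 V2 V3 V4 V5] := B_validP; have [R1 R2] := rem_head.
apply: HVTP_upd_sub => //; first exact: top_size.
  apply/valid_hookP; rewrite -/B; split=> //=.
  - by apply: rem_sorted => //; exact: ltn_transitive.
  - by move=> z; rewrite mem_cat rem_remE => /orP[/andP[_ H]|/Hsub H]; apply: V4; rewrite mem_cat H ?orbT.
  by move=> z /Hsub H; rewrite {1}/hook_entry R1; apply: V5.
by rewrite -/B => z; rewrite !mem_cat rem_remE => /orP[/andP[_ ->]//|/Hsub->]; rewrite orbT.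
Qed.

Section HookTarget.
Hypothesis tgt : target m r l e BHook.

Lemma hook_le_c : e <= c.
Proof. by have := e_le_c vm top tgt; rewrite addn0. Qed.

Lemma hook_new : hk m r.+1 e = 0 \/ l < hk m r.+1 e.
Proof. by case: tgt. Qed.

Lemma hook_le_N : e <= N.
Proof.
case: tgt => _ H; case: e H => // e' /(_ e' erefl) [+ _].
by rewrite (hk_gt0 Ht).
Qed.

Lemma hook_left e' z : e' < e -> z \in entries (cellat t r.+1 e') -> z <= l.
Proof.
move=> He' Hz; have [_ H] := tgt.
have [h0 hle] := H e.-1 (esym (ltn_predK He')).
have Hin := entries_inrow Ht Hz.
have ez : ent m e' z by move: Hz; rewrite (mem_entries Ht) => /andP[].
have [E|ne] := eqVneq e' e.-1.
  by subst e'; case: (hle z ez) => // h; move: Hin; rewrite /inrow h andbF.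
have lt : e' < e.-1 by move: He' ne; clear; lia.
apply: leq_trans (inrow_ent_le vm ez Hin lt h0) _.
case: (hle _ (ent_hk vm h0)) => // h.
by have := hk_col vm (r := r.+1) (c := e.-1); move: h; clear; lia.
Qed.

Lemma hook_above z : z \in entries Be -> l < z.
Proof.
move=> Hz; have := hook_le Ht Hz; have := entries_in Hz; rewrite -(hk_gt0 Ht) -/m.
by have := hook_new; clear; lia.
Qed.

Let hookup arm1 arm2 := upd (upd t r c (fun U => (rem l U.1, arm1))) r.+1 e
  (fun=> (l :: Be.1, arm2)).

(** Treats (a) and (b) at once, with [arm1] and [arm2] the new arms of the lower and the upper cell.
    For [e = c] arm entries may pass upwards, but their total count is kept, which is all that
    [bmove] records. *)
Lemma hook_step arm1 arm2 :
  sorted leq arm1 -> {subset arm1 <= B.2} -> (e = c -> forall z, z \in arm1 -> z < l) ->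
  sorted leq arm2 -> (forall z, z \in arm2 -> z \in Be.2 \/ e = c /\ z \in B.2 /\ l <= z) ->
  (forall z, count_mem z arm2 + count_mem z arm1 = count_mem z Be.2 + count_mem z B.2) ->
  (e <> c -> forall z, count_mem z arm2 = count_mem z Be.2) ->
  HVTP (hookup arm1 arm2) /\ bmove m r c l e BHook (md (hookup arm1 arm2)).
Proof.
rewrite /hookup => s1 sub1 lt1 s2 sub2 cnt cnt'.
have Ht1 := down_valid s1 sub1; set t1 := upd t r c _ in Ht1 *.
have [V1 V2 V3 V4 V5] := B_validP.
have cE : cellat t1 r.+1 e = Be by rewrite cellat_upd eqSn.
have xlE : Be.1 = if e < N then [:: hk m r.+1 e] else [::].
  by case: ltnP => H; [exact: (above_xlE Ht top)|rewrite cellat_out].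
have U_ge z : z \in l :: Be.1 ++ arm2 -> l <= z.
  rewrite inE mem_cat => /or3P[/eqP->//|Hz|/sub2 [Hz|[_ [_ //]]]]; apply: ltnW; apply: hook_above.
    by rewrite mem_cat Hz.
  by rewrite mem_cat Hz orbT.
(* Each entry of the new cell was there before or lies below its old hook entry; either suffices
   against the cells to the right and above. *)
have U_in z : z \in l :: Be.1 ++ arm2 ->
    z \in entries Be \/ (e < N -> z < hk m r.+1 e).
  rewrite inE mem_cat => /or3P[/eqP->|Hz|/sub2 [Hz|[ec [Hz _]]]].
  - by right => eN; apply: hook_above; apply: (hk_mem Ht).
  - by left; rewrite mem_cat Hz.
  - by left; rewrite mem_cat Hz orbT.
  right=> eN; apply: (hv_up Ht (r := r) (c := c) (y := z)); first by rewrite mem_cat Hz orbT.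
  by rewrite -ec; apply: (hk_mem Ht).
have no_right z : z \in entries (cellat t r.+1 e.+1) -> e < N.
  by move/entries_in => H; apply: ltnW.
have no_up z : z \in entries (cellat t r.+2 e) -> e < N.
  by move/entries_in => H; apply: leq_trans H (hv_shape Ht r.+1).
split.
  apply: HVTP_upd => //.
  - by rewrite size_upd leq_maxl.
  - by rewrite size_row_upd eqSn hook_le_N.
  - by move=> _; rewrite size_row_upd eqxx leq_max ltnS hook_le_c.
  - apply/valid_hookP; split=> //=.
    + by rewrite xlE; case: ifP => // eN /=; rewrite andbT; apply: hook_above; apply: (hk_mem Ht).
    + move=> z /U_ge; apply: leq_trans; apply: V4; exact: top_ent.
    by move=> z Hz; apply: U_ge; rewrite inE mem_cat Hz !orbT.
  - move=> c0 y z ec; rewrite cellat_upd eqSn => Hy /U_ge; apply: leq_trans.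
    by apply: (hook_left (e' := c0)) => //; rewrite ec.
  - move=> y z /U_in Hy; rewrite cellat_upd eqSn => Hz; case: Hy => [Hy|Hy].
      exact: (hv_right Ht Hy Hz).
    apply: leq_trans (ltnW (Hy (no_right _ Hz))) _.
    by apply: (hv_right Ht (hk_mem Ht (no_right _ Hz)) Hz).
  - move=> r0 y z /succn_inj <-; rewrite cellat_upd eqxx /= => Hy /U_ge; apply: leq_trans.
    move: Hy; case: (e =P c) => [ec|/eqP ne].
      rewrite -/B mem_cat rem_remE => /orP[/andP[yl yB]|/(lt1 ec)//].
      have [hy|hy] := leqP y (hk m r c); first by apply: leq_ltn_trans hy _; have := top_hk top; case/andP.
      have : y \in leg B by rewrite (mem_leg Ht) /isleg hy; move: yB; rewrite (mem_xl Ht) andbC andbT => ->.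
      by case/top_leg_max => [|[_ [|[_]]]]; rewrite ?ltnn // ltn_neqAle yl.
    move=> Hy; have ec : e < c by rewrite ltn_neqAle ne hook_le_c.
    have hc := top_hk top; case/andP: hc => hc0 hcl.
    apply: leq_ltn_trans hcl; apply: (inrow_ent_le vm (r := r) (c := e)) => //.
      by move: Hy; rewrite (mem_entries Ht) => /andP[].
    exact: (entries_inrow Ht).
  move=> y z /U_in Hy; rewrite cellat_upd gtn_eqF //= => Hz; case: Hy => [Hy|Hy].
    exact: (hv_up Ht Hy Hz).
  apply: ltn_trans (Hy (no_up _ Hz)) _.
  by apply: (hv_up Ht (hk_mem Ht (no_up _ Hz)) Hz).
split=> [r' c'|c' z|c' z].
- rewrite md_hk_upd [fst _]/= [head _ _]/=; case: ifP => // _.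
  rewrite md_hk_upd [fst _]/= -/B (proj1 rem_head).
  by case: ifP => // /andP[/eqP-> /eqP->].
- have E1 := md_ex_upd t1 r.+1 e (fun=> (l :: Be.1, arm2)) c' z; rewrite cE in E1.
  have E2 := md_ex_upd t r c (fun U => (rem l U.1, arm1)) c' z.
  rewrite /at_ !(eq_sym z l) (delta_ins E1 (q := (l == z))) //.
  by rewrite addnAC; congr (_ + _); exact: delta_rem E2 (count_rem_mem z top_in).
have E1 := md_ar_upd t1 r.+1 e (fun=> (l :: Be.1, arm2)) c' z; rewrite cE in E1.
have E2 := md_ar_upd t r c (fun U => (rem l U.1, arm1)) c' z.
case: (e =P c) => [ec|ne]; first by rewrite -(_ : (c' == e) = (c' == c)) in E2; [exact: delta_swap E1 E2 (cnt z)|rewrite ec].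
have Hc : count_mem z arm1 = count_mem z B.2 by have := cnt z; rewrite (cnt' ne); apply: addnI.
exact: etrans (delta_keep E1 (cnt' ne z)) (delta_keep E2 Hc).
Qed.

Lemma bump_hook : HVTP (bump t) /\ bmove m r c l e BHook (md (bump t)).
Proof.
have Hcand := cand_split hook_le_N (fun e' H z => @hook_left e' z H).
have [V1 V2 V3 V4 V5] := B_validP.
have [F1 F2] := filter_last V3.
have tE arm1 : upd t r c (fun U => (take 1 U.1 ++ rem l (behead U.1), arm1 U.2)) =
   upd t r c (fun U => (rem l U.1, arm1 B.2)) by rewrite /upd -/B take_rem.
have C_sorted : sorted leq Be.2.
  by case: (ltnP e N) => [/(md_validP Ht) []//|H]; rewrite cellat_out.
have ctE : (if [seq p <- row_entries (row t r.+1) | l < p.1] is p :: _ then p.2.1 else size (row t r.+1)) = e.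
  rewrite Hcand; case: ltnP => [eN|eN] /=; last by apply/eqP; rewrite eqn_leq eN hook_le_N.
  by rewrite hook_above //; apply: (hk_mem Ht).
have candE : (e < N /\ exists u, [seq p <- row_entries (row t r.+1) | l < p.1] = (hk m r.+1 e, (e, true)) :: u)
    \/ (Be = dcell /\ [seq p <- row_entries (row t r.+1) | l < p.1] = [::]).
  rewrite Hcand; case: ltnP => [eN|eN]; last by right; rewrite cellat_out.
  left; split=> //=; rewrite hook_above; last exact: (hk_mem Ht).
  by eexists.
rewrite bumpE; cbv zeta; rewrite ctE -/Be.
have stepU arm1 arm2 U (P := fun t2 => HVTP t2 /\ bmove m r c l e BHook (md t2)) :
   U = (l :: Be.1, arm2) -> P (hookup (arm1 B.2) arm2) ->
   P (set_nth [::] (upd t r c (fun U => (take 1 U.1 ++ rem l (behead U.1), arm1 U.2))) r.+1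
      (set_nth dcell (row t r.+1) e U)).
  by move=> -> ; rewrite set_row_upd ?row_upd_above // tE.
have [ec|ec] := eqVneq e c; cbv beta iota delta [negb].
  pose M := [seq z <- B.2 | l <= z].
  have H arm2 : perm_eq arm2 (Be.2 ++ M) -> sorted leq arm2 ->
     HVTP (hookup [seq z <- B.2 | z < l] arm2) /\ bmove m r c l e BHook (md (hookup [seq z <- B.2 | z < l] arm2)).
    move=> Hp Hs; apply: hook_step => //.
    - by apply: (sorted_filter leq_trans).
    - by move=> z; rewrite mem_filter => /andP[].
    - by move=> _ z; rewrite mem_filter => /andP[].
    - move=> z; rewrite (perm_mem Hp) mem_cat mem_filter => /orP[Hz|/andP[lz zB]]; first by left.
      by right.
    move=> z; rewrite (permP Hp) count_cat -addnA; congr (_ + _).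
    rewrite -(permP (permEl (perm_filterC (leq l) B.2)) (pred1 z)) count_cat; congr (_ + count_mem z _).
    by apply: eq_filter => y /=; rewrite ltnNge.
  rewrite F1 -/M.
  case: candE => [[eN [u ->]]|[cE ->]];
    apply: (stepU (fun s => [seq z <- s | ~~ (l <= z <= last 0 B.2)]));
    rewrite ?(above_xlE Ht top eN) ?cE //; cbv beta; rewrite F2;
    by apply: H; rewrite ?perm_sort ?cE //; exact: (sort_sorted leq_total).
have H := @hook_step B.2 Be.2 V3 (fun z h => h) (fun E => False_ind _ (elimN eqP ec E))
  C_sorted (fun z h => or_introl h) (fun z => erefl) (fun _ z => erefl).
by case: candE => [[eN [u ->]]|[cE ->]]; apply: (stepU id Be.2) H;
  rewrite ?(above_xlE Ht top eN) ?cE.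
Qed.
End HookTarget.

Lemma bump_arm k : target m r l e (BArm k) ->
  HVTP (bump t) /\ bmove m r c l e (BArm k) (md (bump t)).
Proof.
move=> tgt; have [/andP[h0 hl] ak lk nk kmin] := tgt.
have [V1 V2 V3 V4 V5] := B_validP.
have ec : e < c by have := e_le_c vm top tgt; rewrite addn1.
have eN : e < N by rewrite -(hk_gt0 Ht).
have Hle e' : e' < e -> forall z, z \in entries (cellat t r.+1 e') -> z <= l.
  move=> He' z Hz; apply: leq_trans hl; apply: (inrow_ent_le vm (r := r.+1) (c := e')) => //.
    by move: Hz; rewrite (mem_entries Ht) => /andP[].
  exact: (entries_inrow Ht).
have Hin : inrow m r.+1 e k by rewrite /inrow h0 nk andbT; apply: ltnW; apply: leq_ltn_trans hl lk.
have kin : k \in Be.2 by rewrite (mem_arm Ht) Hin.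
have [W1 W2 W3 W4 W5] := md_validP Ht eN.
have hook0 : hook_entry Be <= l := hl.
have candE : exists u, [seq p <- row_entries (row t r.+1) | l < p.1] = (k, (e, false)) :: u.
  rewrite (cand_split (ltnW eN) Hle) eN [filter _ (_ :: _)]/= ltnNge hook0 /=.
  rewrite filter_map; have [|s' E] := filter_gt_head W3 kin lk.
    by move=> z Hz; apply: kmin; rewrite /ent addn_gt0; move: Hz; rewrite (mem_arm Ht) => /andP[_ ->]; exact: orbT.
  have -> : [seq x <- Be.2 | preim (fun z => (z, (e, false))) (fun p : nat * (nat * bool) => l < p.1) x] = k :: s' by [].
  by eexists.
have [u Eu] := candE.
rewrite bumpE; cbv zeta; rewrite Eu; cbv beta iota; rewrite [(k, (e, false)).2.1]/=.
rewrite -/Be ltn_eqF //; cbv beta iota delta [negb].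
rewrite set_row_upd ?row_upd_above // (above_xlE Ht top eN) [behead _]/= [head _ _]/=.
have -> : ins k [::] = [:: k] by [].
have tE : upd t r c (fun U => (take 1 U.1 ++ rem l (behead U.1), U.2)) = upd t r c (fun U => (rem l U.1, B.2)).
  by rewrite /upd -/B take_rem.
rewrite tE; have [Ht1 [h1 e1 a1]] := remove_ext (g := fun U => (rem l U.1, B.2)) Ht erefl top_in
  (proj1 rem_head) (V4 _ (hk_mem Ht top_size)) V5.
set t1 := upd t r c _ in Ht1 h1 e1 a1 *.
have cE : cellat t1 r.+1 e = Be by rewrite cellat_upd eqSn.
set U := ([:: hk m r.+1 e; k], ins l (rem k Be.2)).
split.
  apply: (HVTP_upd_in (x := l)) => //; rewrite ?cE.
  - by rewrite size_row_upd eqSn.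
  - apply/valid_hookP; split=> //=.
    + by rewrite andbT; apply: leq_ltn_trans hl lk.
    + exact: ins_sorted.
    + move=> z; rewrite /entries /= !inE mem_ins => /or4P[/eqP->//|/eqP->|/eqP->|/mem_rem Hz].
      * by apply: leq_ltn_trans lk.
      * by apply: V4; exact: top_ent.
      by apply: W4; rewrite mem_cat Hz orbT.
    by move=> z; rewrite mem_ins => /orP[/eqP->|/mem_rem/W5].
  - move=> z; rewrite /entries /= !inE mem_ins mem_cat => /or4P[/eqP->|/eqP->|->//|/mem_rem->].
    + by rewrite (hook_in Ht eN) orbT.
    + by rewrite kin !orbT.
    by rewrite !orbT.
  - by move=> c0 y dc; rewrite cellat_upd eqSn => Hy; apply: (Hle c0 _ y Hy); rewrite dc.
  - move=> z; rewrite cellat_upd eqSn => Hz; apply: leq_trans (ltnW lk) _.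
    by apply: (hv_right Ht (r := r.+1) (c := e)) Hz; rewrite mem_cat kin orbT.
  - move=> r0 y /succn_inj <-; rewrite cellat_upd eqxx ltn_eqF //= => Hy.
    have := top_hk top; case/andP=> hc0 hcl; apply: leq_ltn_trans hcl.
    apply: (inrow_ent_le vm (r := r) (c := e)) => //.
      by move: Hy; rewrite (mem_entries Ht) => /andP[].
    exact: (entries_inrow Ht).
  move=> z; rewrite cellat_upd gtn_eqF //= => Hz; apply: ltn_trans lk _.
  by apply: (hv_up Ht (r := r.+1) (c := e)) Hz; rewrite mem_cat kin orbT.
split=> [r' c'|c' z|c' z].
- rewrite md_hk_upd; case: ifP => [/andP[/eqP-> /eqP->] //|_].
  by rewrite h1; case: ifP => // /andP[/eqP-> /eqP->].
- have E1 := md_ex_upd t1 r.+1 e (fun=> U) c' z; rewrite cE in E1.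
  rewrite (delta_ins E1 (q := (k == z))); last by rewrite (above_xlE Ht top eN) /= addn0 addnCA addnC addn0 addnC.
  by rewrite -e1 /at_ !(eq_sym z) addnAC.
have E1 := md_ar_upd t1 r.+1 e (fun=> U) c' z; rewrite cE in E1.
rewrite -a1 /at_ !(eq_sym z).
by apply: delta_move E1 _ (count_rem_mem z kin); exact: count_ins.
Qed.
End BumpSpec.

(** * Uncrowding *)

Lemma bump_id t : leg_excess t = 0 -> bump t = t.
Proof. by move=> E; rewrite /bump E. Qed.

Lemma bump_at t r c l e bk : HVTP t -> topleg (md t) r c l -> target (md t) r l e bk ->
  HVTP (bump t) /\ bmove (md t) r c l e bk (md (bump t)).
Proof. by move=> Ht top; case: bk => [|k] tgt; [apply: bump_hook|apply: bump_arm]. Qed.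

Lemma bump_some t : HVTP t -> leg_excess t != 0 -> exists r c l e bk,
  [/\ topleg (md t) r c l, target (md t) r l e bk, HVTP (bump t)
    & bmove (md t) r c l e bk (md (bump t))].
Proof.
move=> Ht H; have [r [c [l top]]] := topleg_ex Ht H.
have [e [bk tgt]] := target_ex Ht top.
by have [H1 H2] := bump_at Ht top tgt; exists r, c, l, e, bk.
Qed.

Lemma bump_HVTP t : HVTP t -> HVTP (bump t).
Proof.
move=> Ht; have [E|ne] := eqVneq (leg_excess t) 0; first by rewrite bump_id.
by have [r [c [l [e [bk []]]]]] := bump_some Ht ne.
Qed.

(** Turns the stopping test of [vloop] into one on the leg excess, which [f_i] preserves. A genuine
    bump is visible in the model: a hook entry becomes [l], or the extended legs of column [e] gain
    a [k]. *)
Lemma bump_fix t : HVTP t -> (bump t == t) = (leg_excess t == 0).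
Proof.
move=> Ht; apply/idP/idP => [/eqP E|/eqP/bump_id/eqP//]; apply/negPn/negP => ne.
have [r [c [l [e [bk [top tgt _]]]]]] := bump_some Ht ne; rewrite E.
have l0 : 0 < l by have := top_hk top; clear; lia.
have ec := e_le_c (md_valid Ht) top tgt.
case: bk tgt ec => [|k] tgt ec [Hh He Ha].
  have := Hh r.+1 e; rewrite !eqxx /= => Eh; case: tgt => + _.
  by rewrite -/(hk _ _ _) /= Eh; move: l0; clear; lia.
have := He e k; rewrite /at_ !eqxx.
have -> : (e == c) = false by move: ec; rewrite /=; clear; lia.
by move=> /addnI.
Qed.

Lemma fkind_uniq m i d k k' : fkind_at m i d k -> fkind_at m i d k' -> k = k'.
Proof.
case: k k' => [] [] //=.
- by move=> [+ _] [E _]; rewrite E.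
- by move=> [_ H] /H.
- by move=> [E _] [+ _]; rewrite E.
- by move=> [_ H] /H.
- by move=> H [_ /(_ H)].
by move=> H [_ /(_ H)].
Qed.

Lemma shape_eq t t' : HVTP t -> HVTP t' ->
  (forall r c, (0 < hk (md t') r c) = (0 < hk (md t) r c)) -> shape t' = shape t.
Proof.
move=> Ht Ht' H; have [E Hs] := hk_shape Ht Ht' H.
by apply: (@eq_from_nth _ 0); rewrite ?size_map // => r rt; rewrite !(nth_map [::]) -?E //; apply: Hs.
Qed.

Lemma top_leg_row0 t : leg_excess t = 0 -> top_leg_row t = 0.
Proof.
move/eqP; rewrite leg_excess_eq0 => /allP H; rewrite /top_leg_row.
rewrite (@eq_in_filter _ _ pred0) ?filter_pred0 // => r; rewrite mem_iota => /andP[_ rt].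
apply/negbTE/hasPn => U HU; rewrite negbK; apply: H; apply/flattenP; exists (row t r) => //.
exact: mem_nth.
Qed.

Section Commutation.
Variable i : nat.
Hypothesis i0 : 0 < i.

Let a t := na (md t) i.
Let b t := nb (md t) i.

Lemma na_out t x : HVTP t -> size (row t 0) <= x -> a t x = 0 /\ b t x = 0.
Proof.
move=> Ht Hx; have H z := md_narrow Ht z Hx.
by rewrite /a /b /na /nb !(proj1 (H _)) !(proj2 (H _)).
Qed.

Lemma f_op_cases t : HVTP t ->
  (f_op i t = None /\ all_paired (a t) (b t)) \/
  exists d k t', [/\ last_minus (a t) (b t) d, f_op i t = Some t', HVTP t', fkind_at (md t) i d k
     & fmove (md t) i d k (md t') /\ leg_excess t' = leg_excess t].
Proof.
move=> Ht; have := @last_minus_ex (a t) (b t) (size (row t 0)) (fun x Hx => proj1 (na_out Ht Hx)).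
case=> [H|[d Hd]]; first by left; rewrite f_op_none.
by right; have [k [t' [H1 H2 H3 H4 H5]]] := f_op_some Ht i0 Hd; exists d, k, t'.
Qed.

Definition fstep t t' := [/\ HVTP t, HVTP t' & f_op i t = Some t'].

(** Gathers what the control flow of uncrowding depends on and hands the relation to the bumped
    pair; the following lemmas iterate it. *)
Lemma fstep_shape t t' : fstep t t' ->
  [/\ shape t' = shape t, leg_excess t' = leg_excess t, top_leg_row t' = top_leg_row t
    & fstep (bump t) (bump t')].
Proof.
case=> Ht Ht' Hf; case: (f_op_cases Ht) => [[E]|[d [k [t0 [Hd E _ Hk [Hm Hl]]]]]]; first by rewrite E in Hf.
have E' : t0 = t' by move: E; rewrite Hf => -[].
subst t0; have Hs : shape t' = shape t by apply: shape_eq => // r c; rewrite (fmove_hk_gt0 i0 Hm).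
have [E0|ne] := eqVneq (leg_excess t) 0.
  by rewrite !top_leg_row0 ?Hl // !bump_id ?Hl.
have [r [c [l [e [bk [top tgt Hb1 Hb2]]]]]] := bump_some Ht ne.
have [d' [k' [c' [l' [e' [bk' [H1 H2 H3 H4 H5]]]]]]] :=
  bump_commutes (md_valid Ht) i0 top tgt Hd Hk Hm Hb2.
have [Hb1' Hb2'] := bump_at Ht' H3 H4.
split=> //; first by rewrite (top_leg_rowE Ht' H3) (top_leg_rowE Ht top).
have [k3 [t3 [F1 F2 F3 F4 _]]] := f_op_some Hb1 i0 H1.
rewrite (fkind_uniq F3 H2) in F4.
by split=> //; rewrite F1; congr Some; apply: md_inj => //; apply: H5.
Qed.

Lemma fstep_vloop n t t' : fstep t t' -> fstep (vloop n t) (vloop n t').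
Proof.
elim: n t t' => //= n IH t t' H; have [Hs Hl _ Hb] := fstep_shape H.
have [Hsb _ _ _] := fstep_shape Hb; case: H => Ht Ht' _.
rewrite !bump_fix // Hl Hs Hsb; case: ifP => // _; exact: IH.
Qed.

Lemma fstep_ins t t' : fstep t t' -> fstep (uncrowd_ins t) (uncrowd_ins t').
Proof.
move=> H; have [Hs _ _ _] := fstep_shape H; rewrite /uncrowd_ins.
by rewrite -(size_map size t') -/(shape t') Hs size_map; apply: fstep_vloop.
Qed.

Lemma shape_row t r : size (row t r) = nth 0 (shape t) r.
Proof.
by rewrite /row /shape; case: (ltnP r (size t)) => H; [rewrite (nth_map [::])|rewrite !nth_default ?size_map].
Qed.

Lemma fstep_uloop n P P' Q : fstep P P' ->
  fstep (uloop n P Q).1 (uloop n P' Q).1 /\ (uloop n P Q).2 = (uloop n P' Q).2.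
Proof.
elim: n P P' Q => //= n IH P P' Q H; have Hi := fstep_ins H.
have [Hs _ Htop _] := fstep_shape H; have [Hs' _ _ _] := fstep_shape Hi.
have E : new_row P (uncrowd_ins P) = new_row P' (uncrowd_ins P').
  rewrite /new_row -(size_map size (uncrowd_ins P)) -(size_map size (uncrowd_ins P')) -!/(shape _) Hs'.
  by apply: eq_find => j; rewrite !shape_row Hs Hs'.
by rewrite Htop -E; apply: IH.
Qed.

Lemma fstep_uncrowd t t' : fstep t t' ->
  fstep (Ptilde t) (Ptilde t') /\ Qtilde t = Qtilde t'.
Proof.
move=> H; have [Hs Hl _ _] := fstep_shape H; rewrite /Ptilde /Qtilde /uncrowd Hl.
have Hq (s : hvt) : [seq nseq (size rw) (None : option nat) | rw <- s] = [seq nseq n None | n <- shape s].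
  by rewrite -map_comp.
rewrite !Hq Hs; exact: fstep_uloop.
Qed.

(** Uncrowding produces its tableau by bumps alone, whatever the loops count. *)
Lemma Ptilde_ind (K : hvt -> Prop) : (forall t, K t -> K (bump t)) -> forall t, K t -> K (Ptilde t).
Proof.
move=> HK t; rewrite /Ptilde /uncrowd.
have Hv n u : K u -> K (vloop n u).
  by elim: n u => //= n IH u Hu; case: ifP => _; [apply: HK|apply: IH; apply: HK].
move: (leg_excess t) [seq _ | _ <- t] => n; elim: n t => //= n IH u Q Hu.
by apply: IH; apply: Hv.
Qed.

Lemma bump_sig_some t : HVTP t ->
  (all_paired (a t) (b t) -> all_paired (a (bump t)) (b (bump t))) /\
  pend_stable (a t) (b t) (a (bump t)) (b (bump t)).
Proof.
move=> Ht; have [E|ne] := eqVneq (leg_excess t) 0.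
  by rewrite bump_id //; split=> //; exists 0.
have [r [c [l [e [bk [top tgt _ Hb]]]]]] := bump_some Ht ne.
by have [H1 H2 _] := bump_sig (md_valid Ht) top tgt Hb i0.
Qed.

Lemma pend_out t N x : HVTP t -> size (row t 0) <= N -> N <= x ->
  pend (a t) (b t) x = pend (a t) (b t) N.
Proof.
move=> Ht HN; elim: x => [|x IH] Hx; first by have -> : N = 0 by move: Hx; clear; lia.
have [->//|ne] := eqVneq N x.+1.
have [H1 H2] := na_out Ht (x := x) ltac:(move: HN Hx ne; clear; lia).
by rewrite /= H1 H2 subn0 addn0 IH //; move: Hx ne; clear; lia.
Qed.

Lemma f_none_uncrowd t : HVTP t -> f_op i t = None -> f_op i (Ptilde t) = None.
Proof.
move=> Ht Hf; have Hp : all_paired (a t) (b t).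
  by case: (f_op_cases Ht) => [[]//|[d [k [t' [_ E _ _ _]]]]]; rewrite E in Hf.
suff [H1 H2] : HVTP (Ptilde t) /\ all_paired (a (Ptilde t)) (b (Ptilde t)) by apply: f_op_none.
apply: (@Ptilde_ind (fun u => HVTP u /\ all_paired (a u) (b u))) => // u [H1 H2].
by split; [apply: bump_HVTP|apply: (proj1 (bump_sig_some H1))].
Qed.

(** Stated far to the right, so that [pend_stable] carries it along the bumps. *)
Definition no_plus t := exists N, forall x, N <= x -> pend (a t) (b t) x = 0.

(** A value of [e_i] is expressed as a preimage under [f_i]; the commutation with bumps is then
    borrowed from [f_i]. *)
Lemma e_op_cases t : HVTP t ->
  (e_op i t = None /\ no_plus t) \/ exists t', e_op i t = Some t' /\ fstep t' t.
Proof.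
move=> Ht; case: (first_plus_ex (a t) (b t) (size (row t 0))) => [E|[d Hd]]; [left|right].
  split; first exact: e_op_none.
  by exists (size (row t 0)) => x Hx; rewrite (pend_out Ht (leqnn _)).
have [k [t' [H1 H2 H3 H4]]] := e_op_some Ht i0 Hd; exists t'; split=> //.
have [d' [K1 K2 K3]] := emove_inverse (md_valid Ht) (md_narrow Ht) i0 (md_valid H2) Hd H3 H4.
have [k3 [t3 [F1 F2 F3 F4 _]]] := f_op_some H2 i0 K1.
rewrite (fkind_uniq F3 K2) in F4.
by split=> //; rewrite F1; congr Some; apply: md_inj => //; apply: K3.
Qed.

Lemma e_none_uncrowd t : HVTP t -> e_op i t = None -> e_op i (Ptilde t) = None.
Proof.
move=> Ht He; have Hp : no_plus t.
  by case: (e_op_cases Ht) => [[]//|[t' [E _]]]; rewrite E in He.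
suff [H1 [N HN]] : HVTP (Ptilde t) /\ no_plus (Ptilde t).
  apply: e_op_none => //; rewrite -/(a _) -/(b _).
  by rewrite -(pend_out H1 (leqnn _) (leq_maxl _ N)) HN // leq_maxr.
apply: (@Ptilde_ind (fun u => HVTP u /\ no_plus u)) => // u [H1 [N HN]].
split; first exact: bump_HVTP.
have [N' HN'] := proj2 (bump_sig_some H1); exists (maxn N N') => x.
by rewrite geq_max => /andP[h1 h2]; rewrite HN' // HN.
Qed.

Lemma ekind_uniq m d k k' : ekind_at m i d k -> ekind_at m i d k' -> k = k'.
Proof.
case: k k' => [] [] //=.
- by move=> [_ H _] [H1 H2 _]; rewrite H in H1.
- by move=> [_ _ H] /H.
- by move=> [H1 H2 _] [_ H _]; rewrite H in H1.
- by move=> [_ _ H] /H.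
- by move=> H [_ _ /(_ H)].
by move=> H [_ _ /(_ H)].
Qed.

Lemma fstep_inverse t t' : fstep t t' -> e_op i t' = Some t.
Proof.
case=> Ht Ht' Hf; case: (f_op_cases Ht) => [[E]|[d [k [t0 [Hd E _ Hk [Hm _]]]]]]; first by rewrite E in Hf.
have E' : t0 = t' by move: E; rewrite Hf => -[].
subst t0.
have [d' [K1 K2 K3]] := fmove_inverse (md_valid Ht) (md_narrow Ht) i0 Hd Hk Hm.
(* [fmove_inverse] uses the width of [t] and [e_op_some] that of [t']. *)
have Es : size (row t' 0) = size (row t 0).
  have [Hs _ _ _] := fstep_shape (And3 Ht Ht' Hf).
  by rewrite !shape_row Hs.
rewrite -Es in K1; have [k3 [t3 [F1 F2 F3 F4]]] := e_op_some Ht' i0 K1.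
rewrite (ekind_uniq F3 K2) in F4.
by rewrite F1; congr Some; apply: md_inj => //; apply: K3.
Qed.
End Commutation.

Theorem theorem3p38 (T : hvt) (i : nat) :
  is_HVT T -> 0 < i ->
  [/\ (f_op i T = None -> f_op i (Ptilde T) = None),
      (e_op i T = None -> e_op i (Ptilde T) = None),
      (forall T', f_op i T = Some T' ->
         f_op i (Ptilde T) = Some (Ptilde T') /\ Qtilde T = Qtilde T') &
      (forall T', e_op i T = Some T' ->
         e_op i (Ptilde T) = Some (Ptilde T') /\ Qtilde T = Qtilde T')].
Proof.
move=> /HVT_iff HT i0; split=> [| |T' H|T' H].
- exact: f_none_uncrowd.
- exact: e_none_uncrowd.
- case: (f_op_cases i0 HT) => [[E]|[d [k [t' [_ E HT' _ _]]]]]; first by rewrite E in H.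
  have E' : t' = T' by move: E; rewrite H => -[].
  by subst t'; have [[_ _ H1] H2] := fstep_uncrowd i0 (And3 HT HT' H).
case: (e_op_cases i0 HT) => [[E]|[t' [E Hs]]]; first by rewrite E in H.
have E' : t' = T' by move: E; rewrite H => -[].
(* Here [f_i] maps [T'] to [T], so the commutation for [f_i] is applied to [T'] and then
   inverted. *)
subst t'; have [Hs' ->] := fstep_uncrowd i0 Hs.
by rewrite (fstep_inverse i0 Hs').
Qed.
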